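(* The set of $f\in C$ such that $\omega_1^{\mathbf S,f}=\omega_1^{\mathbf S}$ has $\mathbf m$-measure $1$.
   Context: $C=\{0,1\}^{\mathbb N}$, $\mathbf m$ the completed uniform product measure. The Suslin functional: $\mathbf S(g)=0$ if $\forall h\in\mathbb N^{\mathbb N}\exists n\,g(\bar h(n))=0$, and $1$ if $\exists h\forall n\,g(\bar h(n))>0$, $\bar h(n)=\langle h(0),\dots,h(n-1)\rangle$; computability is Kleene computability (S1–S9). $\omega_1^{\mathbf S}$ is the supremum of the ordinal ranks of terminating computations $\{e\}(\mathbf S,\vec a)=b$ with integer arguments only (the least recursively inaccessible ordinal); $\omega_1^{\mathbf S,f}$ is the corresponding ordinal relativised to $f$, i.e. the supremum of ranks of terminating computations $\{e\}(\mathbf S,\vec a,f)=b$ (equivalently the least ordinal not the order type of a well-ordering of a subset of $\mathbb N$ computable in $\mathbf S$ and $f$). *)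

(* Defs.v *)
From HB Require Import structures.
From mathcomp Require Import all_boot all_order all_algebra.
From Stdlib Require Import ClassicalEpsilon.
Set Implicit Arguments. Unset Strict Implicit. Unset Printing Implicit Defensive.
Import Order.TTheory GRing.Theory Num.Theory.

Definition cantor := nat -> bool.

Definition extends (f : cantor) (s : seq bool) : Prop :=
  forall i, i < size s -> f i = nth false s i.

Definition cyl_measure (s : seq bool) : rat := (2%:Q ^- size s)%R.

Definition m_null (A : cantor -> Prop) : Prop :=
  forall eps : rat, (0 < eps)%R ->
    exists s : nat -> seq bool,
      (forall f, A f -> exists k, extends f (s k)) /\
      (forall n, (\sum_(k < n) cyl_measure (s k) <= eps)%R).

(* For the completed product measure m: A is measurable with m(A) = 1
   iff its complement is m-null. *)
Definition m_measure_one (A : cantor -> Prop) : Prop :=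
  m_null (fun f => ~ A f).

Definition bar (h : nat -> nat) (n : nat) : nat := CodeSeq.code (mkseq h n).

Definition Suslin (g : nat -> nat) : nat :=
  if excluded_middle_informative (exists h : nat -> nat, forall n, 0 < g (bar h n))
  then 1 else 0.

(* Kleene computability (schemes S1-S9) relative to a type-2 functional *)
(* F and a list of type-1 arguments.                                   *)

Inductive kcode : Type :=
| Csucc
| Cconst of nat
| Cid
| Ccomp of kcode & kcode
| Cpr of kcode & kcode
| Cswap of nat & kcode       (* S6 : permutation (transposition 0 <-> i) *)
| Capp of nat
| Cfun of kcode
| Cenum.

Fixpoint kenc (c : kcode) : GenTree.tree nat :=
  match c with
  | Csucc => GenTree.Node 0 [::]
  | Cconst q => GenTree.Node 1 [:: GenTree.Leaf q]
  | Cid => GenTree.Node 2 [::]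
  | Ccomp a b => GenTree.Node 3 [:: kenc a; kenc b]
  | Cpr a b => GenTree.Node 4 [:: kenc a; kenc b]
  | Cswap i a => GenTree.Node 5 [:: GenTree.Leaf i; kenc a]
  | Capp k => GenTree.Node 6 [:: GenTree.Leaf k]
  | Cfun a => GenTree.Node 7 [:: kenc a]
  | Cenum => GenTree.Node 8 [::]
  end.

Fixpoint kdec (t : GenTree.tree nat) : option kcode :=
  match t with
  | GenTree.Node 0 [::] => Some Csucc
  | GenTree.Node 1 [:: GenTree.Leaf q] => Some (Cconst q)
  | GenTree.Node 2 [::] => Some Cid
  | GenTree.Node 3 [:: a; b] =>
      match kdec a, kdec b with Some x, Some y => Some (Ccomp x y) | _, _ => None end
  | GenTree.Node 4 [:: a; b] =>
      match kdec a, kdec b with Some x, Some y => Some (Cpr x y) | _, _ => None end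
  | GenTree.Node 5 [:: GenTree.Leaf i; a] =>
      match kdec a with Some x => Some (Cswap i x) | None => None end
  | GenTree.Node 6 [:: GenTree.Leaf k] => Some (Capp k)
  | GenTree.Node 7 [:: a] =>
      match kdec a with Some x => Some (Cfun x) | None => None end
  | GenTree.Node 8 [::] => Some Cenum
  | _ => None
  end.

Lemma kencK : pcancel kenc kdec.
Proof. by elim=> //= [a -> b ->|a -> b ->|i a ->|a ->]. Qed.

HB.instance Definition _ := Countable.copy kcode (pcan_type kencK).

Definition swap0 (i : nat) (a : seq nat) : seq nat :=
  set_nth 0 (set_nth 0 a 0 (nth 0 a i)) i (nth 0 a 0).

(* Comp F al e a z  :<=>  {e}(F, a, al) = z  (a terminating computation) *)
Inductive Comp (F : (nat -> nat) -> nat) (al : seq (nat -> nat))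
  : kcode -> seq nat -> nat -> Prop :=
| C_succ x a : Comp F al Csucc (x :: a) x.+1
| C_const q a : Comp F al (Cconst q) a q
| C_id x a : Comp F al Cid (x :: a) x
| C_comp e1 e2 a y z :
    Comp F al e2 a y -> Comp F al e1 (y :: a) z -> Comp F al (Ccomp e1 e2) a z
| C_pr0 e1 e2 a z : Comp F al e1 a z -> Comp F al (Cpr e1 e2) (0 :: a) z
| C_prS e1 e2 n a y z :
    Comp F al (Cpr e1 e2) (n :: a) y -> Comp F al e2 (y :: n :: a) z ->
    Comp F al (Cpr e1 e2) (n.+1 :: a) z
| C_swap i e1 a z :
    i < size a -> Comp F al e1 (swap0 i a) z -> Comp F al (Cswap i e1) a z
| C_app k x a : k < size al -> Comp F al (Capp k) (x :: a) (nth (fun _ => 0) al k x)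
| C_fun e1 a (g : nat -> nat) :
    (forall x, Comp F al e1 (x :: a) (g x)) -> Comp F al (Cfun e1) a (F g)
| C_enum n a c z :
    unpickle n = Some c -> Comp F al c a z -> Comp F al Cenum (n :: a) z.

Definition computable_rel (F : (nat -> nat) -> nat) (al : seq (nat -> nat))
    (R : nat -> nat -> Prop) : Prop :=
  exists e : kcode, forall x y,
    (R x y -> Comp F al e [:: x; y] 0) /\ (~ R x y -> Comp F al e [:: x; y] 1).

(* R is a (reflexive) well-ordering of its field {x | R x x} *)
Definition wellordering (R : nat -> nat -> Prop) : Prop :=
  [/\ (forall x y, R x y -> R x x /\ R y y),
      (forall x y, R x y -> R y x -> x = y),
      (forall x y z, R x y -> R y z -> R x z),
      (forall x y, R x x -> R y y -> R x y \/ R y x)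
    & (forall P : nat -> Prop, (exists x, P x /\ R x x) ->
         exists m, [/\ P m, R m m & forall y, P y -> R y y -> R m y])].

Definition otype_le (R Q : nat -> nat -> Prop) : Prop :=
  exists h : nat -> nat,
    (forall x, R x x -> Q (h x) (h x)) /\
    (forall x y, R x y -> x <> y -> Q (h x) (h y) /\ h x <> h y).

(* sup of order types of (F,al)-computable well-orderings
   <= sup of order types of (G,bl)-computable well-orderings *)
Definition omega1_le (F : (nat -> nat) -> nat) (al : seq (nat -> nat))
    (G : (nat -> nat) -> nat) (bl : seq (nat -> nat)) : Prop :=
  forall R, wellordering R -> computable_rel F al R ->
    exists Q, [/\ wellordering Q, computable_rel G bl Q & otype_le R Q].

Definition omega1_S_f_eq (f : cantor) : Prop :=
  omega1_le Suslin [:: fun n => nat_of_bool (f n)] Suslin [::] /\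
  omega1_le Suslin [::] Suslin [:: fun n => nat_of_bool (f n)].

(* Main.v *)
(* Let [kappa] be the supremum of the well-orderings computable in [S].  Random
   computations are followed along an [S]-computable well-ordering [w]: the set
   of points [f] at which a given computation from [S] and [f] is completed at
   a given stage of [w] is approximated by clopen sets, in the sense of outer
   measure and uniformly computably in [S], because [S] decides how large the
   result of a Suslin operation on clopen sets is.

   The schemes other than S8 cannot lead beyond [kappa].  For S8, with countably
   many premises, Sacks's argument applies: the set of points at which the first
   [n] premises are completed below [kappa] already exceeds a given bound at
   some [S]-computable well-ordering [w_n]; Gandy selection for [S] makes
   [n |-> w_n] computable, and the sum of all [w_n] bounds the stage of the
   conclusion outside a set of small measure.  Hence for almost all [f] every
   convergent computation from [S] and [f] is completed below [kappa].  Applied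
   to a program that recurses along a well-ordering computable in [S] and [f],
   this embeds the well-ordering into an [S]-computable one. *)

Require Import Defs.
From mathcomp Require Import all_boot all_order all_algebra.
From mathcomp Require Import zify ring lra.
From Stdlib Require Import ClassicalEpsilon Classical FunctionalExtensionality.
Set Implicit Arguments. Unset Strict Implicit. Unset Printing Implicit Defensive.

(** * Programs for the schemes S1-S9 *)

(** Outer measure is used because it carries over to arbitrary sets what the argument needs: it is
    continuous along increasing sequences, and when two sets cover the space, compactness bounds the
    outer measure of their intersection by inclusion-exclusion. Measurability of the sets of points
    never has to be established.

    The size of a Suslin result is decidable in [S] by capacitability. If the result has outer
    measure above [q], some function [h] bounding the paths keeps all clopen approximations along
    [h] above [q]; conversely König's lemma puts the intersection of these approximations inside the
    result. The existence of [h] is again a Suslin operation on decidable data.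

    The obstacle in Sacks's argument is effectiveness: that [w_n] is a good choice is only
    semidecidable, because totality of its program is, and a noncomputable choice would give a sum
    that is not computable in [S]. Both selection and the approximations have to inspect
    computations, so computations are recast as numbers with four kinds of transitions, and the
    decoding of program indices has to be carried out by a program. *)

Lemma Comp_inv F al e a z : Comp F al e a z ->
  match e with
  | Csucc => exists x a', a = x :: a' /\ z = x.+1
  | Cconst q => z = q
  | Cid => exists x a', a = x :: a' /\ z = x
  | Ccomp e1 e2 => exists2 y, Comp F al e2 a y & Comp F al e1 (y :: a) z
  | Cpr e1 e2 =>
      match a with
      | [::] => False
      | 0 :: a' => Comp F al e1 a' z
      | n.+1 :: a' => exists2 y,
          Comp F al (Cpr e1 e2) (n :: a') y & Comp F al e2 (y :: n :: a') z
      end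
  | Cswap i e1 => i < size a /\ Comp F al e1 (swap0 i a) z
  | Capp k => k < size al /\
      if a is x :: _ then z = nth (fun _ => 0) al k x else False
  | Cfun e1 => exists2 g, (forall x, Comp F al e1 (x :: a) (g x)) & z = F g
  | Cenum => if a is n :: a' then
        exists2 c, unpickle n = Some c & Comp F al c a' z else False
  end.
Proof. by case; eauto. Qed.

Lemma Comp_det F al e a y z : Comp F al e a y -> Comp F al e a z -> y = z.
Proof.
move=> H; elim: H z => {e a y}.
- by move=> x a z /Comp_inv[x' [a' [[-> _] ->]]].
- by move=> x a z /Comp_inv.
- by move=> x a z /Comp_inv[x' [a' [[-> _] ->]]].
- move=> e1 e2 a y z _ IH1 _ IH2 z' /Comp_inv[y' h1 h2].
  by apply: IH2; rewrite (IH1 _ h1).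
- by move=> e1 e2 a z _ IH z' /Comp_inv /IH.
- move=> e1 e2 n a y z _ IH1 _ IH2 z' /Comp_inv[y' h1 h2].
  by apply: IH2; rewrite (IH1 _ h1).
- by move=> i e1 a z _ _ IH z' /Comp_inv[_ /IH].
- by move=> k x a _ z' /Comp_inv[_ ->].
- move=> e1 a g _ IH z' /Comp_inv[g' h ->]; congr F.
  by apply: functional_extensionality => x; apply: IH; apply: h.
- move=> n a c z hc _ IH z' /Comp_inv[c'].
  by rewrite hc => -[<-] /IH.
Qed.

Lemma Comp_nil F al e a z : Comp F [::] e a z -> Comp F al e a z.
Proof.
by elim=> {e a z}; eauto using Comp.
Qed.

(** Recursion on the first argument whose step repeats the previous value: the effect is to drop
    that argument. *)
Definition wk e := Cpr e Cid.

Lemma wkE F al e x a z : Comp F al (wk e) (x :: a) z <-> Comp F al e a z.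
Proof.
elim: x z => [|x IH] z; split=> H.
- exact: Comp_inv H.
- exact: C_pr0.
- by case/Comp_inv: H => y /IH h /Comp_inv[x' [a' [[<- _] ->]]].
- by apply: (C_prS (y := z)); [apply/IH | apply: C_id].
Qed.

Lemma wkE_iter F al e b a z :
  Comp F al (iter (size b) wk e) (b ++ a) z <-> Comp F al e a z.
Proof. by elim: b => //= x b IH; rewrite wkE. Qed.

Definition cvar i := Cswap i Cid.

Lemma cvarP F al i a : i < size a -> Comp F al (cvar i) a (nth 0 a i).
Proof.
move=> hi; apply: C_swap => //; rewrite /swap0.
case: a hi => [|x a] //; case: i => [|i] hi /=; exact: C_id.
Qed.

(* Environments cannot be truncated from below directly: [sink] moves the top
   [m] entries into the last [m] places and then drops everything above. *)
Fixpoint sink m B e :=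
  match m with
  | 0 => iter B wk e
  | m'.+1 => Cswap (m' + B) (wk (sink m' B.-1 e))
  end.

Lemma swap0_last v x vs b ws :
  swap0 (size vs + (size b).+1) (v :: vs ++ rcons b x ++ ws)
    = x :: vs ++ b ++ v :: ws.
Proof.
rewrite /swap0 addnS /= -cats1 -!catA /= nth_cat ltnNge leq_addr /=.
rewrite addKn nth_cat ltnn subnn /=; congr (_ :: _).
rewrite set_nthE !size_cat /= ifT; last by rewrite ltn_add2l addnS ltnS leq_addr.
rewrite !catA -(size_cat vs b) take_size_cat // -catA.
rewrite drop_cat size_cat ltnNge leqnSn /= subSnn /= drop0.
by rewrite -!catA.
Qed.

Lemma sinkE F al e vs b ws z : size vs <= size b ->
  Comp F al (sink (size vs) (size b) e) (vs ++ b ++ ws) z <->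
  Comp F al e (rev vs ++ ws) z.
Proof.
elim: vs b ws => [|v vs IH] b ws hb; first exact: wkE_iter.
case/lastP: b hb => // b x; rewrite /= size_rcons ltnS => hb.
have hsw := swap0_last v x vs b ws.
have -> : rev (v :: vs) ++ ws = rev vs ++ v :: ws by rewrite rev_cons cat_rcons.
rewrite -(IH b (v :: ws)) //; split=> H.
- by move/Comp_inv: H => /= [_]; rewrite hsw => /wkE.
- apply: C_swap; last by rewrite hsw; apply/wkE.
  by rewrite /= !size_cat size_rcons; lia.
Qed.

(** [j] counts the values already lying above the original environment, past which the next
    expression must be weakened. The values end up in reverse order; [sink] reverses them back. *)
Fixpoint push j es e :=
  match es with
  | [::] => e
  | e1 :: es' => Ccomp (push j.+1 es' e) (iter j wk e1)
  end.

Fixpoint evals F al (es : seq kcode) a (vs : seq nat) : Prop :=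
  match es, vs with
  | [::], [::] => True
  | e :: es', v :: vs' => Comp F al e a v /\ evals F al es' a vs'
  | _, _ => False
  end.

Lemma evals_cat F al es es' a vs vs' :
  evals F al es a vs -> evals F al es' a vs' -> evals F al (es ++ es') a (vs ++ vs').
Proof. by elim: es vs => [|e es IH] [|v vs] //= [? ?] ?; split=> //; apply: IH. Qed.

Lemma evals_size F al es a vs : evals F al es a vs -> size es = size vs.
Proof. by elim: es vs => [|e es IH] [|v vs] //= [_ /IH ->]. Qed.

Lemma pushE F al es b a vs e z : evals F al es a vs ->
  Comp F al (push (size b) es e) (b ++ a) z <-> Comp F al e (rev vs ++ b ++ a) z.
Proof.
elim: es b vs => [|e1 es IH] b [|v vs] //= [h1 h2].
rewrite rev_cons cat_rcons -(IH (v :: b) vs h2); split=> H.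
- case/Comp_inv: H => y /wkE_iter hy.
  by rewrite (Comp_det h1 hy).
- by apply: C_comp H; apply/wkE_iter.
Qed.

(* Call [e] with exactly the values of [es] as arguments, from an environment
   of size [k]. *)
Definition xcall k e es :=
  push 0 (nseq (size es) (Cconst 0) ++ es) (sink (size es) (size es + k) e).

Lemma xcallE F al k e es a vs z : size a = k -> evals F al es a vs ->
  Comp F al (xcall k e es) a z <-> Comp F al e vs z.
Proof.
move=> hk hes; have hs := evals_size hes.
(* The zeros pad the environment so that at least as many entries lie below the arguments as there
   are arguments, as [sinkE] requires. *)
have h0 : evals F al (nseq (size es) (Cconst 0)) a (nseq (size es) 0).
  by elim: (size es) => //= n IH; split=> //; apply: C_const.
rewrite /xcall (@pushE _ _ _ [::] a _ _ _ (evals_cat h0 hes)) /= rev_cat -catA.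
have -> : size es + k = size (rev (nseq (size es) 0) ++ a).
  by rewrite size_cat size_rev size_nseq hk.
have {1}-> : size es = size (rev vs) by rewrite size_rev.
have := @sinkE F al e (rev vs) (rev (nseq (size es) 0) ++ a) [::] z.
rewrite revK !cats0; apply.
by rewrite !size_cat !size_rev size_nseq hs leq_addr.
Qed.

(* [Cpr] evaluates its base case eagerly, so a lazy conditional has to select
   an index and run it with [Cenum]. *)
Definition cif (e0 e1 e2 : kcode) :=
  Ccomp Cenum (Ccomp (Cpr (Cconst (pickle e1)) (Cconst (pickle e2))) e0).

Lemma pr_constE F al p q n a z :
  Comp F al (Cpr (Cconst p) (Cconst q)) (n :: a) z <-> z = if n == 0 then p else q.
Proof.
elim: n z => [|n IH] z; split.
- by move/Comp_inv/Comp_inv.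
- by move=> ->; apply: C_pr0; apply: C_const.
- by case/Comp_inv => y _ /Comp_inv.
- by move=> ->; apply: C_prS; [apply/IH; reflexivity | apply: C_const].
Qed.

Lemma cif0 F al e0 e1 e2 a z :
  Comp F al e0 a 0 -> Comp F al e1 a z -> Comp F al (cif e0 e1 e2) a z.
Proof.
move=> h0 h1; apply: (C_comp (y := pickle e1)).
  by apply: C_comp h0 _; apply/pr_constE.
by apply: C_enum h1; rewrite pickleK.
Qed.

Lemma cifS F al e0 e1 e2 a n z :
  Comp F al e0 a n.+1 -> Comp F al e2 a z -> Comp F al (cif e0 e1 e2) a z.
Proof.
move=> h0 h1; apply: (C_comp (y := pickle e2)).
  by apply: C_comp h0 _; apply/pr_constE.
by apply: C_enum h1; rewrite pickleK.
Qed.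

Lemma cif_inv F al e0 e1 e2 a z : Comp F al (cif e0 e1 e2) a z ->
  exists2 n, Comp F al e0 a n & Comp F al (if n == 0 then e1 else e2) a z.
Proof.
case/Comp_inv => p /Comp_inv[n h0 /pr_constE ->] /Comp_inv[c].
by case: (n =P 0) => hn; rewrite pickleK => -[<-] h; exists n => //; case: eqP.
Qed.

(** * Uniformly computable functions of number arguments *)

Notation env := (nat -> nat).

(* [pc k Pre F]: one index, uniformly in the type-1 arguments, computes
   [F rho] from the [k] numbers [rho 0 .. rho (k-1)] whenever [Pre rho]. *)
Definition pc k (Pre : env -> Prop) (F : env -> nat) :=
  exists e, forall al a, size a = k -> Pre (nth 0 a) ->
    Comp Suslin al e a (F (nth 0 a)).

Notation tt1 := (fun _ : env => True).

Lemma pc_var k P i : i < k -> pc k P (fun r => r i).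
Proof. by move=> hi; exists (cvar i) => al a hk _; apply: cvarP; rewrite hk. Qed.

Lemma pc_const k P c : pc k P (fun=> c).
Proof. by exists (Cconst c) => *; apply: C_const. Qed.

Lemma pc_ext k P F G : (forall r, P r -> F r = G r) -> pc k P F -> pc k P G.
Proof. by move=> h [e he]; exists e => al a ha hp; rewrite -h //; apply: he. Qed.

Lemma pc_weaken k (P Q : env -> Prop) F :
  (forall r, Q r -> P r) -> pc k P F -> pc k Q F.
Proof. by move=> h [e he]; exists e => al a ha hp; apply: he => //; apply: h. Qed.

Lemma pc_succ k P F : pc k P F -> pc k P (fun r => (F r).+1).
Proof.
move=> [e he]; exists (Ccomp Csucc e) => al a hk hp.
by apply: C_comp (he al a hk hp) _; apply: C_succ.
Qed.

Lemma pc_app1 (f : nat -> nat) k P F :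
  pc 1 tt1 (fun r => f (r 0)) -> pc k P F -> pc k P (fun r => f (F r)).
Proof.
move=> [e he] [e1 h1]; exists (xcall k e [:: e1]) => al a hk hp.
by apply/(@xcallE _ _ _ _ _ _ ([:: F (nth 0 a)])) => //=; [split=> //; exact: h1 | exact: he].
Qed.

Lemma pc_app2 (f : nat -> nat -> nat) k P F G :
  pc 2 tt1 (fun r => f (r 0) (r 1)) -> pc k P F -> pc k P G ->
  pc k P (fun r => f (F r) (G r)).
Proof.
move=> [e he] [e1 h1] [e2 h2]; exists (xcall k e [:: e1; e2]) => al a hk hp.
apply/(@xcallE _ _ _ _ _ _ ([:: F (nth 0 a); G (nth 0 a)])) => //=.
  by split; [exact: h1 | split => //; exact: h2].
exact: (he _ [:: _; _]).
Qed.

Lemma pc_app3 (f : nat -> nat -> nat -> nat) k P F G H :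
  pc 3 tt1 (fun r => f (r 0) (r 1) (r 2)) -> pc k P F -> pc k P G -> pc k P H ->
  pc k P (fun r => f (F r) (G r) (H r)).
Proof.
move=> [e he] [e1 h1] [e2 h2] [e3 h3].
exists (xcall k e [:: e1; e2; e3]) => al a hk hp.
apply/(@xcallE _ _ _ _ _ _ ([:: F (nth 0 a); G (nth 0 a); H (nth 0 a)])) => //=.
  by split; [exact: h1 | split; [exact: h2 | split => //; exact: h3]].
exact: (he _ [:: _; _; _]).
Qed.

(** Reuses a program for a family with one index under [d] further bound variables: it is called on
    the value of [G] followed by the environment below those variables. *)
Lemma pc_deepw d (f : nat -> env -> nat) k (P Q : env -> Prop) G :
  (forall r, Q r -> P (fun i => r (d + i))) ->
  pc k.+1 (fun r => P (fun i => r i.+1)) (fun r => f (r 0) (fun i => r i.+1)) ->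
  pc (d + k) Q G -> pc (d + k) Q (fun r => f (G r) (fun i => r (d + i))).
Proof.
move=> hPQ [e he] [e1 h1].
exists (xcall (d + k) e (e1 :: [seq cvar (d + i) | i <- iota 0 k])) => al a hk hp.
have hd : (fun i => nth 0 a (d + i)) = nth 0 (drop d a).
  by apply: functional_extensionality => i; rewrite nth_drop.
apply/(@xcallE _ _ _ _ _ _ (G (nth 0 a) :: drop d a)) => //=.
  split; first exact: h1.
  have -> : drop d a = [seq nth 0 a (d + i) | i <- iota 0 k].
    apply: (@eq_from_nth _ 0) => [|i]; rewrite size_drop hk addKn.
      by rewrite size_map size_iota.
    by move=> hi; rewrite nth_drop (nth_map 0) ?size_iota // nth_iota.
  have : all (fun i => i < k) (iota 0 k) by apply/allP => i; rewrite mem_iota.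
  elim: (iota 0 k) => //= i s IH /andP[hi /IH hs]; split=> //.
  by apply: cvarP; rewrite hk ltn_add2l.
move: (hPQ _ hp); rewrite hd => hp'.
by apply: (he al (_ :: drop d a)); rewrite //= size_drop hk addKn.
Qed.

Lemma pc_deep d (f : nat -> env -> nat) k P G :
  pc k.+1 (fun r => P (fun i => r i.+1)) (fun r => f (r 0) (fun i => r i.+1)) ->
  pc (d + k) (fun r => P (fun i => r (d + i))) G ->
  pc (d + k) (fun r => P (fun i => r (d + i))) (fun r => f (G r) (fun i => r (d + i))).
Proof. exact: pc_deepw. Qed.

Lemma pc_iteri k P (N Z : env -> nat) (G : nat -> nat -> env -> nat) :
  pc k.+2 (fun r => P (fun i => r i.+2)) (fun r => G (r 1) (r 0) (fun i => r i.+2)) ->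
  pc k P N -> pc k P Z ->
  pc k P (fun r => iteri (N r) (fun i y => G i y r) (Z r)).
Proof.
move=> [eg hg] [en hn] [ez hz]; exists (Ccomp (Cpr ez eg) en) => al a hk hp.
apply: C_comp (hn al a hk hp) _; elim: (N _) => [|n IH] /=.
  by apply: C_pr0; apply: hz.
by apply: C_prS IH _; apply: (hg al (_ :: n :: a)) => //=; rewrite hk.
Qed.

Lemma pc_if k P (b : env -> bool) F G :
  pc k P (fun r => b r) -> pc k (fun r => P r /\ b r) F ->
  pc k (fun r => P r /\ ~~ b r) G -> pc k P (fun r => if b r then F r else G r).
Proof.
move=> [e0 h0] [e1 h1] [e2 h2]; exists (cif e0 e2 e1) => al a hk hp.
have := h0 al a hk hp; case E : (b (nth 0 a)) => /= h.
- by apply: cifS h _; apply: h1 => //; rewrite E.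
- by apply: cif0 h _; apply: h2 => //; rewrite E.
Qed.

Lemma pc_sus k P (G : nat -> env -> nat) :
  pc k.+1 (fun r => P (fun i => r i.+1)) (fun r => G (r 0) (fun i => r i.+1)) ->
  pc k P (fun r => Suslin (fun s => G s r)).
Proof.
move=> [e h]; exists (Cfun e) => al a hk hp; apply: C_fun => x.
by apply: (h al (x :: a)) => //=; rewrite hk.
Qed.

Definition mu (p : nat -> bool) : nat :=
  match excluded_middle_informative (exists n, p n) with
  | left H => ex_minn H
  | right _ => 0
  end.

Lemma muP (p : nat -> bool) : (exists n, p n) -> p (mu p).
Proof.
by rewrite /mu; case: excluded_middle_informative => // H _; case: ex_minnP.
Qed.

Lemma mu_min (p : nat -> bool) n : n < mu p -> p n = false.
Proof.
rewrite /mu; case: excluded_middle_informative => // H; case: ex_minnP => m _ hm.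
by move=> hn; apply/negP => /hm; rewrite leqNgt hn.
Qed.

Lemma pc_mu k P (p : nat -> env -> bool) :
  pc k.+1 (fun r => P (fun i => r i.+1)) (fun r => p (r 0) (fun i => r i.+1)) ->
  (forall r, P r -> exists n, p n r) ->
  pc k P (fun r => mu (fun n => p n r)).
Proof.
move=> [ep hp] hex.
(* The search program finds its own index on top of the counter [n]; [nxt] replaces [n] by its
   successor and runs that index on the new environment. *)
pose nxt := Ccomp (Cswap 2 (wk (Ccomp Cenum Cid))) (Ccomp Csucc (cvar 1)).
pose e := cif (wk ep) nxt (cvar 1).
exists (Ccomp (Ccomp e (Cconst (pickle e))) (Cconst 0)) => al a hk hP.
apply: C_comp; first exact: C_const.
apply: C_comp; first exact: C_const.
set p' := fun n => _; have hm := muP (hex _ hP).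
have h0 n : Comp Suslin al (wk ep) (pickle e :: n :: a) (p' n).
  by apply/wkE; apply: (hp al (n :: a)) => //=; rewrite hk.
suff H d n : mu p' = n + d -> Comp Suslin al e (pickle e :: n :: a) (mu p').
  exact: (H (mu p')).
elim: d n => [|d IH] n hn.
  apply: (@cifS _ _ _ _ _ _ 0).
    have hn' : p' n by rewrite -[n]addn0 -hn; exact: hm.
    by have := h0 n; rewrite hn'.
  by rewrite hn addn0; apply: cvarP.
have {}h0 := h0 n; rewrite (mu_min (p := p')) in h0; last by rewrite hn; lia.
apply: cif0 h0 _; apply: (C_comp (y := n.+1)).
  by apply: (C_comp (y := n)); [exact: cvarP | exact: C_succ].
apply: C_swap => //; apply/wkE; rewrite /swap0 /=.
apply: C_comp; first exact: C_id.
by apply: C_enum; [rewrite pickleK | apply: IH; rewrite hn addSnnS].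
Qed.

(** * Arithmetic *)

Lemma pc_pred k P F : pc k P F -> pc k P (fun r => (F r).-1).
Proof.
move=> h; apply: (pc_ext (F := fun r => iteri (F r) (fun i _ => i) 0)).
  by move=> r _; case: (F r).
by apply: pc_iteri => //; [apply: pc_var | apply: pc_const].
Qed.

Lemma pc_add k P F G : pc k P F -> pc k P G -> pc k P (fun r => F r + G r).
Proof.
move=> h1 h2; apply: (pc_ext (F := fun r => iteri (F r) (fun _ y => y.+1) (G r))).
  by move=> r _; elim: (F r) => //= n ->; rewrite addSn.
by apply: pc_iteri => //; apply: pc_succ; apply: pc_var.
Qed.

Lemma pc_sub k P F G : pc k P F -> pc k P G -> pc k P (fun r => F r - G r).
Proof.
move=> h1 h2; apply: (pc_ext (F := fun r => iteri (G r) (fun _ y => y.-1) (F r))).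
  by move=> r _; elim: (G r) => /= [|n ->]; rewrite ?subn0 ?subnS.
by apply: pc_iteri => //; apply: pc_pred; apply: pc_var.
Qed.

Lemma pc_mul k P F G : pc k P F -> pc k P G -> pc k P (fun r => F r * G r).
Proof.
move=> h1 h2.
apply: (pc_ext (F := fun r => iteri (F r) (fun _ y => (fun r => G r + y) r) 0)).
  by move=> r _; elim: (F r) => //= n ->; rewrite mulSn.
apply: pc_iteri => //; last exact: pc_const.
apply: pc_add; last exact: pc_var.
case: h2 => e he; exists (wk (wk e)) => al [|x [|y a]] //= [hk] hP.
by do 2 apply/wkE; apply: he.
Qed.

Lemma pc_exp2 k P F : pc k P F -> pc k P (fun r => 2 ^ F r).
Proof.
move=> h; apply: (pc_ext (F := fun r => iteri (F r) (fun _ y => y + y) 1)).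
  by move=> r _; elim: (F r) => //= n ->; rewrite addnn expnS mul2n.
by apply: pc_iteri => //; [apply: pc_add; apply: pc_var | apply: pc_const].
Qed.

Lemma pc_not k P (b : env -> bool) : pc k P (fun r => b r) -> pc k P (fun r => ~~ b r).
Proof.
move=> h; apply: (pc_ext (F := fun r => 1 - b r)); first by move=> r _; case: (b r).
by apply: pc_sub => //; apply: pc_const.
Qed.

Lemma pc_and k P (b c : env -> bool) :
  pc k P (fun r => b r) -> pc k (fun r => P r /\ b r) (fun r => c r) ->
  pc k P (fun r => b r && c r).
Proof.
move=> h1 h2; apply: (pc_ext (F := fun r => if b r then c r : nat else 0)).
  by move=> r _; case: (b r).
by apply: pc_if => //; apply: pc_const.
Qed.

Lemma pc_or k P (b c : env -> bool) :
  pc k P (fun r => b r) -> pc k (fun r => P r /\ ~~ b r) (fun r => c r) ->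
  pc k P (fun r => b r || c r).
Proof.
move=> h1 h2; apply: (pc_ext (F := fun r => if b r then 1 else c r : nat)).
  by move=> r _; case: (b r).
by apply: pc_if => //; apply: pc_const.
Qed.

Lemma pc_le k P F G : pc k P F -> pc k P G -> pc k P (fun r => F r <= G r).
Proof.
move=> h1 h2; apply: (pc_ext (F := fun r => 1 - (F r - G r))).
  by move=> r _; rewrite /leq; case: (F r - G r).
by apply: pc_sub; [apply: pc_const | apply: pc_sub].
Qed.

Lemma pc_eq k P F G : pc k P F -> pc k P G -> pc k P (fun r => F r == G r).
Proof.
move=> h1 h2; apply: (pc_ext (F := fun r => (F r <= G r) && (G r <= F r))).
  by move=> r _; rewrite -eqn_leq.
by apply: pc_and; apply: pc_le => //; [apply: (pc_weaken _ h2) => r [] | apply: (pc_weaken _ h1) => r []].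
Qed.

Definition sumf n (G : nat -> nat) := iteri n (fun i y => y + G i) 0.

Lemma sumfE n G : sumf n G = \sum_(i < n) G i.
Proof. by elim: n => [|n IH]; rewrite ?big_ord0 // big_ord_recr /= -IH. Qed.

Lemma pc_sum k P (N : env -> nat) (G : nat -> env -> nat) :
  pc k P N ->
  pc k.+1 (fun r => P (fun i => r i.+1)) (fun r => G (r 0) (fun i => r i.+1)) ->
  pc k P (fun r => sumf (N r) (fun i => G i r)).
Proof.
move=> h1 [e he]; apply: pc_iteri => //; last exact: pc_const.
apply: pc_add; first exact: pc_var.
exists (wk e) => al [|x [|y a]] //= [hk] hP.
by apply/wkE; apply: (he al (y :: a)) => //=; rewrite hk.
Qed.

Lemma sum_ltn m q : \sum_(j < m) (j < q) = minn m q.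
Proof.
by elim: m => [|m IH]; rewrite ?big_ord0 ?min0n // big_ord_recr /= IH; lia.
Qed.

Lemma divn_sum x d : 0 < d -> x %/ d = sumf x (fun j => j.+1 * d <= x).
Proof.
move=> hd; rewrite sumfE.
have hq : x %/ d <= x by apply: leq_div.
under eq_bigr => j _ do rewrite -leq_divRL //.
by rewrite sum_ltn; lia.
Qed.

Lemma pc_div2 k P F G : pc k P F -> pc k P G -> pc k P (fun r => F r %/ 2 ^ G r).
Proof.
move=> h1 h2; apply: (pc_app2 (f := fun x n => x %/ 2 ^ n)) => //.
apply: (pc_ext (F := fun r => sumf (r 0) (fun j => (fun r => j.+1 * 2 ^ r 1 <= r 0) r))).
  by move=> r _; rewrite -divn_sum // expn_gt0.
apply: pc_sum; first exact: pc_var.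
apply: pc_le; last exact: pc_var.
by apply: pc_mul; [apply: pc_succ | apply: pc_exp2]; apply: pc_var.
Qed.

Lemma pc_mod2 k P F G : pc k P F -> pc k P G -> pc k P (fun r => F r %% 2 ^ G r).
Proof.
move=> h1 h2; apply: (pc_ext (F := fun r => F r - F r %/ 2 ^ G r * 2 ^ G r)).
  by move=> r _; rewrite {1}(divn_eq (F r) (2 ^ G r)) addKn.
by apply: pc_sub => //; apply: pc_mul; [apply: pc_div2 | apply: pc_exp2].
Qed.

Lemma pc_odd k P F : pc k P F -> pc k P (fun r => odd (F r)).
Proof.
move=> h; apply: (pc_ext (F := fun r => F r %% 2 ^ 1)).
  by move=> r _; rewrite expn1 modn2.
by apply: pc_mod2 => //; apply: pc_const.
Qed.

Lemma pc_half k P F : pc k P F -> pc k P (fun r => (F r)./2).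
Proof.
move=> h; apply: (pc_ext (F := fun r => F r %/ 2 ^ 1)).
  by move=> r _; rewrite expn1 divn2.
by apply: pc_div2 => //; apply: pc_const.
Qed.

Lemma pc_double k P F : pc k P F -> pc k P (fun r => (F r).*2).
Proof.
move=> h; apply: (pc_ext (F := fun r => F r + F r)); last exact: pc_add.
by move=> r _; rewrite addnn.
Qed.

(** * Codes of finite sequences *)

Notation code := CodeSeq.code.
Notation decode := CodeSeq.decode.

Definition consc n t := 2 ^ n * t.*2.+1.
Definition headc s := head 0 (decode s).
Definition tailc s := code (behead (decode s)).
Definition nthc s i := nth 0 (decode s) i.
Definition sizec s := size (decode s).

Lemma consc_code n l : consc n (code l) = code (n :: l). Proof. by []. Qed.

Lemma conscE n t : consc n t = code (n :: decode t).
Proof. by rewrite -consc_code CodeSeq.decodeK. Qed.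

Lemma decode_consc n t : decode (consc n t) = n :: decode t.
Proof. by rewrite conscE CodeSeq.codeK. Qed.

Lemma headc_cons n t : headc (consc n t) = n.
Proof. by rewrite /headc decode_consc. Qed.

Lemma tailc_cons n t : tailc (consc n t) = t.
Proof. by rewrite /tailc decode_consc CodeSeq.decodeK. Qed.

Lemma consc_gt0 n t : 0 < consc n t.
Proof. by rewrite /consc muln_gt0 expn_gt0. Qed.

Lemma code_gt0 n l : 0 < code (n :: l). Proof. exact: consc_gt0. Qed.

Lemma consK s : 0 < s -> consc (headc s) (tailc s) = s.
Proof.
move=> hs; rewrite conscE /headc /tailc CodeSeq.codeK -[RHS]CodeSeq.decodeK.
by case E : (decode s) => [|x l] //; move: hs; rewrite -(CodeSeq.decodeK s) E.
Qed.

Lemma code_eq0 l : (code l == 0) = (l == [::]).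
Proof. by case: l => //= n l; apply/negbTE; rewrite -lt0n; apply: code_gt0. Qed.

(** The head of a positive code is the exponent of 2 in it, counted here by the positive powers of 2
    that divide the code. *)
Lemma headc_sum s :
  headc s = if 0 < s then sumf s (fun i => s %% 2 ^ i.+1 == 0) else 0.
Proof.
case: ifP => [hs|]; last by case: s.
rewrite -{2 3}(consK hs) sumfE; set n := headc s; set t := tailc s.
have hn : n <= consc n t.
  apply: leq_trans (ltnW (ltn_expl n (isT : 1 < 2))) _.
  by rewrite leq_pmulr.
under eq_bigr => i _.
  have -> : (consc n t %% 2 ^ i.+1 == 0) = (i < n).
    rewrite -/(dvdn _ _) /consc; case: (ltnP i n) => hi.
      by apply: dvdn_mulr; apply: dvdn_exp2l.
    apply/negbTE/negP => h; have : 2 ^ n.+1 %| 2 ^ n * t.*2.+1.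
      by apply: dvdn_trans h; apply: dvdn_exp2l.
    by rewrite expnSr dvdn_pmul2l ?expn_gt0 // dvdn2 /= odd_double.
  over.
by rewrite sum_ltn; lia.
Qed.

Lemma tailc_half s : tailc s = (s %/ 2 ^ headc s)./2.
Proof.
case: (posnP s) => [->|hs] //; rewrite -{2}(consK hs) /consc mulKn ?expn_gt0 //.
by rewrite -addn1 halfD odd_double add0n doubleK addn0.
Qed.

Lemma decode_tailc s : decode (tailc s) = behead (decode s).
Proof. by rewrite CodeSeq.codeK. Qed.

Lemma nthc_iter s i : nthc s i = headc (iteri i (fun _ y => tailc y) s).
Proof.
have h : decode (iteri i (fun _ y => tailc y) s) = drop i (decode s).
  elim: i => [|i IH] /=; first by rewrite drop0.
  by rewrite decode_tailc IH -drop1 drop_drop add1n.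
by rewrite /headc h /nthc -nth0 nth_drop addn0.
Qed.

Lemma size_decode s : sizec s <= s.
Proof.
rewrite -{2}(CodeSeq.decodeK s) /sizec; elim: (decode s) => //= n l IH.
apply: leq_trans (_ : (code l).+1 <= _) => //.
rewrite -[X in X <= _]mul1n leq_mul ?expn_gt0 //; lia.
Qed.

Lemma sizec_sum s : sizec s = sumf s (fun i => iteri i (fun _ y => tailc y) s != 0).
Proof.
rewrite sumfE; under eq_bigr => i _.
  have -> : (iteri i (fun _ y => tailc y) s != 0) = (i < sizec s).
    have h : decode (iteri i (fun _ y => tailc y) s) = drop i (decode s).
      elim: (nat_of_ord i) => [|j IH] /=; first by rewrite drop0.
      by rewrite decode_tailc IH -drop1 drop_drop add1n.
    rewrite -[iteri _ _ _]CodeSeq.decodeK h code_eq0 -size_eq0 size_drop.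
    by rewrite subn_eq0 -ltnNge.
  over.
by rewrite sum_ltn; have := size_decode s; lia.
Qed.

(** Entries are produced from the last to the first, since [consc] extends a code at the front. *)
Definition mkseqc n (G : nat -> nat) :=
  iteri n (fun i y => consc (G (n - i.+1)) y) 0.

Lemma mkseqcE n G : mkseqc n G = code (mkseq G n).
Proof.
rewrite /mkseqc; suff H i : i <= n ->
    iteri i (fun i y => consc (G (n - i.+1)) y) 0 = code (drop (n - i) (mkseq G n)).
  by rewrite H // subnn drop0.
elim: i => [|i IH] hi /=; first by rewrite subn0 drop_oversize ?size_mkseq.
rewrite IH 1?ltnW // consc_code (drop_nth 0 (n := n - i.+1)) ?size_mkseq; last lia.
by rewrite nth_mkseq; [rewrite subnSK | lia].
Qed.

Definition foldc (step : nat -> nat -> nat) z s :=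
  iteri (sizec s) (fun i y => step (nthc s (sizec s - i.+1)) y) z.

Lemma foldcE step z s : foldc step z s = foldr step z (decode s).
Proof.
rewrite /foldc; suff H i : i <= sizec s ->
   iteri i (fun i y => step (nthc s (sizec s - i.+1)) y) z
     = foldr step z (drop (sizec s - i) (decode s)).
  by rewrite H // subnn drop0.
elim: i => [|i IH] hi /=; first by rewrite subn0 drop_oversize.
rewrite IH 1?ltnW // (drop_nth 0 (n := sizec s - i.+1)) /=; last by rewrite /sizec in hi *; lia.
by rewrite subnSK.
Qed.

Lemma pc_consc k P F G : pc k P F -> pc k P G -> pc k P (fun r => consc (F r) (G r)).
Proof.
by move=> h1 h2; apply: pc_mul; [apply: pc_exp2 | apply: pc_succ; apply: pc_double].
Qed.

Lemma pc_headc k P F : pc k P F -> pc k P (fun r => headc (F r)).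
Proof.
apply: pc_app1; apply: pc_ext; first by move=> r _; rewrite headc_sum.
apply: pc_if; [|apply: pc_sum|exact: pc_const].
- by apply: pc_le; [apply: pc_const | apply: pc_var].
- exact: pc_var.
- apply: pc_eq; last exact: pc_const.
  by apply: pc_mod2; [|apply: pc_succ]; apply: pc_var.
Qed.

Lemma pc_tailc k P F : pc k P F -> pc k P (fun r => tailc (F r)).
Proof.
move=> h; apply: (pc_ext (F := fun r => (F r %/ 2 ^ headc (F r))./2)).
  by move=> r _; rewrite tailc_half.
by apply: pc_half; apply: pc_div2 => //; apply: pc_headc.
Qed.

Lemma pc_nthc k P F G : pc k P F -> pc k P G -> pc k P (fun r => nthc (F r) (G r)).
Proof.
apply: (pc_app2 (f := nthc)); apply: pc_ext; first by move=> r _; rewrite nthc_iter.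
apply: pc_headc; apply: (pc_iteri (G := fun i y r => tailc y)); try exact: pc_var.
by apply: pc_tailc; apply: pc_var.
Qed.

Lemma pc_sizec k P F : pc k P F -> pc k P (fun r => sizec (F r)).
Proof.
apply: pc_app1; apply: pc_ext; first by move=> r _; rewrite sizec_sum.
apply: pc_sum; first exact: pc_var.
apply: pc_not; apply: pc_eq; last exact: pc_const.
apply: (pc_iteri (G := fun i y r => tailc y)); try exact: pc_var.
by apply: pc_tailc; apply: pc_var.
Qed.

Lemma pc_mkseqc k P N (G : nat -> env -> nat) :
  pc k.+1 (fun r => P (fun i => r i.+1)) (fun r => G (r 0) (fun i => r i.+1)) ->
  pc k P N -> pc k P (fun r => mkseqc (N r) (fun i => G i r)).
Proof.
move=> hG hN.
apply: (pc_iteri (G := fun i y r => consc (G (N r - i.+1) r) y)) => //; last first.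
  exact: pc_const.
apply: pc_consc; last exact: pc_var.
apply: (pc_deep (d := 2)) => //; apply: pc_sub; last by apply: pc_succ; apply: pc_var.
by case: hN => e he; exists (wk (wk e)) => al [|x [|y a]] //= [hk] hP;
   do 2 apply/wkE; apply: he.
Qed.

Lemma pc_foldc k P (G : nat -> nat -> nat) Z S :
  pc 2 tt1 (fun r => G (r 0) (r 1)) ->
  pc k P Z -> pc k P S -> pc k P (fun r => foldc G (Z r) (S r)).
Proof.
move=> hG; apply: (pc_app2 (f := fun z s => foldc G z s)).
apply: (pc_iteri (G := fun i y r => G (nthc (r 1) (sizec (r 1) - i.+1)) y)).
- apply: pc_app2 => //; last exact: pc_var.
  apply: pc_nthc; first exact: pc_var.
  apply: pc_sub; first by apply: pc_sizec; apply: pc_var.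
  by apply: pc_succ; apply: pc_var.
- by apply: pc_sizec; apply: pc_var.
- exact: pc_var.
Qed.

(** * Quantifiers and programs run by index *)

Definition exb (p : nat -> bool) : bool :=
  if excluded_middle_informative (exists n, p n) then true else false.
Definition allb (p : nat -> bool) : bool := ~~ exb (fun n => ~~ p n).
Definition susb (p : nat -> bool) : bool :=
  if excluded_middle_informative (exists h, forall n, p (bar h n))
  then true else false.

Lemma exbP (p : nat -> bool) : reflect (exists n, p n) (exb p).
Proof. by rewrite /exb; case: excluded_middle_informative => h; constructor. Qed.

Lemma allbP (p : nat -> bool) : reflect (forall n, p n) (allb p).
Proof.
apply: (iffP negP) => [h n|h /exbP[n]]; last by rewrite h.
by apply/negPn/negP => hn; apply: h; apply/exbP; exists n.
Qed.

Lemma susbP (p : nat -> bool) : reflect (exists h, forall n, p (bar h n)) (susb p).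
Proof. by rewrite /susb; case: excluded_middle_informative => h; constructor. Qed.

Lemma pc_susb k P (p : nat -> env -> bool) :
  pc k.+1 (fun r => P (fun i => r i.+1)) (fun r => p (r 0) (fun i => r i.+1)) ->
  pc k P (fun r => susb (fun n => p n r)).
Proof.
move=> h; apply: (pc_ext (F := fun r => Suslin (fun s => p s r))); last exact: pc_sus.
move=> r _; rewrite /Suslin /susb.
case: excluded_middle_informative => [[g hg]|H1];
  case: excluded_middle_informative => [[g' hg']|H2] //.
- by case: H2; exists g => n; have := hg n; case: (p _ r).
- by case: H1; exists g' => n; rewrite hg'.
Qed.

Lemma headc_bar h n : headc (bar h n.+1) = h 0.
Proof. by rewrite /headc /bar CodeSeq.codeK. Qed.

(** A number quantifier is a Suslin operation whose family looks only at the first entry of a path;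
    the empty sequence, having no first entry, is accepted. *)
Lemma pc_exb k P (p : nat -> env -> bool) :
  pc k.+1 (fun r => P (fun i => r i.+1)) (fun r => p (r 0) (fun i => r i.+1)) ->
  pc k P (fun r => exb (fun n => p n r)).
Proof.
move=> h; pose q s r := (s == 0) || p (headc s) r.
apply: (pc_ext (F := fun r => susb (fun s => q s r))).
  move=> r _; congr nat_of_bool; apply/susbP/exbP => [[g hg]|[n hn]].
    by exists (g 0); have := hg 1; rewrite /q headc_bar /bar code_eq0.
  exists (fun=> n) => -[|m]; first by rewrite /q /bar.
  by rewrite /q headc_bar hn orbT.
apply: pc_susb; apply: pc_or; first by apply: pc_eq; [apply: pc_var | apply: pc_const].
refine (@pc_weaken _ (fun r => P (fun i => r i.+1)) _ _ _ _); first by move=> r [].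
apply: (pc_deep (d := 1) (f := fun n r => p n r)) => //.
by apply: pc_headc; apply: pc_var.
Qed.

Lemma pc_allb k P (p : nat -> env -> bool) :
  pc k.+1 (fun r => P (fun i => r i.+1)) (fun r => p (r 0) (fun i => r i.+1)) ->
  pc k P (fun r => allb (fun n => p n r)).
Proof. by move=> h; apply: pc_not; apply: pc_exb; apply: pc_not. Qed.

(** The value is unspecified when the program diverges. Computability of [run_val] therefore always
    comes with a proof of [runs], which is what the preconditions of [pc] are for. *)
Definition run_val w (args : seq nat) : nat :=
  epsilon (inhabits 0) (fun z => Comp Suslin [::] Cenum (w :: args) z).
Definition runs w (args : seq nat) := exists z, Comp Suslin [::] Cenum (w :: args) z.

Lemma runsP w args : runs w args -> Comp Suslin [::] Cenum (w :: args) (run_val w args).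
Proof. exact: epsilon_spec. Qed.

Lemma run_valE w args z : Comp Suslin [::] Cenum (w :: args) z -> run_val w args = z.
Proof. by move=> h; apply: (Comp_det _ h); apply: runsP; exists z. Qed.

Lemma Comp_pickle (e : kcode) args z :
  Comp Suslin [::] Cenum (pickle e :: args) z <-> Comp Suslin [::] e args z.
Proof.
split=> [/Comp_inv[c]|h]; first by rewrite pickleK => -[->].
by apply: C_enum h; rewrite pickleK.
Qed.

Definition pcs k P (Fs : seq (env -> nat)) := foldr (fun F Q => pc k P F /\ Q) True Fs.

Lemma pc_run_val k P W Fs : pc k P W -> pcs k P Fs ->
  (forall r, P r -> runs (W r) [seq F r | F <- Fs]) ->
  pc k P (fun r => run_val (W r) [seq F r | F <- Fs]).
Proof.
move=> [ew hw] hF hc.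
have [es hes] : exists es, forall al a, size a = k -> P (nth 0 a) ->
    evals Suslin al es a [seq F (nth 0 a) | F <- Fs].
  elim: Fs hF {hc} => [|F Fs IH] /=; first by exists [::].
  by case=> [[e he] /IH[es hes]]; exists (e :: es) => al a hk hP; split; auto.
exists (xcall k Cenum (ew :: es)) => al a hk hP.
apply/(@xcallE _ _ _ _ _ _ (W (nth 0 a) :: [seq F (nth 0 a) | F <- Fs])) => //=.
  by split; [apply: hw | apply: hes].
by apply: Comp_nil; apply: runsP; apply: hc.
Qed.

Lemma pc_ifb k P (b F G : env -> bool) :
  pc k P (fun r => b r) -> pc k (fun r => P r /\ b r) (fun r => F r) ->
  pc k (fun r => P r /\ ~~ b r) (fun r => G r) ->
  pc k P (fun r => if b r then F r else G r).
Proof.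
move=> h1 h2 h3; have h := pc_if h1 h2 h3; apply: pc_ext h => r _.
by case: (b r).
Qed.

(** Syntax-directed closure rules for [pc]; [pcx] receives the rules for functions introduced
    later. *)
Ltac pcx := fail.
Ltac pc1 := match goal with
  | |- pcs _ _ nil => exact Logic.I
  | |- pcs _ _ (cons _ _) => split
  | |- pc _ _ (fun r => r _) => apply: pc_var; done
  | |- pc ?k ?P (fun r => consc (@?F r) (@?G r)) => refine (@pc_consc k P F G _ _)
  | |- pc ?k ?P (fun r => headc (@?F r)) => refine (@pc_headc k P F _)
  | |- pc ?k ?P (fun r => tailc (@?F r)) => refine (@pc_tailc k P F _)
  | |- pc ?k ?P (fun r => nthc (@?F r) (@?G r)) => refine (@pc_nthc k P F G _ _)
  | |- pc ?k ?P (fun r => sizec (@?F r)) => refine (@pc_sizec k P F _)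
  | |- pc ?k ?P (fun r => mkseqc (@?F r) (fun i => @?G r i)) =>
      refine (@pc_mkseqc k P F (fun i r => G r i) _ _)
  | |- pc ?k ?P (fun r => sumf (@?F r) (fun i => @?G r i)) =>
      refine (@pc_sum k P F (fun i r => G r i) _ _)
  | |- pc ?k ?P (fun r => nat_of_bool (exb (fun i => @?G r i))) =>
      refine (@pc_exb k P (fun i r => G r i) _)
  | |- pc ?k ?P (fun r => nat_of_bool (allb (fun i => @?G r i))) =>
      refine (@pc_allb k P (fun i r => G r i) _)
  | |- pc ?k ?P (fun r => nat_of_bool (susb (fun i => @?G r i))) =>
      refine (@pc_susb k P (fun i r => G r i) _)
  | |- pc ?k ?P (fun r => Suslin (fun i => @?G r i)) =>
      refine (@pc_sus k P (fun i r => G r i) _)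
  | |- pc ?k ?P (fun r => mu (fun i => @?G r i)) =>
      refine (@pc_mu k P (fun i r => G r i) _ _)
  | |- pc ?k ?P (fun r => nat_of_bool (negb (@?F r))) => refine (@pc_not k P F _)
  | |- pc ?k ?P (fun r => nat_of_bool (andb (@?F r) (@?G r))) =>
      refine (@pc_and k P F G _ _)
  | |- pc ?k ?P (fun r => nat_of_bool (orb (@?F r) (@?G r))) =>
      refine (@pc_or k P F G _ _)
  | |- pc ?k ?P (fun r => nat_of_bool (eq_op (@?F r) (@?G r))) =>
      refine (@pc_eq k P F G _ _)
  | |- pc ?k ?P (fun r => nat_of_bool (leq (@?F r) (@?G r))) =>
      refine (@pc_le k P F G _ _)
  | |- pc ?k ?P (fun r => nat_of_bool (odd (@?F r))) => refine (@pc_odd k P F _)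
  | |- pc ?k ?P (fun r => S (@?F r)) => refine (@pc_succ k P F _)
  | |- pc ?k ?P (fun r => predn (@?F r)) => refine (@pc_pred k P F _)
  | |- pc ?k ?P (fun r => half (@?F r)) => refine (@pc_half k P F _)
  | |- pc ?k ?P (fun r => double (@?F r)) => refine (@pc_double k P F _)
  | |- pc ?k ?P (fun r => addn (@?F r) (@?G r)) => refine (@pc_add k P F G _ _)
  | |- pc ?k ?P (fun r => subn (@?F r) (@?G r)) => refine (@pc_sub k P F G _ _)
  | |- pc ?k ?P (fun r => muln (@?F r) (@?G r)) => refine (@pc_mul k P F G _ _)
  | |- pc ?k ?P (fun r => expn 2 (@?F r)) => refine (@pc_exp2 k P F _)
  | |- pc ?k ?P (fun r => divn (@?F r) (expn 2 (@?G r))) =>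
      refine (@pc_div2 k P F G _ _)
  | |- pc ?k ?P (fun r => modn (@?F r) (expn 2 (@?G r))) =>
      refine (@pc_mod2 k P F G _ _)
  | |- pc ?k ?P (fun r => run_val (@?W r) nil) =>
      refine (@pc_run_val k P W nil _ _ _)
  | |- pc ?k ?P (fun r => run_val (@?W r) [:: @?A r]) =>
      refine (@pc_run_val k P W [:: A] _ _ _)
  | |- pc ?k ?P (fun r => run_val (@?W r) [:: @?A r; @?B r]) =>
      refine (@pc_run_val k P W [:: A; B] _ _ _)
  | |- pc ?k ?P (fun r => run_val (@?W r) [:: @?A r; @?B r; @?C r]) =>
      refine (@pc_run_val k P W [:: A; B; C] _ _ _)
  | |- pc ?k ?P (fun r => run_val (@?W r) [:: @?A r; @?B r; @?C r; @?D r; @?E r]) =>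
      refine (@pc_run_val k P W [:: A; B; C; D; E] _ _ _)
  | |- pc ?k ?P (fun r => run_val (@?W r) [:: @?A r; @?B r; @?C r; @?D r; @?E r; @?F r]) =>
      refine (@pc_run_val k P W [:: A; B; C; D; E; F] _ _ _)
  | |- pc _ _ (fun _ => ?c) => apply: pc_const
  | |- _ => first [simple apply pc_if | simple apply pc_ifb | pcx]
  end.
Ltac pca := repeat (cbv beta; pc1).

(** * Computations as a transition system *)

(** [Cenum] reads its index through [unpickle]. For programs to parse indices, [unpickle] is
    unfolded into operations on sequence codes, beginning with the tokens of a serialized tree:
    [inr] is a leaf, [inl] a bracket or a node label. *)
Definition tok (n : nat) : option (nat + nat) :=
  match decode n with
  | [:: a; b] =>
      match decode b, decode a with
      | y :: _, _ => Some (inr y)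
      | [::], x :: _ => Some (inl x)
      | [::], [::] => None
      end
  | _ => None
  end.

Lemma unpickle_tok n : (unpickle n : option (nat + nat)) = tok n.
Proof.
transitivity (obind (@sum_of_opair nat nat) (omap (@pair_of_tag _ _)
  (unpickle_tagged (fun _ : option nat => option nat) n))) => //.
rewrite /tok /unpickle_tagged; case: (decode n) => [|a [|b [|c l]]] //=.
have h l : pmap (@unpickle nat) l = l by elim: l => //= x l ->.
by rewrite !h; case: (decode b) => //; case: (decode a).
Qed.

Lemma unpickle_kcode n : (unpickle n : option kcode) =
  obind kdec (GenTree.decode (pmap tok (decode n))).
Proof.
transitivity (obind kdec (obind (@GenTree.decode nat)
  (Some (pmap (@unpickle (nat + nat)%type) (decode n))))) => //.
by rewrite /= (eq_pmap unpickle_tok).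
Qed.

(** Configurations use this numbering because [headc] and [nthc] read off the components of a
    program. It never takes the value [0], which is thus free to mark an index that codes no
    program. *)
Fixpoint kcode_num (c : kcode) : nat :=
  match c with
  | Csucc => consc 0 0
  | Cconst q => consc 1 (consc q 0)
  | Cid => consc 2 0
  | Ccomp a b => consc 3 (consc (kcode_num a) (consc (kcode_num b) 0))
  | Cpr a b => consc 4 (consc (kcode_num a) (consc (kcode_num b) 0))
  | Cswap i a => consc 5 (consc i (consc (kcode_num a) 0))
  | Capp k => consc 6 (consc k 0)
  | Cfun a => consc 7 (consc (kcode_num a) 0)
  | Cenum => consc 8 0
  end.

Lemma kcode_num_gt0 c : 0 < kcode_num c.
Proof. by case: c => *; apply: consc_gt0. Qed.

(* What the parser needs to know about a tree: [2 y + 1] for a leaf [y], twice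
   the number of the program for a tree decoding to one, and [0] otherwise. *)
Definition tree_info (t : GenTree.tree nat) : nat :=
  match t with
  | GenTree.Leaf y => y.*2.+1
  | _ => if kdec t is Some c then (kcode_num c).*2 else 0
  end.

Lemma tree_info_odd t : odd (tree_info t) = if t is GenTree.Leaf _ then true else false.
Proof.
case: t => [y|n f]; first by rewrite /= odd_double.
by rewrite /tree_info; case E : (kdec (GenTree.Node n f)) => [c|] //; rewrite odd_double.
Qed.

Definition is_program x := (0 < x) && ~~ odd x.

Lemma is_program_tree_info t : is_program (tree_info t) = (kdec t : bool).
Proof.
case: t => [y|n f]; first by rewrite /is_program /= odd_double.
by rewrite /is_program /tree_info; case E : (kdec (GenTree.Node n f)) => [c|] //; rewrite double_gt0 kcode_num_gt0 odd_double.
Qed.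

Lemma tree_info_half t c : kdec t = Some c -> (tree_info t)./2 = kcode_num c.
Proof. by case: t => // n f h; rewrite /tree_info h doubleK. Qed.

Definition nodec n F :=
  let x := nthc F 0 in let y := nthc F 1 in
  if (n == 0) && (F == 0) then (consc 0 0).*2
  else if (n == 1) && ((sizec F == 1) && odd x) then (consc 1 (consc x./2 0)).*2
  else if (n == 2) && (F == 0) then (consc 2 0).*2
  else if ((n == 3) || (n == 4)) && ((sizec F == 2) && (is_program x && is_program y)) then
    (consc n (consc x./2 (consc y./2 0))).*2
  else if (n == 5) && ((sizec F == 2) && (odd x && is_program y)) then
    (consc 5 (consc x./2 (consc y./2 0))).*2
  else if (n == 6) && ((sizec F == 1) && odd x) then (consc 6 (consc x./2 0)).*2
  else if (n == 7) && ((sizec F == 1) && is_program x) then (consc 7 (consc x./2 0)).*2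
  else if (n == 8) && (F == 0) then (consc 8 0).*2
  else 0.

Lemma nodec_tree_info n f : nodec n (code (map tree_info f)) = tree_info (GenTree.Node n f).
Proof.
rewrite /nodec code_eq0 /sizec /nthc CodeSeq.codeK size_map -size_eq0 size_map.
case: n => [|[|[|[|[|[|[|[|[|n]]]]]]]]]; case: f => [|a [|b [|c f]]] //=;
  rewrite -/is_program ?andbF //.
all: try by case: a.
- by rewrite tree_info_odd; case: a => [y|m g] //=; rewrite uphalf_double.
- rewrite !is_program_tree_info; case ea : (kdec a) => [x|]; case eb : (kdec b) => [y|] //=.
  by rewrite (tree_info_half ea) (tree_info_half eb).
- rewrite !is_program_tree_info; case ea : (kdec a) => [x|]; case eb : (kdec b) => [y|] //=.
  by rewrite (tree_info_half ea) (tree_info_half eb).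
- rewrite is_program_tree_info tree_info_odd; case: a => [i|m g] //; case eb : (kdec b) => [y|] //=.
  by rewrite (tree_info_half eb) uphalf_double.
- by rewrite tree_info_odd; case: a => [y|m g] //=; rewrite uphalf_double.
- rewrite is_program_tree_info; case ea : (kdec a) => [x|] //=.
  by rewrite (tree_info_half ea).
Qed.

(* Parser states: a coded forest under construction on top of a coded stack of
   forests. *)
Definition stepc n s :=
  if sizec n != 2 then s
  else if nthc n 1 != 0 then
    consc (consc (headc (nthc n 1)).*2.+1 (headc s)) (tailc s)
  else if nthc n 0 == 0 then s
  else if headc (nthc n 0) == 0 then consc 0 (consc (headc s) (tailc s))
  else consc (consc (nodec (headc (nthc n 0)).-1 (headc s)) (headc (tailc s)))
             (tailc (tailc s)).

Definition index_num n :=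
  let t := headc (headc (foldc stepc (consc 0 0) n)) in
  if odd t then 0 else t./2.

Lemma head_decode n : decode n = if n == 0 then [::] else headc n :: decode (tailc n).
Proof. by case: eqP => [->|/eqP h] //; rewrite -decode_consc consK ?lt0n. Qed.

Lemma index_numE n : index_num n = if (unpickle n : option kcode) is Some c then kcode_num c else 0.
Proof.
(* [enc] codes a state of the tree decoder with each tree replaced by its [tree_info]; [H] says that
   [stepc] simulates the decoder on these codes. *)
pose enc (fs : seq (GenTree.tree nat) * seq (seq (GenTree.tree nat))) :=
  consc (code (map tree_info fs.1)) (code (map (fun l => code (map tree_info l)) fs.2)).
pose fs := foldr (@GenTree.decode_step nat) ([::], [::]) (pmap tok (decode n)).
have H : foldc stepc (consc 0 0) n = enc fs.
  rewrite foldcE /fs; elim: (decode n) => [|m l IH] //=.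
  set r := pmap tok l in IH *.
  have -> : foldr (@GenTree.decode_step nat) ([::], [::]) (oapp (cons^~ r) r (tok m))
    = oapp (fun c => GenTree.decode_step c (foldr (@GenTree.decode_step nat) ([::], [::]) r))
        (foldr (@GenTree.decode_step nat) ([::], [::]) r) (tok m) by case: (tok m).
  rewrite {}IH; move: (foldr _ _ r) => [F S].
  rewrite /stepc /tok /sizec /nthc.
  case: (decode m) => [|a [|b [|c l']]] //=.
  rewrite (head_decode b) (head_decode a).
  case: (b =P 0) => hb /=; last first.
    by rewrite /enc /= headc_cons tailc_cons consc_code.
  case: (a =P 0) => ha //=.
  case: (headc a) => [|k] /=; first by rewrite /enc /= headc_cons tailc_cons.
  have h1 : headc (code (map (fun l => code (map tree_info l)) S)) = code (map tree_info (head [::] S)).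
    by case: S => [|G S] //=; rewrite headc_cons.
  have h2 : tailc (code (map (fun l => code (map tree_info l)) S))
      = code (map (fun l => code (map tree_info l)) (behead S)).
    by case: S {h1} => [|G S] //=; rewrite tailc_cons.
  by rewrite /enc headc_cons tailc_cons nodec_tree_info h1 h2.
rewrite /index_num H /enc headc_cons unpickle_kcode /GenTree.decode -/fs.
case: fs.1 => [|t f] //=.
rewrite headc_cons tree_info_odd; case: t => [y|k g] //; rewrite /tree_info /obind /oapp.
by case: (kdec (GenTree.Node k g)) => // c; rewrite doubleK.
Qed.

Lemma pc_index_num k P F : pc k P F -> pc k P (fun r => index_num (F r)).
Proof.
apply: pc_app1.
have hn : pc 2 tt1 (fun r => nodec (r 0) (r 1)) by rewrite /nodec /is_program; pca.
have hs : pc 2 tt1 (fun r => stepc (r 0) (r 1)).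
  rewrite /stepc; pca; apply: (pc_app2 (f := nodec)) => //; pca.
have h0 : pc 1 tt1 (fun r => headc (headc (foldc stepc (consc 0 0) (r 0)))).
  by pca; apply: pc_foldc => //; pca.
rewrite /index_num; apply: pc_if; [|exact: pc_const|].
- by apply: pc_odd.
- by apply: pc_half; apply: pc_weaken h0.
Qed.

Definition swapc i A :=
  mkseqc (sizec A)
    (fun j => if j == 0 then nthc A i else if j == i then nthc A 0 else nthc A j).

Lemma swapcE i a : i < size a -> swapc i (code a) = code (swap0 i a).
Proof.
move=> hi; rewrite /swapc mkseqcE /sizec /nthc CodeSeq.codeK /swap0; congr code.
apply: (@eq_from_nth _ 0).
  by rewrite size_mkseq !size_set_nth; case: (a) hi => //=; lia.
move=> j; rewrite size_mkseq => hj; rewrite nth_mkseq // !nth_set_nth /=.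
case: (j =P 0) => [->|hj0].
  by rewrite nth_set_nth /=; case: eqP => [<-|] //.
by rewrite nth_set_nth /=; case: eqP => // _; case: eqP.
Qed.

(* Kinds of configurations: [0] for a leaf with value [leaf_value], [1] for a
   call of the type-1 argument at [leaf_value], [2] for a first subcomputation
   [subconf x 0] whose value [y] leads to [nextconf x y], and [3] for an
   application of S8 to the family [subconf x].  Configurations that get stuck
   are of kind [2] with themselves as first subcomputation. *)
Definition conf_tag x := headc (headc x).
Definition conf_arg1 x := nthc (headc x) 1.
Definition conf_arg2 x := nthc (headc x) 2.
Definition conf_env x := tailc x.

Definition conf (c : kcode) (a : seq nat) := consc (kcode_num c) (code a).

Definition kind x :=
  if (conf_tag x == 1) || (((conf_tag x == 0) || (conf_tag x == 2)) && (conf_env x != 0)) then 0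
  else if (conf_tag x == 6) && ((conf_arg1 x == 0) && (conf_env x != 0)) then 1
  else if conf_tag x == 7 then 3
  else 2.

Definition leaf_value x :=
  if conf_tag x == 0 then (headc (conf_env x)).+1
  else if conf_tag x == 1 then conf_arg1 x
  else headc (conf_env x).

(** A convergent dummy: schemes with a single premise take it as first subcomputation and so fit
    kind [2]. *)
Definition triv := conf (Cconst 0) [::].

Definition subconf x i :=
  if conf_tag x == 3 then consc (conf_arg2 x) (conf_env x)
  else if (conf_tag x == 4) && (conf_env x != 0) then
    if headc (conf_env x) == 0 then triv
    else consc (headc x) (consc (headc (conf_env x)).-1 (tailc (conf_env x)))
  else if (conf_tag x == 5) && (conf_arg1 x < sizec (conf_env x)) then triv
  else if conf_tag x == 7 then consc (conf_arg1 x) (consc i (conf_env x))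
  else if (conf_tag x == 8) && ((conf_env x != 0) && (index_num (headc (conf_env x)) != 0)) then triv
  else x.

Definition nextconf x y :=
  if conf_tag x == 3 then consc (conf_arg1 x) (consc y (conf_env x))
  else if conf_tag x == 4 then
    if headc (conf_env x) == 0 then consc (conf_arg1 x) (tailc (conf_env x))
    else consc (conf_arg2 x) (consc y (consc (headc (conf_env x)).-1 (tailc (conf_env x))))
  else if conf_tag x == 5 then consc (conf_arg2 x) (swapc (conf_arg1 x) (conf_env x))
  else consc (index_num (headc (conf_env x))) (tailc (conf_env x)).

Lemma pc_kind k P F : pc k P F -> pc k P (fun r => kind (F r)).
Proof. by apply: pc_app1; rewrite /kind /conf_tag /conf_env /conf_arg1; pca. Qed.

Lemma pc_leaf_value k P F : pc k P F -> pc k P (fun r => leaf_value (F r)).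
Proof. by apply: pc_app1; rewrite /leaf_value /conf_tag /conf_env /conf_arg1; pca. Qed.

Lemma pc_subconf k P F G : pc k P F -> pc k P G -> pc k P (fun r => subconf (F r) (G r)).
Proof.
by apply: (pc_app2 (f := subconf)); rewrite /subconf /conf_tag /conf_env /conf_arg1 /conf_arg2; pca; apply: pc_index_num; pca.
Qed.

Lemma pc_nextconf k P F G : pc k P F -> pc k P G -> pc k P (fun r => nextconf (F r) (G r)).
Proof.
apply: (pc_app2 (f := nextconf)); rewrite /nextconf /conf_tag /conf_env /conf_arg1 /conf_arg2 /swapc; pca.
by apply: pc_index_num; pca.
Qed.

(** Only the first type-1 argument can be called, so [Capp k] with [k > 0] is stuck. This is why the
    translation to and from [Comp] assumes at most one such argument. *)
Inductive Run (al : seq (nat -> nat)) : nat -> nat -> Prop :=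
| Run_leaf x : kind x = 0 -> Run al x (leaf_value x)
| Run_oracle x : kind x = 1 -> 0 < size al -> Run al x (nth (fun=> 0) al 0 (leaf_value x))
| Run_bind x y z : kind x = 2 -> Run al (subconf x 0) y -> Run al (nextconf x y) z -> Run al x z
| Run_fun x g : kind x = 3 -> (forall i, Run al (subconf x i) (g i)) -> Run al x (Suslin g).

Lemma nthc_cons0 x t : nthc (consc x t) 0 = x.
Proof. by rewrite /nthc decode_consc. Qed.

Lemma nthc_consS x t i : nthc (consc x t) i.+1 = nthc t i.
Proof. by rewrite /nthc decode_consc. Qed.

Lemma conf_tagE c a : conf_tag (conf c a) =
  match c with
  | Csucc => 0 | Cconst _ => 1 | Cid => 2 | Ccomp _ _ => 3 | Cpr _ _ => 4
  | Cswap _ _ => 5 | Capp _ => 6 | Cfun _ => 7 | Cenum => 8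
  end.
Proof. by rewrite /conf_tag headc_cons; case: c => *; rewrite [kcode_num _]/= headc_cons. Qed.

Lemma conf_arg1E c a : conf_arg1 (conf c a) =
  match c with
  | Cconst q => q | Ccomp e _ => kcode_num e | Cpr e _ => kcode_num e
  | Cswap i _ => i | Capp k => k | Cfun e => kcode_num e | _ => 0
  end.
Proof.
by rewrite /conf_arg1 headc_cons; case: c => *; rewrite [kcode_num _]/= nthc_consS // nthc_cons0.
Qed.

Lemma conf_arg2E c a : conf_arg2 (conf c a) =
  match c with
  | Ccomp _ e => kcode_num e | Cpr _ e => kcode_num e | Cswap _ e => kcode_num e | _ => 0
  end.
Proof.
by rewrite /conf_arg2 headc_cons; case: c => *; rewrite [kcode_num _]/= nthc_consS // nthc_consS // nthc_cons0.
Qed.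

Lemma conf_envE c a : conf_env (conf c a) = code a. Proof. exact: tailc_cons. Qed.

Lemma code_cons x a : code (x :: a) = consc x (code a). Proof. by []. Qed.

Lemma kindE c a : kind (conf c a) =
  match c, a with
  | Cconst _, _ => 0 | Csucc, _ :: _ => 0 | Cid, _ :: _ => 0
  | Capp 0, _ :: _ => 1 | Cfun _, _ => 3 | _, _ => 2
  end.
Proof.
rewrite /kind conf_tagE conf_arg1E conf_envE code_eq0.
by case: c => [|q||e1 e2|e1 e2|i e|k|e|]; case: a => [|x a] //=; case: k.
Qed.

Lemma subconf_compE e1 e2 a i : subconf (conf (Ccomp e1 e2) a) i = conf e2 a.
Proof. by rewrite /subconf conf_tagE conf_arg2E conf_envE. Qed.
Lemma nextconf_compE e1 e2 a y : nextconf (conf (Ccomp e1 e2) a) y = conf e1 (y :: a).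
Proof. by rewrite /nextconf conf_tagE conf_arg1E conf_envE. Qed.
Lemma subconf_pr0E e1 e2 a i : subconf (conf (Cpr e1 e2) (0 :: a)) i = triv.
Proof. by rewrite /subconf conf_tagE conf_envE code_eq0 code_cons headc_cons. Qed.
Lemma nextconf_pr0E e1 e2 a y : nextconf (conf (Cpr e1 e2) (0 :: a)) y = conf e1 a.
Proof. by rewrite /nextconf conf_tagE conf_arg1E conf_envE code_cons headc_cons tailc_cons. Qed.
Lemma subconf_prSE e1 e2 n a i :
  subconf (conf (Cpr e1 e2) (n.+1 :: a)) i = conf (Cpr e1 e2) (n :: a).
Proof. by rewrite /subconf conf_tagE conf_envE code_eq0 code_cons !headc_cons tailc_cons. Qed.
Lemma nextconf_prSE e1 e2 n a y :
  nextconf (conf (Cpr e1 e2) (n.+1 :: a)) y = conf e2 (y :: n :: a).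
Proof. by rewrite /nextconf conf_tagE conf_arg2E conf_envE code_cons !headc_cons tailc_cons. Qed.
Lemma subconf_swapE i e a j : i < size a -> subconf (conf (Cswap i e) a) j = triv.
Proof. by move=> h; rewrite /subconf conf_tagE conf_arg1E conf_envE /sizec CodeSeq.codeK h. Qed.
Lemma nextconf_swapE i e a y : i < size a -> nextconf (conf (Cswap i e) a) y = conf e (swap0 i a).
Proof. by move=> h; rewrite /nextconf conf_tagE conf_arg1E conf_arg2E conf_envE swapcE. Qed.
Lemma subconf_funE e a i : subconf (conf (Cfun e) a) i = conf e (i :: a).
Proof. by rewrite /subconf conf_tagE conf_arg1E conf_envE. Qed.
Lemma subconf_enumE n (c : kcode) a j : unpickle n = Some c -> subconf (conf Cenum (n :: a)) j = triv.
Proof.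
by move=> h; rewrite /subconf conf_tagE conf_envE code_eq0 code_cons headc_cons index_numE h -lt0n kcode_num_gt0.
Qed.
Lemma nextconf_enumE n (c : kcode) a y : unpickle n = Some c -> nextconf (conf Cenum (n :: a)) y = conf c a.
Proof. by move=> h; rewrite /nextconf conf_tagE conf_envE code_cons headc_cons tailc_cons index_numE h. Qed.
Lemma leaf_valueE c a : leaf_value (conf c a) =
  match c, a with
  | Csucc, x :: _ => x.+1 | Csucc, [::] => 1 | Cconst q, _ => q
  | _, x :: _ => x | _, [::] => 0
  end.
Proof.
by rewrite /leaf_value conf_tagE conf_arg1E conf_envE; case: c; case: a => // *; rewrite code_cons headc_cons.
Qed.

Lemma Run_triv al : Run al triv 0.
Proof. by have -> : 0 = leaf_value triv; [rewrite leaf_valueE | apply: Run_leaf; rewrite kindE]. Qed.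

Lemma Comp_Run al c a z : size al <= 1 -> Comp Suslin al c a z -> Run al (conf c a) z.
Proof.
move=> hal; elim=> {c a z}.
- move=> x a; rewrite -[x.+1](leaf_valueE Csucc (x :: a)); apply: Run_leaf; exact: kindE.
- move=> q a; rewrite -[X in Run _ _ X](leaf_valueE (Cconst q) a); apply: Run_leaf; exact: kindE.
- move=> x a; rewrite -[X in Run _ _ X](leaf_valueE Cid (x :: a)); apply: Run_leaf; exact: kindE.
- move=> e1 e2 a y z _ h1 _ h2; apply: (Run_bind (y := y)); rewrite ?kindE //.
  + by rewrite subconf_compE.
  + by rewrite nextconf_compE.
- move=> e1 e2 a z _ h1; apply: (Run_bind (y := 0)); rewrite ?kindE //.
  + by rewrite subconf_pr0E; apply: Run_triv.
  + by rewrite nextconf_pr0E.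
- move=> e1 e2 n a y z _ h1 _ h2; apply: (Run_bind (y := y)); rewrite ?kindE //.
  + by rewrite subconf_prSE.
  + by rewrite nextconf_prSE.
- move=> i e1 a z hi _ h1; apply: (Run_bind (y := 0)); rewrite ?kindE //.
  + by rewrite subconf_swapE //; apply: Run_triv.
  + by rewrite nextconf_swapE.
- move=> k x a hk; have hk0 : k = 0 by lia.
  subst k; rewrite -[X in nth _ _ _ X](leaf_valueE (Capp 0) (x :: a)).
  by apply: Run_oracle => //; rewrite kindE.
- move=> e1 a g _ h; apply: Run_fun; rewrite ?kindE // => i.
  by rewrite subconf_funE.
- move=> n a c z hc _ h; apply: (Run_bind (y := 0)); rewrite ?kindE //.
  + by rewrite (subconf_enumE _ _ hc); apply: Run_triv.
  + by rewrite (nextconf_enumE _ _ hc).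
Qed.

Lemma Run_inv al x z : Run al x z ->
  match kind x with
  | 0 => z = leaf_value x
  | 1 => 0 < size al /\ z = nth (fun=> 0) al 0 (leaf_value x)
  | 2 => exists2 y, Run al (subconf x 0) y & Run al (nextconf x y) z
  | 3 => exists2 g, (forall i, Run al (subconf x i) (g i)) & z = Suslin g
  | _ => False
  end.
Proof. by case=> [{}x|{}x|{}x y {}z|{}x g] -> //; eauto. Qed.

Lemma Run_det al x y z : Run al x y -> Run al x z -> y = z.
Proof.
move=> H; elim: H z => {x y} [x hk|x hk ha|x y z hk _ IH1 _ IH2|x g hk _ IH] z'
  /Run_inv; rewrite hk.
- by [].
- by case.
- by case=> y' /IH1 <- /IH2.
- move=> [g' hg ->]; congr Suslin.
  by apply: functional_extensionality => i; apply: IH.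
Qed.

Lemma subconf_noarg x i : conf_tag x = 8 -> conf_env x = 0 -> subconf x i = x.
Proof. by rewrite /subconf => -> ->. Qed.

Lemma subconf_badindex x i : conf_tag x = 8 -> index_num (headc (conf_env x)) = 0 -> subconf x i = x.
Proof. by rewrite /subconf => -> ->; rewrite !andbF. Qed.

Lemma Run_Comp al c a z : size al <= 1 -> Run al (conf c a) z -> Comp Suslin al c a z.
Proof.
move=> hal; move E : (conf c a) => x H.
elim: H c a E => {x z} [x hk|x hk ha|x y z hk h1 IH1 h2 IH2|x g hk h IH] c a E; subst x.
- rewrite leaf_valueE; rewrite kindE in hk.
  case: c hk => [|q||e1 e2|e1 e2|i e|[|k]|e|]; case: a => [|x a] //= _.
  + exact: C_succ.
  + exact: C_const.
  + exact: C_const.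
  + exact: C_id.
- rewrite leaf_valueE; rewrite kindE in hk.
  case: c hk => [|q||e1 e2|e1 e2|i e|[|k]|e|]; case: a => [|x a] //= _.
  exact: C_app.
- rewrite kindE in hk.
  (* A stuck configuration is its own first premise, so the induction hypothesis already claims that
     the program converges there, which it does not. *)
  have stuck e : subconf (conf c a) 0 = conf c a -> (forall y, ~ Comp Suslin al c a y) -> Comp Suslin al c a e.
    by move=> hs hn; case: (hn y); apply: IH1.
  case: c hk IH1 IH2 stuck h1 h2 => [|q||e1 e2|e1 e2|i e|k|e|] hk IH1 IH2 stuck h1 h2.
  + by apply: stuck; [rewrite /subconf conf_tagE | case: a hk {IH1 IH2 h1 h2} => // _ y' /Comp_inv[? [? []]]].
  + by [].
  + by apply: stuck; [rewrite /subconf conf_tagE | case: a hk {IH1 IH2 h1 h2} => // _ y' /Comp_inv[? [? []]]].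
  + by apply: (C_comp (y := y)); [apply: IH1; rewrite subconf_compE | apply: IH2; rewrite nextconf_compE].
  + case: a hk IH1 IH2 stuck h1 h2 => [|[|n] a] hk IH1 IH2 stuck h1 h2.
    * by apply: stuck; [rewrite /subconf conf_tagE conf_envE | move=> y' /Comp_inv].
    * by apply: C_pr0; apply: IH2; rewrite nextconf_pr0E.
    * by apply: (C_prS (y := y)); [apply: IH1; rewrite subconf_prSE | apply: IH2; rewrite nextconf_prSE].
  + case: (ltnP i (size a)) => hi; first by apply: C_swap => //; apply: IH2; rewrite nextconf_swapE.
    apply: stuck; first by rewrite /subconf conf_tagE conf_arg1E conf_envE /sizec CodeSeq.codeK ltnNge hi.
    by move=> y' /Comp_inv[]; rewrite ltnNge hi.
  + apply: stuck; first by rewrite /subconf conf_tagE.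
    by move=> y' /Comp_inv[hk']; have hk0 : k = 0; [lia | subst k; case: a hk {IH1 IH2 h1 h2}].
  + by [].
  + case: a hk IH1 IH2 stuck h1 h2 => [|n a] hk IH1 IH2 stuck h1 h2.
      apply: stuck; last by move=> y' /Comp_inv.
      by apply: subconf_noarg; rewrite ?conf_tagE ?conf_envE.
    case hc : (unpickle n : option kcode) => [c|].
      by apply: (C_enum hc); apply: IH2; rewrite (nextconf_enumE _ _ hc).
    apply: stuck.
      by apply: subconf_badindex; rewrite ?conf_tagE // conf_envE code_cons headc_cons index_numE hc.
    by move=> y' /Comp_inv[c]; rewrite hc.
- rewrite kindE in hk.
  case: c hk h IH => [|q||e1 e2|e1 e2|i e|[|k]|e|]; case: a => [|x' a] //= _ _ IH.
  + by apply: C_fun => i; apply: IH; rewrite subconf_funE.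
  + by apply: C_fun => i; apply: IH; rewrite subconf_funE.
Qed.

(** * Selection *)

Ltac pcx ::= first [simple apply pc_kind | simple apply pc_leaf_value | simple apply pc_subconf
  | simple apply pc_nextconf | simple apply pc_index_num].

Definition converges x := exists z, Run [::] x z.

(** Makes values of convergent configurations available to programs. The interpreter calls itself
    through its own index [s], and [ok] lists the calls that have to converge. *)
Lemma interp : exists interp_index, forall x z, Run [::] x z ->
  Comp Suslin [::] Cenum [:: interp_index; x] z.
Proof.
pose ok (s x : nat) := (kind x == 2 -> runs s [:: s; subconf x 0] /\
    runs s [:: s; nextconf x (run_val s [:: s; subconf x 0])]) /\
  (kind x == 3 -> forall i, runs s [:: s; subconf x i]).
have [e he] : pc 2 (fun r => ok (r 0) (r 1)) (fun r =>
    if kind (r 1) == 0 then leaf_value (r 1)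
    else if kind (r 1) == 2 then run_val (r 0) [:: r 0; nextconf (r 1) (run_val (r 0) [:: r 0; subconf (r 1) 0])]
    else if kind (r 1) == 3 then Suslin (fun i => run_val (r 0) [:: r 0; subconf (r 1) i])
    else 0).
  pca.
  - by move=> r [[[h _] _] hk] /=; case: (h hk).
  - by move=> r [[[h _] _] hk] /=; case: (h hk).
  - by move=> r [[[[_ h] _] _] hk] /=; apply: h.
pose s := pickle e.
suff H x z : Run [::] x z -> Comp Suslin [::] e [:: s; x] z.
  exists (pickle (Ccomp e (Cconst s))) => x z /H h.
  by apply/Comp_pickle; apply: C_comp h; apply: C_const.
elim=> {x z} [x hk|x hk //|x y z hk _ IH1 _ IH2|x g hk _ IH].
- by have := he [::] [:: s; x] erefl; rewrite /= /ok hk; apply; split.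
- have h1 := run_valE (proj2 (Comp_pickle e _ _) IH1).
  have h2 := run_valE (proj2 (Comp_pickle e _ _) IH2).
  have := he [::] [:: s; x] erefl; rewrite /= /ok hk h1 h2 /=; apply; split=> // _.
  by split; eexists; apply/Comp_pickle; eassumption.
- have h i := run_valE (proj2 (Comp_pickle e _ _) (IH i)).
  have := he [::] [:: s; x] erefl; rewrite /= /ok hk /=.
  have -> : (fun i => run_val s [:: s; subconf x i]) = g.
    by apply: functional_extensionality => i; rewrite h.
  apply; split=> // _ i; exists (g i).
  by apply/Comp_pickle; apply: IH.
Qed.

Definition interp_index := proj1_sig (constructive_indefinite_description _ interp).

Lemma interp_indexP x z : Run [::] x z -> Comp Suslin [::] Cenum [:: interp_index; x] z.
Proof. exact: (proj2_sig (constructive_indefinite_description _ interp)). Qed.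

Lemma interp_indexE x z : Run [::] x z -> run_val interp_index [:: x] = z.
Proof. by move/interp_indexP/run_valE. Qed.

(** A configuration of kind [1] diverges in the absence of a type-1 argument; as its own premise it
    then also has a divergent premise, so convergence of all premises excludes this kind. *)
Definition premise x i := if kind x == 3 then subconf x i else if kind x == 2 then subconf x 0 else x.
Definition nextval x := nextconf x (run_val interp_index [:: subconf x 0]).

(** The answer [0] certifies that [x] converges, any other answer that [y] does. Either each premise
    of [x] wins against some premise of [y], and then all premises of [x] converge; or one premise
    of [x] loses to all premises of [y], and then all of those converge. The side whose premises
    converge is finished if it is of kind [3]; otherwise its successor configuration is compared
    with the premises of the other side in the same way. *)
Definition selF (c : nat -> nat -> nat) x y :=
  if kind x == 0 then 0 else if kind y == 0 then 1 else
  if allb (fun i => exb (fun j => c (premise x i) (premise y j) == 0)) then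
    if kind x == 3 then 0 else
    if exb (fun j => c (nextval x) (premise y j) == 0) then 0 else
    if kind y == 3 then 1 else c (nextval x) (nextval y)
  else
    if kind y == 3 then 1 else
    if exb (fun i => c (premise x i) (nextval y) != 0) then 1 else
    if kind x == 3 then 0 else c (nextval x) (nextval y).

Section Selection.
Variable self : nat.
Let c x y := run_val self [:: self; x; y].

Definition selOK x y := exists r, [/\ Comp Suslin [::] Cenum [:: self; self; x; y] r,
  r = 0 -> converges x & r <> 0 -> converges y].

Lemma selOK_run_val x y : selOK x y ->
  [/\ runs self [:: self; x; y], c x y = 0 -> converges x & c x y <> 0 -> converges y].
Proof. by case=> r [h h1 h2]; rewrite /c (run_valE h); split=> //; exists r. Qed.

Definition nextof x x' := kind x = 2 /\ exists2 v, Run [::] (subconf x 0) v & x' = nextconf x v.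

Definition selPre x y := kind x <> 0 -> kind y <> 0 ->
  [/\ forall i j, selOK (premise x i) (premise y j),
      forall x' j, nextof x x' -> selOK x' (premise y j),
      forall y' i, nextof y y' -> selOK (premise x i) y'
    & forall x' y', nextof x x' -> nextof y y' -> selOK x' y'].

Lemma kind_le3 x : kind x <= 3.
Proof. by rewrite /kind; do ! case: ifP => _. Qed.

Lemma kind_cases x : [\/ kind x = 0, kind x = 1, kind x = 2 | kind x = 3].
Proof. by have := kind_le3 x; case: (kind x) => [|[|[|[|]]]] // _; constructor. Qed.

Lemma kind1_stuck x : kind x = 1 -> ~ converges x.
Proof. by move=> hk [z /Run_inv]; rewrite hk => -[]. Qed.

Lemma next_nxt x : (forall i, converges (premise x i)) -> kind x <> 0 -> kind x <> 3 -> nextof x (nextval x).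
Proof.
move=> h h0 h3; case: (kind_cases x) => // hk.
  by have := h 0; rewrite /premise hk => /(kind1_stuck hk).
by have := h 0; rewrite /premise hk /= => -[v hv]; split=> //; exists v; rewrite // /nextval (interp_indexE hv).
Qed.

Lemma converges_premises x : kind x = 3 -> (forall i, converges (premise x i)) -> converges x.
Proof.
move=> hk; rewrite /premise hk /= => h.
have [g hg] : exists g, forall i, Run [::] (subconf x i) (g i).
  exists (fun i => epsilon (inhabits 0) (Run [::] (subconf x i))) => i.
  exact: epsilon_spec (h i).
by exists (Suslin g); apply: Run_fun.
Qed.

Lemma converges_next x x' : nextof x x' -> converges x' -> converges x.
Proof. by case=> hk [v hv ->] [z hz]; exists z; apply: Run_bind hk hv hz. Qed.

Lemma converges_leaf x : kind x = 0 -> converges x.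
Proof. by move=> h; exists (leaf_value x); apply: Run_leaf. Qed.

Lemma sel_all x y : selPre x y -> kind x <> 0 -> kind y <> 0 ->
  allb (fun i => exb (fun j => c (premise x i) (premise y j) == 0)) -> forall i, converges (premise x i).
Proof.
move=> hP hx hy /allbP h i; case/exbP: (h i) => j /eqP hj.
by case: (hP hx hy) => h1 _ _ _; case/selOK_run_val: (h1 i j) => _ h2 _; apply: h2.
Qed.

Lemma sel_nall x y : selPre x y -> kind x <> 0 -> kind y <> 0 ->
  ~~ allb (fun i => exb (fun j => c (premise x i) (premise y j) == 0)) -> forall j, converges (premise y j).
Proof.
move=> hP hx hy /negPn/exbP[i /exbP h] j.
case: (hP hx hy) => h1 _ _ _; case/selOK_run_val: (h1 i j) => _ _; apply=> h2.
by apply: h; exists j; apply/eqP.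
Qed.

Lemma sel_nex x y : selPre x y -> kind x <> 0 -> kind y <> 0 -> nextof x (nextval x) ->
  ~~ exb (fun j => c (nextval x) (premise y j) == 0) -> forall j, converges (premise y j).
Proof.
move=> hP hx hy hn /exbP h j; case: (hP hx hy) => _ h1 _ _.
case/selOK_run_val: (h1 _ j hn) => _ _; apply=> h2.
by apply: h; exists j; apply/eqP.
Qed.

Lemma sel_nex' x y : selPre x y -> kind x <> 0 -> kind y <> 0 -> nextof y (nextval y) ->
  ~~ exb (fun i => c (premise x i) (nextval y) != 0) -> forall i, converges (premise x i).
Proof.
move=> hP hx hy hn /exbP h i; case: (hP hx hy) => _ _ h1 _.
case/selOK_run_val: (h1 _ i hn) => _ + _; apply; apply/eqP/negPn/negP => h2.
by apply: h; exists i.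
Qed.

Lemma selF_sound x y : selPre x y ->
  (selF c x y = 0 -> converges x) /\ (selF c x y <> 0 -> converges y).
Proof.
move=> hP; rewrite /selF.
case: eqP => hx; first by split=> // _; apply: converges_leaf.
case: eqP => hy; first by split=> // _; apply: converges_leaf.
case: (hP hx hy) => _ hP2 hP3 hP4.
case: ifPn => hall.
- have hcx := sel_all hP hx hy hall.
  case: eqP => hx3; first by split=> // _; apply: converges_premises.
  have hnx := next_nxt hcx hx hx3.
  case: ifPn => hex.
    split=> // _; apply: (converges_next hnx); case/exbP: hex => j /eqP hj.
    by case/selOK_run_val: (hP2 _ j hnx) => _ h _; apply: h.
  have hcy := sel_nex hP hx hy hnx hex.
  case: eqP => hy3; first by split=> // _; apply: converges_premises.
  have hny := next_nxt hcy hy hy3.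
  have [_ h1 h2] := selOK_run_val (hP4 _ _ hnx hny).
  by split=> h; [apply: (converges_next hnx); apply: h1 | apply: (converges_next hny); apply: h2].
- have hcy := sel_nall hP hx hy hall.
  case: eqP => hy3; first by split=> // _; apply: converges_premises.
  have hny := next_nxt hcy hy hy3.
  case: ifPn => hex.
    split=> // _; apply: (converges_next hny); case/exbP: hex => i /eqP hi.
    by case/selOK_run_val: (hP3 _ i hny) => _ _; apply.
  have hcx := sel_nex' hP hx hy hny hex.
  case: eqP => hx3; first by split=> // _; apply: converges_premises.
  have hnx := next_nxt hcx hx hx3.
  have [_ h1 h2] := selOK_run_val (hP4 _ _ hnx hny).
  by split=> h; [apply: (converges_next hnx); apply: h1 | apply: (converges_next hny); apply: h2].
Qed.

Lemma selOK_runs x y : selOK x y -> runs self [:: self; x; y].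
Proof. by case/selOK_run_val. Qed.

Lemma nextof_runs x x' : nextof x x' -> runs interp_index [:: subconf x 0].
Proof. by case=> _ [v /interp_indexP hv _]; exists v. Qed.

Lemma sel_nextx x y : selPre x y -> kind x != 0 -> kind y != 0 ->
  allb (fun i => exb (fun j => c (premise x i) (premise y j) == 0)) -> kind x != 3 ->
  nextof x (nextval x).
Proof. by move=> hP /eqP hx /eqP hy hall /eqP h3; apply: next_nxt => //; apply: (sel_all hP). Qed.

Lemma sel_nexty x y : selPre x y -> kind x != 0 -> kind y != 0 ->
  ~~ allb (fun i => exb (fun j => c (premise x i) (premise y j) == 0)) -> kind y != 3 ->
  nextof y (nextval y).
Proof. by move=> hP /eqP hx /eqP hy hall /eqP h3; apply: next_nxt => //; apply: (sel_nall hP). Qed.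

Lemma sel_nexty' x y : selPre x y -> kind x != 0 -> kind y != 0 -> nextof x (nextval x) ->
  ~~ exb (fun j => c (nextval x) (premise y j) == 0) -> kind y != 3 -> nextof y (nextval y).
Proof. by move=> hP /eqP hx /eqP hy hn hex /eqP h3; apply: next_nxt => //; apply: (sel_nex hP). Qed.

Lemma sel_nextx' x y : selPre x y -> kind x != 0 -> kind y != 0 -> nextof y (nextval y) ->
  ~~ exb (fun i => c (premise x i) (nextval y) != 0) -> kind x != 3 -> nextof x (nextval x).
Proof. by move=> hP /eqP hx /eqP hy hn hex /eqP h3; apply: next_nxt => //; apply: (sel_nex' hP). Qed.

Lemma sel_runs x y : selPre x y -> kind x != 0 -> kind y != 0 ->
  [/\ forall i j, runs self [:: self; premise x i; premise y j],
      forall x' j, nextof x x' -> runs self [:: self; x'; premise y j],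
      forall y' i, nextof y y' -> runs self [:: self; premise x i; y']
    & forall x' y', nextof x x' -> nextof y y' -> runs self [:: self; x'; y']].
Proof.
move=> hP /eqP hx /eqP hy; case: (hP hx hy) => h1 h2 h3 h4.
by split=> *; apply: selOK_runs; auto.
Qed.

End Selection.

(* The comparison of two computations runs through their immediate
   subcomputations; it only has to decide which one converges, not to compare
   ordinal ranks. *)
Lemma selection : exists select_index, forall x y, converges x \/ converges y ->
  exists r, [/\ Comp Suslin [::] Cenum [:: select_index; x; y] r,
    r = 0 -> converges x & r <> 0 -> converges y].
Proof.
have [e he] : pc 3 (fun r => selPre (r 0) (r 1) (r 2)) (fun r =>
    selF (fun x y => run_val (r 0) [:: r 0; x; y]) (r 1) (r 2)).
  rewrite /selF /premise /nextval; pca; cbv beta; move=> r /=.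
  - by case=> [[hP hx] hy]; case: (sel_runs hP hx hy) => h _ _ _; apply: h.
  - by case=> [[[[hP hx] hy] hall] h3]; apply: nextof_runs (sel_nextx hP hx hy hall h3).
  - case=> [[[[hP hx] hy] hall] h3]; have hn := sel_nextx hP hx hy hall h3.
    by case: (sel_runs hP hx hy) => _ h _ _; apply: h hn.
  - by case=> [[[[[[hP hx] hy] hall] h3] _] _]; apply: nextof_runs (sel_nextx hP hx hy hall h3).
  - case=> [[[[[[hP hx] hy] hall] h3] hex] h3']; have hn := sel_nextx hP hx hy hall h3.
    exact: nextof_runs (sel_nexty' hP hx hy hn hex h3').
  - case=> [[[[[[hP hx] hy] hall] h3] hex] h3']; have hn := sel_nextx hP hx hy hall h3.
    have hn' := sel_nexty' hP hx hy hn hex h3'.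
    by case: (sel_runs hP hx hy) => _ _ _ h; apply: h hn hn'.
  - by case=> [[[[hP hx] hy] hall] h3]; apply: nextof_runs (sel_nexty hP hx hy hall h3).
  - case=> [[[[hP hx] hy] hall] h3]; have hn := sel_nexty hP hx hy hall h3.
    by case: (sel_runs hP hx hy) => _ _ h _; apply: h hn.
  - case=> [[[[[[hP hx] hy] hall] h3] hex] h3']; have hn := sel_nexty hP hx hy hall h3.
    exact: nextof_runs (sel_nextx' hP hx hy hn hex h3').
  - by case=> [[[[[[hP hx] hy] hall] h3] _] _]; apply: nextof_runs (sel_nexty hP hx hy hall h3).
  - case=> [[[[[[hP hx] hy] hall] h3] hex] h3']; have hn := sel_nexty hP hx hy hall h3.
    have hn' := sel_nextx' hP hx hy hn hex h3'.
    by case: (sel_runs hP hx hy) => _ _ _ h; apply: h hn' hn.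
pose s := pickle e.
have main x y : selPre s x y -> selOK s x y.
  move=> hP; have [h0 hS] := selF_sound hP.
  exists (selF (fun x y => run_val s [:: s; x; y]) x y); split=> //.
  by apply/Comp_pickle; apply: (he [::] [:: s; x; y]).
(* In every recursive call the left argument is a premise or the successor of [x], so induction on
   the computation of [x] suffices for arbitrary [y]; [hr] is the mirror image. *)
have hl x z : Run [::] x z -> forall y, selOK s x y.
  elim=> {x z} [x hk|x hk //|x v z hk r1 IH1 r2 IH2|x g hk r IH] y; apply: main => hx hy.
  - by [].
  - have hs i : premise x i = subconf x 0 by rewrite /premise hk.
    have hn x' : nextof x x' -> x' = nextconf x v.
      by case=> _ [v' hv' ->]; rewrite (Run_det hv' r1).
    split.
    + by move=> i j; rewrite hs; apply: IH1.
    + by move=> x' j /hn ->; apply: IH2.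
    + by move=> y' i _; rewrite hs; apply: IH1.
    + by move=> x' y' /hn -> _; apply: IH2.
  - have hs i : premise x i = subconf x i by rewrite /premise hk.
    split.
    + by move=> i j; rewrite hs; apply: IH.
    + by move=> x' j []; rewrite hk.
    + by move=> y' i _; rewrite hs; apply: IH.
    + by move=> x' y' []; rewrite hk.
have hr y z : Run [::] y z -> forall x, selOK s x y.
  elim=> {y z} [y hk|y hk //|y v z hk r1 IH1 r2 IH2|y g hk r IH] x; apply: main => hx hy.
  - by [].
  - have hs i : premise y i = subconf y 0 by rewrite /premise hk.
    have hn y' : nextof y y' -> y' = nextconf y v.
      by case=> _ [v' hv' ->]; rewrite (Run_det hv' r1).
    split.
    + by move=> i j; rewrite hs; apply: IH1.
    + by move=> x' j _; rewrite hs; apply: IH1.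
    + by move=> y' i /hn ->; apply: IH2.
    + by move=> x' y' _ /hn ->; apply: IH2.
  - have hs i : premise y i = subconf y i by rewrite /premise hk.
    split.
    + by move=> i j; rewrite hs; apply: IH.
    + by move=> x' j _; rewrite hs; apply: IH.
    + by move=> y' i []; rewrite hk.
    + by move=> x' y' _ []; rewrite hk.
exists (pickle (Ccomp e (Cconst s))) => x y hxy.
have [r [h1 h2 h3]] : selOK s x y.
  by case: hxy => -[z hz]; [exact: (hl _ _ hz y) | exact: (hr _ _ hz x)].
exists r; split=> //; apply/Comp_pickle; apply: C_comp; first exact: C_const.
exact/Comp_pickle.
Qed.

Definition select_index := proj1_sig (constructive_indefinite_description _ selection).

Lemma select_indexP x y : converges x \/ converges y -> [/\ runs select_index [:: x; y],
  run_val select_index [:: x; y] = 0 -> converges x & run_val select_index [:: x; y] <> 0 -> converges y].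
Proof.
move=> /(proj2_sig (constructive_indefinite_description _ selection))[r [h h1 h2]].
by rewrite (run_valE h); split=> //; exists r.
Qed.

Lemma convergesE c a : converges (conf c a) <-> exists z, Comp Suslin [::] c a z.
Proof.
by split=> -[z hz]; exists z; [apply: Run_Comp hz | apply: Comp_Run hz].
Qed.

(* Gandy's selection: the search program compares the computation of its [n]th
   candidate with its own computation at [n + 1]. *)
Lemma gandy (c : kcode) : exists g : kcode, forall b,
  (exists k z, Comp Suslin [::] c [:: k; b] z) ->
  exists2 k, Comp Suslin [::] g [:: b] k & exists z, Comp Suslin [::] c [:: k; b] z.
Proof.
pose X n b := conf c [:: n; b].
pose Y s n b := conf Cenum [:: s; s; n.+1; b].
have [es hes] : pc 3 (fun r => converges (X (r 1) (r 2)) \/ converges (Y (r 0) (r 1) (r 2)))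
    (fun r => run_val select_index [:: X (r 1) (r 2); Y (r 0) (r 1) (r 2)]).
  apply: (pc_run_val (Fs := [:: fun r => X (r 1) (r 2); fun r => Y (r 0) (r 1) (r 2)])).
  - exact: pc_const.
  - split; [|split=> //].
      have h : pc 3 (fun r => converges (X (r 1) (r 2)) \/ converges (Y (r 0) (r 1) (r 2)))
        (fun r => consc (kcode_num c) (consc (r 1) (consc (r 2) 0))) by pca.
      exact: h.
    have h : pc 3 (fun r => converges (X (r 1) (r 2)) \/ converges (Y (r 0) (r 1) (r 2)))
      (fun r => consc (kcode_num Cenum) (consc (r 0) (consc (r 0) (consc (r 1).+1 (consc (r 2) 0))))).
      by pca.
    exact: h.
  - by move=> r /= /select_indexP[].
(* The search started at [n] returns the distance from [n] to the chosen candidate: [e0] runs the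
   candidate and returns [0], [e1] adds one to the result of the search started at [n + 1]. *)
pose e0 := Ccomp (Cconst 0) (xcall 3 c [:: cvar 1; cvar 2]).
pose e1 := Ccomp Csucc (xcall 3 Cenum [:: cvar 0; cvar 0; Ccomp Csucc (cvar 1); cvar 2]).
pose e := cif es e0 e1; pose s := pickle e.
have hv0 n b : evals Suslin [::] [:: cvar 1; cvar 2] [:: s; n; b] [:: n; b].
  by split; [exact: cvarP | split=> //; exact: cvarP].
have hv1 n b : evals Suslin [::] [:: cvar 0; cvar 0; Ccomp Csucc (cvar 1); cvar 2]
    [:: s; n; b] [:: s; s; n.+1; b].
  split; first exact: cvarP.
  split; first exact: cvarP.
  split; last by split=> //; exact: cvarP.
  by apply: (C_comp (y := n)); [exact: cvarP | exact: C_succ].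
have inv v n b : Comp Suslin [::] e [:: s; n; b] v ->
    exists z, Comp Suslin [::] c [:: n + v; b] z.
  elim: v n => [|v IH] n /cif_inv[m _]; case: (m =P 0) => _ /Comp_inv[y].
  - by move/(xcallE _ _ erefl (hv0 n b)); rewrite addn0; exists y.
  - by move=> _ /Comp_inv[? [? []]].
  - by move=> _ /Comp_inv.
  - move/(xcallE _ _ erefl (hv1 n b))/Comp_pickle => h /Comp_inv[y' [a' [[<- _] [E]]]].
    by rewrite -E in h; rewrite -addSnnS; apply: IH.
have cY n b : converges (Y s n b) -> exists v, Comp Suslin [::] e [:: s; n.+1; b] v.
  by move/convergesE => [v /Comp_pickle h]; exists v.
have step n b : (exists z, Comp Suslin [::] c [:: n; b] z) \/
    (exists v, Comp Suslin [::] e [:: s; n.+1; b] v) ->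
    exists v, Comp Suslin [::] e [:: s; n; b] v.
  move=> h; have {}h : converges (X n b) \/ converges (Y s n b).
    case: h => h; [left|right]; apply/convergesE => //.
    by case: h => v h; exists v; apply/Comp_pickle.
  have := hes [::] [:: s; n; b] erefl h => /=.
  have [_ h0 h1] := select_indexP h; case: (run_val _ _) h0 h1 => [|m] h0 h1 hs.
    have /convergesE[z hz] := h0 erefl; exists 0.
    apply: cif0 hs _; apply: C_comp (C_const _ _ _ _).
    by apply/(xcallE _ _ erefl (hv0 n b)); exact: hz.
  have [v hv] := cY _ _ (h1 (PeanoNat.Nat.neq_succ_0 m)); exists v.+1.
  apply: cifS hs _; apply: C_comp (C_succ _ _ _ _).
  by apply/(xcallE _ _ erefl (hv1 n b)); apply/Comp_pickle.
exists (Ccomp (Ccomp e (Cconst s)) (Cconst 0)) => b [k hk].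
(* Convergence of the search descends from the candidate [k] to [0]: if the search converges at
   [n + 1], the comparison made at [n] has a convergent side. *)
have [v hv] : exists v, Comp Suslin [::] e [:: s; 0; b] v.
  have : exists v, Comp Suslin [::] e [:: s; k; b] v by apply: step; left.
  by elim: k {hk} => // k IH h; apply: IH; apply: step; right.
exists v; last exact: inv hv.
by apply: C_comp; [exact: C_const | apply: C_comp hv; exact: C_const].
Qed.

(** * Outer measure on Cantor space *)

Notation lv := headc (only parsing).

Section CantorMeasure.
Import Order.TTheory GRing.Theory Num.Theory.

(* A clopen set is coded by a level [l] together with a bit mask indexed by the
   numbers below [2 ^ l], that is by the first [l] bits of a point. *)
Definition In c x := odd (tailc c %/ 2 ^ (x %% 2 ^ lv c)).
Definition num (f : cantor) L := \sum_(i < L) f i * 2 ^ i.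
Definition clop c f := In c (num f (lv c)).
Definition bits (x : nat) : cantor := fun i => odd (x %/ 2 ^ i).

Lemma num_lt f L : num f L < 2 ^ L.
Proof.
rewrite /num; elim: L => [|L IH]; first by rewrite big_ord0.
by rewrite big_ord_recr /= expnS; move: (\sum_(i < L) _) IH => s; case: (f L); lia.
Qed.

Lemma num_add f l d : exists t, num f (l + d) = num f l + t * 2 ^ l.
Proof.
elim: d => [|d [t IH]]; first by exists 0; rewrite addn0 mul0n addn0.
exists (t + f (l + d) * 2 ^ d); rewrite addnS /num big_ord_recr /= -/(num f (l + d)) IH.
by rewrite mulnDl -mulnA -expnD [d + l]addnC addnA.
Qed.

Lemma num_mod f l L : l <= L -> num f L %% 2 ^ l = num f l.
Proof.
move=> h; have [t] := num_add f l (L - l); rewrite subnKC // => ->.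
by rewrite addnC modnMDl modn_small // num_lt.
Qed.

Lemma In_num c f L : lv c <= L -> In c (num f L) = clop c f.
Proof. by move=> h; rewrite /clop /In !num_mod. Qed.

Lemma num_bits x L : num (bits x) L = x %% 2 ^ L.
Proof.
rewrite /num; elim: L => [|L IH]; first by rewrite big_ord0 modn1.
rewrite big_ord_recr /= {}IH /bits.
have e : x = (x %/ 2 ^ L %/ 2) * 2 ^ L.+1 + (x %% 2 ^ L + odd (x %/ 2 ^ L) * 2 ^ L).
  rewrite {1}(divn_eq x (2 ^ L)) {1}(divn_eq (x %/ 2 ^ L) 2) modn2 expnS.
  by rewrite mulnDl -mulnA addnAC addnA.
rewrite [in RHS]e modnMDl [RHS]modn_small //.
have : x %% 2 ^ L < 2 ^ L by rewrite ltn_pmod // expn_gt0.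
rewrite expnS; move: (x %% _) (odd _) => m b; move: (2 ^ L) => p.
by case: b => /=; lia.
Qed.

Lemma In_bits c x : clop c (bits x) = In c x.
Proof. by rewrite /clop /In num_bits modn_mod. Qed.

Definition maskof n (p : nat -> bool) := sumf n (fun x => p x * 2 ^ x).

Lemma maskof_lt n p : maskof n p < 2 ^ n.
Proof.
rewrite /maskof sumfE; elim: n => [|n IH]; first by rewrite big_ord0.
by rewrite big_ord_recr /= expnS; move: (\sum_(i < n) _) IH => s; case: (p n); lia.
Qed.

Lemma maskofE n p y : y < n -> odd (maskof n p %/ 2 ^ y) = p y.
Proof.
rewrite /maskof => hy; rewrite -(subnKC hy) addSnnS.
elim: (n - y.+1) => [|d IH].
  rewrite addn1 /sumf /= -/(sumf y _) -/(maskof y p) divnDMl ?expn_gt0 //.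
  by rewrite divn_small ?maskof_lt // add0n oddb.
rewrite addnS /sumf /= -/(sumf _ _).
have -> : p (y + d.+1) * 2 ^ (y + d.+1) = (p (y + d.+1) * 2 ^ d.+1) * 2 ^ y.
  by rewrite -mulnA -expnD [d.+1 + y]addnC.
by rewrite divnDMl ?expn_gt0 // oddD expnS mulnCA oddM /= addbF.
Qed.

Definition mkc l (p : nat -> bool) := consc l (maskof (2 ^ l) p).

Lemma lv_mkc l p : lv (mkc l p) = l. Proof. exact: headc_cons. Qed.

Lemma In_mkc l p x : In (mkc l p) x = p (x %% 2 ^ l).
Proof. by rewrite /In /mkc headc_cons tailc_cons maskofE // ltn_pmod // expn_gt0. Qed.

Lemma clop_mkc l p f : clop (mkc l p) f = p (num f l).
Proof. by rewrite /clop In_mkc lv_mkc modn_small // num_lt. Qed.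

Lemma In_level c d x : lv c <= d -> In c (x %% 2 ^ d) = In c x.
Proof. by move=> h; rewrite /In modn_dvdm // dvdn_exp2l. Qed.

Definition capc c d := mkc (lv c + lv d) (fun x => In c x && In d x).
Definition cupc c d := mkc (lv c + lv d) (fun x => In c x || In d x).
Definition diffc c d := mkc (lv c + lv d) (fun x => In c x && ~~ In d x).
Definition fullc := mkc 0 (fun=> true).
Definition epsc k := mkc k (fun x => x == 0).

Lemma clop_cap c d f : clop (capc c d) f = clop c f && clop d f.
Proof. by rewrite clop_mkc !In_num ?leq_addr ?leq_addl. Qed.
Lemma clop_cup c d f : clop (cupc c d) f = clop c f || clop d f.
Proof. by rewrite clop_mkc !In_num ?leq_addr ?leq_addl. Qed.
Lemma clop_diff c d f : clop (diffc c d) f = clop c f && ~~ clop d f.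
Proof. by rewrite clop_mkc !In_num ?leq_addr ?leq_addl. Qed.
Lemma clop_full f : clop fullc f. Proof. by rewrite clop_mkc. Qed.
Lemma clop_empty f : clop 0 f = false. Proof. by rewrite /clop /In div0n. Qed.

Definition cnt L c := sumf (2 ^ L) (fun x => In c x).

Local Open Scope ring_scope.

Definition halfpow (k : nat) : rat := 2%:R ^- k.
Definition mes c : rat := (cnt (lv c) c)%:R * halfpow (lv c).

Lemma halfpow_gt0 k : 0 < halfpow k. Proof. by rewrite /halfpow invr_gt0 exprn_gt0. Qed.
Lemma halfpowS k : halfpow k = halfpow k.+1 + halfpow k.+1.
Proof.
by rewrite /halfpow exprS invfM -mulrDl -[1 in X in X * _]/(1) (_ : 2^-1 + 2^-1 = 1 :> rat) ?mul1r.
Qed.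
Lemma halfpow0 : halfpow 0 = 1. Proof. by rewrite /halfpow expr0 invr1. Qed.
Lemma halfpowD k l : halfpow (k + l) = halfpow k * halfpow l.
Proof. by rewrite /halfpow exprD invfM. Qed.
Lemma halfpow_exp k : (2 ^ k)%:R * halfpow k = 1 :> rat.
Proof. by rewrite /halfpow natrX mulfV // expf_neq0. Qed.

Lemma halfpow_small e : 0 < e -> exists k, halfpow k < e.
Proof.
move=> he; exists (Num.truncn e^-1).+1.
rewrite /halfpow invf_plt ?posrE ?exprn_gt0 //.
apply: lt_le_trans (truncnS_gt _) _.
by rewrite -natrX ler_nat ltnW // ltn_expl.
Qed.

Lemma sum_halfpow n : \sum_(i < n) halfpow i.+1 = 1 - halfpow n.
Proof.
elim: n => [|n IH]; first by rewrite big_ord0 halfpow0 subrr.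
by rewrite big_ord_recr /= IH (halfpowS n); lra.
Qed.

Lemma cnt_level L c : (lv c <= L)%N -> (cnt L c)%:R * halfpow L = mes c.
Proof.
move=> h; rewrite -(subnKC h); elim: (L - lv c)%N => [|d IH].
  by rewrite addn0.
rewrite -{}IH addnS; set M := (lv c + d)%N.
have -> : cnt M.+1 c = (2 * cnt M c)%N.
  rewrite /cnt !sumfE expnS !mul2n -!addnn.
  rewrite big_split_ord /=; congr (_ + _)%N; apply: eq_bigr => x _.
  by rewrite -(@In_level c M) ?leq_addr // modnDl In_level // leq_addr.
by rewrite natrM (halfpowS M); ring.
Qed.

Lemma mes_le c d : (forall f, clop c f -> clop d f) -> mes c <= mes d.
Proof.
move=> h; rewrite -(@cnt_level (lv c + lv d) c) ?leq_addr //.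
rewrite -(@cnt_level (lv c + lv d) d) ?leq_addl //.
rewrite ler_pM2r ?halfpow_gt0 // ler_nat /cnt !sumfE leq_sum // => x _.
by have := h (bits x); rewrite !In_bits; case: (In c x) => // ->.
Qed.

Lemma mes_ext c d : clop c =1 clop d -> mes c = mes d.
Proof. by move=> h; apply/eqP; rewrite eq_le !mes_le // => f; rewrite h. Qed.

Lemma mes_ge0 c : 0 <= mes c.
Proof. by rewrite mulr_ge0 ?ler0n // ltW // halfpow_gt0. Qed.

Lemma mes_modular c d : mes (cupc c d) + mes (capc c d) = mes c + mes d.
Proof.
set L := (lv c + lv d)%N.
rewrite -(@cnt_level L c) ?leq_addr // -(@cnt_level L d) ?leq_addl //.
rewrite -(@cnt_level L (cupc c d)) ?lv_mkc // -(@cnt_level L (capc c d)) ?lv_mkc //.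
rewrite -!mulrDl -!natrD /cnt !sumfE -!big_split /=; congr (_%:R * _).
apply: eq_bigr => x _; rewrite !In_mkc !In_level ?leq_addr ?leq_addl //.
by case: (In c x); case: (In d x).
Qed.

Lemma mes_diff c d : mes (capc c d) + mes (diffc c d) = mes c.
Proof.
set L := (lv c + lv d)%N.
rewrite -(@cnt_level L c) ?leq_addr //.
rewrite -(@cnt_level L (diffc c d)) ?lv_mkc // -(@cnt_level L (capc c d)) ?lv_mkc //.
rewrite -!mulrDl -!natrD /cnt !sumfE -!big_split /=; congr (_%:R * _).
apply: eq_bigr => x _; rewrite !In_mkc !In_level ?leq_addr ?leq_addl //.
by case: (In c x); case: (In d x).
Qed.

Lemma mes_full : mes fullc = 1.
Proof.
by rewrite -(@cnt_level 0) ?lv_mkc // halfpow0 mulr1 /cnt sumfE expn0 big_ord1 In_mkc.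
Qed.

Lemma mes_le1 c : mes c <= 1.
Proof. by rewrite -mes_full; apply: mes_le => f _; apply: clop_full. Qed.

Lemma mes_eps k : mes (epsc k) = halfpow k.
Proof.
rewrite -(@cnt_level k) ?lv_mkc // /cnt sumfE -[RHS]mul1r; congr (_ * _).
have h0 : (0 < 2 ^ k)%N by rewrite expn_gt0.
rewrite (bigD1 (Ordinal h0)) //= In_mkc mod0n big1 // => i hi.
rewrite In_mkc modn_small //; case: eqP => // h; case/eqP: hi.
exact: val_inj.
Qed.

Lemma mes_empty : mes 0 = 0.
Proof. by rewrite -(@cnt_level 0) // /cnt sumfE expn0 big_ord1 mul0r. Qed.

Local Open Scope ring_scope.

(** * Open covers and outer measure *)

Definition incr (C : nat -> nat) := forall n f, clop (C n) f -> clop (C n.+1) f.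

(* [Cov A q]: the outer measure of [A] is at most [q], witnessed by an open
   cover; [outer_le A q] allows for an arbitrarily small error. *)
Definition Cov (A : cantor -> Prop) (q : rat) := exists C,
  [/\ incr C, forall n, mes (C n) <= q & forall f, A f -> exists n, clop (C n) f].

Definition outer_le A q := forall e, 0 < e -> Cov A (q + e).

Lemma incr_le C n m f : incr C -> (n <= m)%N -> clop (C n) f -> clop (C m) f.
Proof.
by move=> hC /subnKC <-; elim: (m - n)%N => [|d IH]; rewrite ?addn0 // addnS => /IH /hC.
Qed.

Lemma Cov_sub A B p q : (forall f, A f -> B f) -> p <= q -> Cov B p -> Cov A q.
Proof.
move=> hA hq [C [h1 h2 h3]]; exists C; split=> //.
- by move=> n; apply: le_trans hq.
- by move=> f /hA /h3.
Qed.

Lemma Cov_clop c : Cov (clop c) (mes c).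
Proof. by exists (fun=> c); split=> // f hf; exists 0%N. Qed.

Lemma Cov_neg A q : q < 0 -> ~ Cov A q.
Proof. by move=> hq [C [_ /(_ 0%N) h _]]; have := mes_ge0 (C 0%N); lra. Qed.

Fixpoint cups (C : nat -> nat) n : nat :=
  if n is m.+1 then cupc (cups C m) (C m) else 0%N.

Lemma clop_cups C n f : clop (cups C n) f <-> exists2 i, (i < n)%N & clop (C i) f.
Proof.
elim: n => [|n IH] /=; first by split=> [|[]] //; rewrite clop_empty.
rewrite clop_cup; split.
- by case/orP => [/IH[i hi h]|h]; [exists i => //; apply: ltnW | exists n].
- case=> i; rewrite ltnS leq_eqVlt => /orP[/eqP ->|hi] h; first by rewrite h orbT.
  by apply/orP; left; apply/IH; exists i.
Qed.

Lemma mes_cup_le c d : mes (cupc c d) <= mes c + mes d.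
Proof. by have := mes_modular c d; have := mes_ge0 (capc c d); lra. Qed.

Lemma mes_cups C n : mes (cups C n) <= \sum_(i < n) mes (C i).
Proof.
elim: n => [|n IH] /=; first by rewrite big_ord0 mes_empty.
by rewrite big_ord_recr /=; have := mes_cup_le (cups C n) (C n); lra.
Qed.

Lemma Cov_bigU (A : nat -> cantor -> Prop) q Q : (forall i, Cov (A i) (q i)) ->
  (forall n, \sum_(i < n) q i <= Q) -> Cov (fun f => exists i, A i f) Q.
Proof.
move=> hA hQ.
have [C hC] : exists C : nat -> nat -> nat, forall i,
  [/\ incr (C i), forall n, mes (C i n) <= q i & forall f, A i f -> exists n, clop (C i n) f].
  by apply: (choice (fun i C => [/\ incr C, forall n, mes (C n) <= q i & forall f, A i f -> exists n, clop (C n) f])).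
exists (fun n => cups (fun i => C i n) n); split.
- move=> n f /clop_cups[i hi h]; apply/clop_cups; exists i; first exact: ltnW.
  by case: (hC i) => h' _ _; apply: h'.
- move=> n; apply: le_trans (mes_cups _ _) _; apply: le_trans _ (hQ n).
  by apply: ler_sum => i _; case: (hC i).
- move=> f [i hf]; case: (hC i) => h1 _ /(_ f hf)[n hn].
  exists (maxn n i.+1); apply/clop_cups; exists i; first by rewrite leq_maxr.
  by apply: incr_le hn; rewrite // leq_maxl.
Qed.

Lemma Cov_U A B p q : Cov A p -> Cov B q -> Cov (fun f => A f \/ B f) (p + q).
Proof.
move=> [C [c1 c2 c3]] [D [d1 d2 d3]]; exists (fun n => cupc (C n) (D n)); split.
- by move=> n f; rewrite !clop_cup => /orP[/c1 ->|/d1 ->]; rewrite ?orbT.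
- by move=> n; have := mes_cup_le (C n) (D n); have := c2 n; have := d2 n; lra.
- by move=> f [/c3|/d3] [n hn]; exists n; rewrite clop_cup hn ?orbT.
Qed.

Lemma outer_le_sub A B q : (forall f, A f -> B f) -> outer_le B q -> outer_le A q.
Proof. by move=> h hB e /hB; apply: Cov_sub. Qed.

Lemma Cov_Le A q : Cov A q -> outer_le A q.
Proof. by move=> h e he; apply: Cov_sub h => //; lra. Qed.

(** Stands in for the infimum of all bounds, which need not be rational: lowering a bound by [d]
    must fail eventually, since no measure is negative. *)
Lemma Cov_gap A q d : 0 < d -> Cov A q ->
  exists r, [/\ r <= q, Cov A r & ~ Cov A (r - d)].
Proof.
move=> hd hq; apply: NNPP => hn.
have h n : Cov A (q - n%:R * d).
  elim: n => [|n IH]; first by rewrite mul0r subr0.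
  apply: NNPP => h; apply: hn; exists (q - n%:R * d); split=> //.
    by have : 0 <= n%:R * d by [rewrite mulr_ge0 ?ler0n // ltW]; lra.
  by move=> h'; apply: h; apply: Cov_sub h' => //; rewrite -addn1 natrD; lra.
have := h (Num.truncn (q / d)).+1; apply: Cov_neg.
by have := truncnS_gt (q / d); rewrite ltr_pdivrMr // => h'; lra.
Qed.

(* Outer measure is continuous along increasing sequences of arbitrary sets:
   for covers that are nearly optimal the overlap of consecutive covers is
   nearly as large as the smaller set. *)
Lemma outer_le_incr (X : nat -> cantor -> Prop) q :
  (forall j f, X j f -> X j.+1 f) -> (forall j, outer_le (X j) q) ->
  outer_le (fun f => exists j, X j f) q.
Proof.
(* Half of [e] is the slack of the individual covers, the other half bounds the sum of the gaps
   [d j] lost in passing from one cover to the next. *)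
move=> hX hL e he; pose d j := e / 2 * halfpow j.+1.
have hd j : 0 < d j by rewrite mulr_gt0 ?halfpow_gt0 //; lra.
have [r hr] : exists r : nat -> rat, forall j,
    [/\ r j <= q + e / 2, Cov (X j) (r j) & ~ Cov (X j) (r j - d j)].
  apply: (choice (fun j r => [/\ r <= q + e / 2, Cov (X j) r & ~ Cov (X j) (r - d j)])) => j.
  by apply: Cov_gap => //; apply: hL; lra.
have [C hC] : exists C : nat -> nat -> nat, forall i,
  [/\ incr (C i), forall n, mes (C i n) <= r i & forall f, X i f -> exists n, clop (C i n) f].
  apply: (choice (fun i C => [/\ incr C, forall n, mes (C n) <= r i & forall f, X i f -> exists n, clop (C n) f])) => i.
  by case: (hr i).
pose V j n := cups (fun i => C i n) j.+1.
have hV j : incr (V j).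
  move=> n f /clop_cups[i hi h]; apply/clop_cups; exists i => //.
  by case: (hC i) => h' _ _; apply: h'.
have hm j n : mes (V j n) <= r j + \sum_(i < j) d i.
  elim: j n => [|j IH] n.
    rewrite big_ord0 addr0; case: (hC 0%N) => _ /(_ n) h _; apply: le_trans _ h.
    by apply: mes_le => f /clop_cups[[|i]].
  (* Otherwise these overlaps, which still cover the smaller set [X j], would contradict the near
     optimality of [r j]. *)
  have [n0 hn0] : exists n0, r j - d j < mes (capc (V j n0) (C j.+1 n0)).
    apply: NNPP => hno; case: (hr j) => _ _; apply.
    exists (fun n => capc (V j n) (C j.+1 n)); split.
    - move=> m f; rewrite !clop_cap => /andP[/hV -> h] /=.
      by case: (hC j.+1) => h' _ _; apply: h'.
    - by move=> m; rewrite leNgt; apply/negP => h; apply: hno; exists m.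
    - move=> f hf; case: (hC j.+1) => i1 _ /(_ f (hX _ _ hf))[n1 h1].
      case: (hC j) => i2 _ /(_ f hf)[n2 h2]; exists (maxn n1 n2).
      rewrite clop_cap; apply/andP; split.
        by apply/clop_cups; exists j => //; apply: incr_le h2 => //; apply: leq_maxr.
      by apply: incr_le h1 => //; apply: leq_maxl.
  pose m := maxn n n0.
  have hmn : mes (V j.+1 n) <= mes (V j.+1 m).
    by apply: mes_le => f; apply: incr_le => //; apply: leq_maxl.
  have h0m : mes (capc (V j n0) (C j.+1 n0)) <= mes (capc (V j m) (C j.+1 m)).
    apply: mes_le => f; rewrite !clop_cap => /andP[h1 h2].
    rewrite (incr_le (hV j) _ h1) ?leq_maxr //=.
    by case: (hC j.+1) => h' _ _; apply: incr_le h2 => //; apply: leq_maxr.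
  have := mes_modular (V j m) (C j.+1 m); rewrite -/(V j.+1 m).
  have := IH m; case: (hC j.+1) => _ /(_ m) hc _.
  by rewrite big_ord_recr /=; lra.
exists (fun n => V n n); split.
- move=> n f /clop_cups[i hi h]; apply/clop_cups; exists i; first exact: ltnW.
  by case: (hC i) => h' _ _; apply: h'.
- move=> n; apply: le_trans (hm n n) _; case: (hr n) => hrn _ _.
  by rewrite -mulr_sumr sum_halfpow; have : 0 < e / 2 * halfpow n by [rewrite mulr_gt0 ?halfpow_gt0 //; lra]; lra.
- move=> f [j hf]; case: (hC j) => h1 _ /(_ f hf)[n hn]; exists (maxn j n).
  apply/clop_cups; exists j; first by rewrite ltnS leq_maxl.
  by apply: incr_le hn => //; apply: leq_maxr.
Qed.

Lemma clop_agree c f g : (forall i, (i < lv c)%N -> f i = g i) -> clop c f = clop c g.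
Proof.
by move=> h; rewrite /clop /num; congr In; apply: eq_bigr => i _; rewrite h.
Qed.

(** If no stage is the whole space, finite sequences can be extended forever so that each of their
    cylinders meets the complement of every stage. The limit point lies in some stage, which depends
    on finitely many coordinates only. *)
Lemma compact C : incr C -> (forall f, exists n, clop (C n) f) ->
  exists n, forall f, clop (C n) f.
Proof.
move=> hC hcov; apply: NNPP => hno.
pose bad s := forall n, exists f : cantor, extends f s /\ ~~ clop (C n) f.
have bad0 : bad [::].
  move=> n; apply: NNPP => h; apply: hno; exists n => f.
  by apply/negPn/negP => hf; apply: h; exists f; split.
have badS s : bad s -> exists b, bad (rcons s b).
  move=> hs; apply: NNPP => h.
  have hb b : exists n, forall f : cantor, extends f (rcons s b) -> clop (C n) f.
    apply: NNPP => h'; apply: h; exists b => n; apply: NNPP => h''; apply: h'.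
    exists n => f hf; apply/negPn/negP => hcf; apply: h''; exists f; split=> //.
  case: (hb true) => n1 h1; case: (hb false) => n2 h2.
  case: (hs (maxn n1 n2)) => f [hf /negP]; apply.
  have hext : extends f (rcons s (f (size s))).
    move=> i; rewrite size_rcons nth_rcons ltnS leq_eqVlt => /orP[/eqP ->|hi].
      by rewrite ltnn eqxx.
    by rewrite hi; apply: hf.
  case: (f (size s)) hext => hext.
    by apply: incr_le (h1 _ hext) => //; apply: leq_maxl.
  by apply: incr_le (h2 _ hext) => //; apply: leq_maxr.
pose nb s := epsilon (inhabits true) (fun b => bad (rcons s b)).
pose st n := iter n (fun s => rcons s (nb s)) [::].
have hst n : bad (st n).
  by elim: n => //= n IH; apply: epsilon_spec (badS _ IH).
have szst n : size (st n) = n by elim: n => //= n IH; rewrite size_rcons IH.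
pose f : cantor := fun i => nth false (st i.+1) i.
have hf n i : (i < n)%N -> nth false (st n) i = f i.
  elim: n => // n IH; rewrite ltnS leq_eqVlt => /orP[/eqP ->|hi] //=.
  by rewrite nth_rcons szst hi IH.
case: (hcov f) => n hn; case: (hst (lv (C n)) n) => g [hg /negP]; apply.
rewrite (clop_agree (g := f)) // => i hi.
by rewrite hg ?szst // hf.
Qed.

(** By compactness the two open covers together fill the space from some stage [n0] on, and from
    there modularity of [mes] bounds their overlap. In the argument of Sacks this takes the place of
    additivity of the measure. *)
Lemma Cov_cap A B p q : (forall f, A f \/ B f) -> Cov A p -> Cov B q ->
  Cov (fun f => A f /\ B f) (p + q - 1).
Proof.
move=> hAB [C [c1 c2 c3]] [D [d1 d2 d3]].
have [n0 hn0] : exists n, forall f, clop (cupc (C n) (D n)) f.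
  apply: (compact (C := fun n => cupc (C n) (D n))).
    by move=> n f; rewrite !clop_cup => /orP[/c1 ->|/d1 ->]; rewrite ?orbT.
  by move=> f; case: (hAB f) => [/c3|/d3] [n hn]; exists n; rewrite clop_cup hn ?orbT.
exists (fun n => capc (C (n0 + n)%N) (D (n0 + n)%N)); split.
- by move=> n f; rewrite !addnS !clop_cap => /andP[/c1 -> /d1 ->].
- move=> n; have := mes_modular (C (n0 + n)%N) (D (n0 + n)%N).
  have -> : mes (cupc (C (n0 + n)%N) (D (n0 + n)%N)) = 1.
    rewrite -mes_full; apply: mes_ext => f; rewrite clop_full clop_cup.
    have := hn0 f; rewrite clop_cup => /orP[h|h].
      by rewrite (incr_le c1 _ h) ?leq_addr.
    by rewrite (incr_le d1 _ h) ?leq_addr ?orbT.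
  by have := c2 (n0 + n)%N; have := d2 (n0 + n)%N; lra.
- move=> f [/c3[n1 h1] /d3[n2 h2]]; exists (maxn n1 n2); rewrite clop_cap.
  rewrite (incr_le c1 _ h1) ?(incr_le d1 _ h2) //.
    by rewrite (leq_trans (leq_maxr n1 n2)) // leq_addl.
  by rewrite (leq_trans (leq_maxl n1 n2)) // leq_addl.
Qed.

Local Open Scope ring_scope.

(** * Cylinders and null sets *)

Definition cyl (s : seq bool) :=
  mkc (size s) (fun x => x == num (nth false s) (size s)).

Lemma bits_num f L i : (i < L)%N -> bits (num f L) i = f i.
Proof. by move=> hi; rewrite /bits -(maskofE f hi) /maskof sumfE. Qed.

Lemma clop_cyl s f : clop (cyl s) f <-> extends f s.
Proof.
rewrite clop_mkc; split=> [/eqP h i hi|h].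
  by rewrite -(bits_num f hi) h bits_num.
by apply/eqP; apply: eq_bigr => i _; rewrite h.
Qed.

Lemma mes_cyl s : mes (cyl s) = halfpow (size s).
Proof.
rewrite -(@cnt_level (size s)) ?lv_mkc // /cnt sumfE -[RHS]mul1r; congr (_ * _).
rewrite (bigD1 (Ordinal (num_lt (nth false s) (size s)))) //=.
rewrite In_mkc modn_small ?num_lt // eqxx big1 // => i hi.
rewrite In_mkc modn_small //; case: eqP => // h; case/eqP: hi.
exact: val_inj.
Qed.

Lemma extends_mkseq (f : cantor) n : extends f (mkseq f n).
Proof. by move=> i; rewrite size_mkseq => hi; rewrite nth_mkseq. Qed.

Lemma extendsE (f : cantor) s : extends f s -> s = mkseq f (size s).
Proof.
move=> h; apply: (@eq_from_nth _ false); rewrite ?size_mkseq // => i hi.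
by rewrite nth_mkseq // h.
Qed.

(* The maximal cylinders inside an open set are disjoint and cover it; indices
   not coding a maximal cylinder are filled up with tiny ones. *)
Lemma m_null_Cov A : (forall e, 0 < e -> Cov A e) -> m_null A.
Proof.
(* Half of [e] goes to the cylinders of the cover, half to the fillers, whose measures
   [halfpow (c + k.+1)] sum to less than [halfpow c]. *)
move=> hA e he; have [c hc] := @halfpow_small (e / 2) (ltac:(lra)).
have [C [h1 h2 h3]] : Cov A (e / 2) by apply: hA; lra.
pose sub s := exists n, forall f : cantor, extends f s -> clop (C n) f.
pose Max s := sub s /\ forall i, (i < size s)%N -> ~ sub (take i s).
(* The condition [pickle s = k] gives each cylinder a single index, so that no measure is counted
   twice. *)
pose good (k : nat) s := [/\ (unpickle k : option (seq bool)) = Some s, pickle s = k & Max s].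
have [s hs] : exists s : nat -> seq bool, forall k,
    good k (s k) \/ (~ (exists t, good k t) /\ s k = nseq (c + k.+1) false).
  apply: (choice (fun k t => good k t \/ (~ (exists t, good k t) /\ t = nseq (c + k.+1) false))) => k.
  case: (classic (exists t, good k t)) => [[t ht]|hn]; first by exists t; left.
  by exists (nseq (c + k.+1) false); right.
exists s; split=> [f hf|N].
  have [n hn] := h3 f hf.
  have hex : exists i, if excluded_middle_informative (sub (mkseq f i)) then true else false.
    exists (lv (C n)); case: excluded_middle_informative => // -[]; exists n => g hg.
    by rewrite -(clop_agree (f := f)) // => i hi; rewrite hg ?size_mkseq // nth_mkseq.
  case: (ex_minnP hex) => i; case: excluded_middle_informative => // hi _ hmin.
  have hM : Max (mkseq f i).
    split=> // j; rewrite size_mkseq => hj hsub.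
    have := hmin j; case: excluded_middle_informative => [_|] /=.
      by move=> /(_ isT); rewrite leqNgt hj.
    case; have -> : mkseq f j = take j (mkseq f i) => //.
    by rewrite /mkseq -map_take take_iota (minn_idPl (ltnW hj)).
  exists (pickle (mkseq f i)); case: (hs (pickle (mkseq f i))) => [[]|[[]]].
    by rewrite pickleK => -[<-] _ _; apply: extends_mkseq.
  by exists (mkseq f i); split=> //; rewrite pickleK.
pose D k := if excluded_middle_informative (good k (s k)) then cyl (s k) else 0%N.
have hDg k f : clop (D k) f -> good k (s k) /\ extends f (s k).
  rewrite /D; case: excluded_middle_informative => [hg|hb] /=; rewrite ?clop_empty //.
  by move/clop_cyl.
have hcup n : mes (cups D n) = \sum_(k < n) mes (D k).
  elim: n => [|n IH]; first by rewrite big_ord0 /= mes_empty.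
  rewrite big_ord_recr /= -IH -mes_modular -[LHS]addr0; congr (_ + _).
  rewrite -mes_empty; apply: mes_ext => f; rewrite clop_empty clop_cap.
  symmetry; apply/negP => /andP[/clop_cups[k hk hDk] hDn].
  have [[_ pk [sk mk]] /extendsE ek] := hDg _ _ hDk.
  have [[_ pn [sn mn]] /extendsE en] := hDg _ _ hDn.
  have ht i j : (i <= j)%N -> take i (mkseq f j) = mkseq f i.
    by move=> hij; rewrite /mkseq -map_take take_iota (minn_idPl hij).
  case: (ltngtP (size (s k)) (size (s n))) => hsz.
  - by apply: (mn _ hsz); rewrite en ht ?(ltnW hsz) // -ek.
  - by apply: (mk _ hsz); rewrite ek ht ?(ltnW hsz) // -en.
  - by move: hk; rewrite -pk -pn ek en hsz ltnn.
have hle n : exists m, forall f, clop (cups D n) f -> clop (C m) f.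
  elim: n => [|n [m hm]]; first by exists 0%N => f; rewrite clop_empty.
  have [l hl] : exists l, forall f, clop (D n) f -> clop (C l) f.
    case: (classic (good n (s n))) => [[_ _ [[l hl] _]]|hb].
      by exists l => f /hDg[_ /hl].
    by exists 0%N => f /hDg[].
  exists (maxn m l) => f /=; rewrite clop_cup => /orP[/hm|/hl].
    by apply: incr_le => //; apply: leq_maxl.
  by apply: incr_le => //; apply: leq_maxr.
have hD : \sum_(k < N) mes (D k) <= e / 2.
  rewrite -hcup; have [m hm] := hle N; exact: le_trans (mes_le hm) (h2 m).
have hsum : \sum_(k < N) cyl_measure (s k) <= \sum_(k < N) (mes (D k) + halfpow c * halfpow k.+1).
  apply: ler_sum => k _; have -> : cyl_measure (s k) = halfpow (size (s k)) by [].
  rewrite /D; case: excluded_middle_informative => hg /=.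
    by rewrite mes_cyl lerDl mulr_ge0 // ltW // halfpow_gt0.
  case: (hs k) => // -[_ ->]; rewrite size_nseq halfpowD lerDr; exact: mes_ge0.
apply: le_trans hsum _; rewrite big_split /= -mulr_sumr sum_halfpow.
have : 0 <= halfpow c * halfpow N by rewrite mulr_ge0 // ltW // halfpow_gt0.
by lra.
Qed.

End CantorMeasure.

(** * Measure approximation of the Suslin operation *)

Section SuslinApproximation.
Import Order.TTheory GRing.Theory Num.Theory.

Definition Sus (X : nat -> cantor -> Prop) f := exists h, forall n, X (bar h n) f.

Definition takec i s :=
  mkseqc (if i <= sizec s then i else sizec s) (fun j => nthc s j).
Definition below s t := (sizec s == sizec t) && allb (fun i => nthc s i <= nthc t i).

(* The union over all [s] bounded by [t] of the intersections of the members of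
   the family along [s]. *)
Definition Kin (C : nat -> nat) t x := exb (fun s => below s t &&
  allb (fun i => ~~ (i <= sizec s) || In (C (takec i s)) x)).
(** All initial segments of sequences bounded by [t] have codes at most [t] ([below_le]), so at this
    level every clopen set that enters [Kin] is determined. *)
Definition Klv (C : nat -> nat) t := sumf t.+1 (fun p => lv (C p)).
Definition Kc C t := mkc (Klv C t) (Kin C t).

Lemma takecE i s : takec i s = code (take i (decode s)).
Proof.
rewrite /takec mkseqcE; congr code; apply: (@eq_from_nth _ 0).
  by rewrite size_mkseq size_take_min; rewrite /sizec; case: leqP; lia.
move=> j; rewrite size_mkseq => hj; rewrite nth_mkseq // /nthc nth_take //.
by move: hj; case: (leqP i (sizec s)); lia.
Qed.

Lemma code_le l m : size l = size m -> (forall i, nth 0 l i <= nth 0 m i) -> code l <= code m.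
Proof.
elim: l m => [|x l IH] [|y m] //= [hs] h.
apply: leq_mul; first by rewrite leq_exp2l //; apply: (h 0).
by rewrite ltnS leq_double; apply: IH => // i; apply: (h i.+1).
Qed.

Lemma code_take i l : code (take i l) <= code l.
Proof.
elim: l i => [|x l IH] [|i] //=.
by apply: leq_mul => //; rewrite ltnS leq_double.
Qed.

Lemma below_le s t i : below s t -> takec i s <= t.
Proof.
move=> /andP[/eqP hs /allbP h]; rewrite takecE.
apply: leq_trans (code_take _ _) _; rewrite -[X in _ <= X](CodeSeq.decodeK t).
by apply: code_le => // j; apply: h.
Qed.

Lemma lv_Klv C t p : p <= t -> lv (C p) <= Klv C t.
Proof.
by rewrite -ltnS => hp; rewrite /Klv sumfE (bigD1 (Ordinal hp)) //= leq_addr.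
Qed.

Lemma nth_bar h n i : nthc (bar h n) i = if i < n then h i else 0.
Proof.
rewrite /nthc /bar CodeSeq.codeK; case: ltnP => hi; first by rewrite nth_mkseq.
by rewrite nth_default ?size_mkseq.
Qed.

Lemma size_bar h n : sizec (bar h n) = n.
Proof. by rewrite /sizec /bar CodeSeq.codeK size_mkseq. Qed.

Lemma take_bar h n i : i <= n -> takec i (bar h n) = bar h i.
Proof.
move=> hi; rewrite takecE /bar CodeSeq.codeK; congr code.
by rewrite /mkseq -map_take take_iota (minn_idPl hi).
Qed.

Lemma bar_nthc s : bar (nthc s) (sizec s) = s.
Proof. by rewrite -[RHS]CodeSeq.decodeK /bar; congr code; exact: mkseq_nth. Qed.

Lemma KcP C h n f : clop (Kc C (bar h n)) f <->
  exists g, (forall i, i < n -> g i <= h i) /\ (forall i, i <= n -> clop (C (bar g i)) f).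
Proof.
rewrite /Kc clop_mkc; split.
- case/exbP => s /andP[hb /allbP hs]; have /andP[/eqP hz /allbP hle] := hb.
  rewrite size_bar in hz; exists (nthc s); split=> i hi.
    by have := hle i; rewrite nth_bar hi.
  have := hs i; rewrite hz hi /= In_num; last by apply: lv_Klv; apply: below_le.
  by rewrite -{1}(bar_nthc s) hz take_bar.
- case=> g [hg hC]; apply/exbP; exists (bar g n).
  have hb : below (bar g n) (bar h n).
    rewrite /below !size_bar eqxx; apply/allbP => i; rewrite !nth_bar.
    by case: ltnP => // /hg.
  rewrite hb; apply/allbP => i; rewrite size_bar; case: leqP => //= hi.
  rewrite In_num; last by apply: lv_Klv; apply: below_le.
  by rewrite take_bar //; apply: hC.
Qed.

Lemma Kc_anti C h n m f : n <= m -> clop (Kc C (bar h m)) f -> clop (Kc C (bar h n)) f.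
Proof.
move=> hnm /KcP[g [h1 h2]]; apply/KcP; exists g; split=> i hi.
  by apply: h1; apply: leq_trans hnm.
by apply: h2; apply: leq_trans hnm.
Qed.

Lemma Kc_mono C h h' n f : (forall i, h i <= h' i) ->
  clop (Kc C (bar h n)) f -> clop (Kc C (bar h' n)) f.
Proof.
move=> hh /KcP[g [h1 h2]]; apply/KcP; exists g; split=> i hi; last exact: h2.
by apply: leq_trans (hh i); apply: h1.
Qed.

Lemma Kc_cap C B h n f : clop (Kc (fun s => capc (C s) B) (bar h n)) f =
  clop (Kc C (bar h n)) f && clop B f.
Proof.
apply/idP/andP => [/KcP[g [h1 h2]]|[/KcP[g [h1 h2]] hB]].
- split; last by have := h2 0 isT; rewrite clop_cap => /andP[].
  by apply/KcP; exists g; split=> // i /h2; rewrite clop_cap => /andP[].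
- by apply/KcP; exists g; split=> // i /h2; rewrite clop_cap hB => ->.
Qed.

Lemma Kc_diff C B h n f : clop (Kc (fun s => diffc (C s) B) (bar h n)) f =
  clop (Kc C (bar h n)) f && ~~ clop B f.
Proof.
apply/idP/andP => [/KcP[g [h1 h2]]|[/KcP[g [h1 h2]] hB]].
- split; last by have := h2 0 isT; rewrite clop_diff => /andP[].
  by apply/KcP; exists g; split=> // i /h2; rewrite clop_diff => /andP[].
- by apply/KcP; exists g; split=> // i /h2; rewrite clop_diff hB => ->.
Qed.

Lemma bar_ext g h n : (forall i, i < n -> g i = h i) -> bar g n = bar h n.
Proof.
by move=> e; rewrite /bar /mkseq; congr code; apply/eq_in_map => i; rewrite mem_iota => /e.
Qed.

(** The tree of sequences bounded by [h] is finitely branching. Thus the compact set approximated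
    along [h] lies inside the result of the Suslin operation. *)
Lemma konig C h f : (forall n, clop (Kc C (bar h n)) f) ->
  exists g, forall n, clop (C (bar g n)) f.
Proof.
move=> hK; pose ok s := forall n, exists g, [/\ forall i, i < size s -> g i = nth 0 s i,
  forall i, i < n -> g i <= h i & forall i, i <= n -> clop (C (bar g i)) f].
have ok0 : ok [::] by move=> n; have /KcP[g [h1 h2]] := hK n; exists g.
have okS s : ok s -> exists j, ok (rcons s j).
  move=> hs; apply: NNPP => hno.
  have [N hN] : exists N : nat -> nat, forall j, ~ exists g,
     [/\ forall i, i < size (rcons s j) -> g i = nth 0 (rcons s j) i,
         forall i, i < N j -> g i <= h i & forall i, i <= N j -> clop (C (bar g i)) f].
    apply: (choice (fun j n => ~ exists g,
     [/\ forall i, i < size (rcons s j) -> g i = nth 0 (rcons s j) i,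
         forall i, i < n -> g i <= h i & forall i, i <= n -> clop (C (bar g i)) f])) => j.
    by apply: not_all_ex_not => hj; apply: hno; exists j.
  (* [M] is at least every [N j] with [j <= h (size s)], and large enough that a sequence good up to
     [M] must take one of these [j] as its next value. *)
  pose M := (size s).+1 + \sum_(j < (h (size s)).+1) N j.
  have [g [h1 h2 h3]] := hs M.
  have hgj : g (size s) < (h (size s)).+1 by rewrite ltnS; apply: h2; rewrite /M leq_addr.
  apply: (hN (g (size s))); exists g.
  have hM : N (g (size s)) <= M.
    by rewrite /M (bigD1 (Ordinal hgj)) //= addnCA leq_addr.
  split=> i hi.
  - move: hi; rewrite size_rcons nth_rcons ltnS leq_eqVlt => /orP[/eqP ->|hi].
      by rewrite ltnn eqxx.
    by rewrite hi h1.
  - by apply: h2; apply: leq_trans hM.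
  - by apply: h3; apply: leq_trans hM.
pose nb s := epsilon (inhabits 0) (fun j => ok (rcons s j)).
pose st n := iter n (fun s => rcons s (nb s)) [::].
have hst n : ok (st n).
  by elim: n => //= n IH; apply: epsilon_spec (okS _ IH).
have szst n : size (st n) = n by elim: n => //= n IH; rewrite size_rcons IH.
pose g i := nth 0 (st i.+1) i.
have hg n i : i < n -> nth 0 (st n) i = g i.
  elim: n => // n IH; rewrite ltnS leq_eqVlt => /orP[/eqP ->|hi] //=.
  by rewrite nth_rcons szst hi IH.
exists g => n; have [g' [h1 _ h3]] := hst n n.
rewrite -(@bar_ext g' g n) ?h3 // => i hi.
by rewrite h1 ?szst // hg.
Qed.

Local Open Scope ring_scope.

(** The decidable substitute for a lower bound on the measure of the Suslin result: the decreasing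
    clopen sets along [h] approximate a compact subset of it, and the quantifier over [h] is itself
    a Suslin operation. *)
Definition big (C : nat -> nat) q := exists h, forall n, q < mes (Kc C (bar h n)).

(** Capacitability. The entries of the paths are bounded one after the other; by continuity of outer
    measure along increasing sequences, each bound can be taken so large that the paths obeying it
    still produce a set of outer measure above [q]. *)
Lemma big_Sus C q : ~ outer_le (Sus (fun s => clop (C s))) q -> big C q.
Proof.
move=> hq; pose A t (f : cantor) := exists g : nat -> nat,
  (forall i, (i < size t)%N -> (g i <= nth 0%N t i)%N) /\ forall n, clop (C (bar g n)) f.
have A0 : ~ outer_le (A [::]) q.
  by move=> h; apply: hq; apply: outer_le_sub h => f [g hg]; exists g.
have AS t : ~ outer_le (A t) q -> exists j, ~ outer_le (A (rcons t j)) q.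
  move=> ht; apply: not_all_ex_not => h; apply: ht.
  apply: outer_le_sub (@outer_le_incr (fun j => A (rcons t j)) q _ h) => [f [g [h1 h2]]|j f [g [h1 h2]]].
    exists (g (size t)), g; split=> // i; rewrite size_rcons nth_rcons ltnS leq_eqVlt.
    by case/orP => [/eqP ->|hi]; [rewrite ltnn eqxx | rewrite hi h1].
  exists g; split=> // i; rewrite size_rcons => hi.
  have := h1 i; rewrite size_rcons => /(_ hi); rewrite !nth_rcons.
  by case: ifP => // _; case: ifP => // _ /leqW.
pose nb s := epsilon (inhabits 0%N) (fun j => ~ outer_le (A (rcons s j)) q).
pose st n := iter n (fun s => rcons s (nb s)) [::].
have hst n : ~ outer_le (A (st n)) q.
  by elim: n => //= n IH; apply: epsilon_spec (AS _ IH).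
have szst n : size (st n) = n by elim: n => //= n IH; rewrite size_rcons IH.
pose g i := nth 0%N (st i.+1) i.
have hg n i : (i < n)%N -> nth 0%N (st n) i = g i.
  elim: n => // n IH; rewrite ltnS leq_eqVlt => /orP[/eqP ->|hi] //=.
  by rewrite nth_rcons szst hi IH.
exists g => n; rewrite ltNge; apply/negP => hle; apply: (hst n).
apply: Cov_Le; apply: Cov_sub hle (Cov_clop _) => f [g' [h1 h2]].
apply/KcP; exists g'; split=> // i hi.
by rewrite -(hg n) // h1 ?szst.
Qed.

(** Bounds occur as differences of two measures; with three arguments the comparison stays within
    natural numbers, as counts at a common level. *)
Definition mesgt c d e := (cnt (lv c + lv d + lv e) e < cnt (lv c + lv d + lv e) c + cnt (lv c + lv d + lv e) d)%N.

Lemma mesgtE c d e : mesgt c d e = (mes e < mes c + mes d).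
Proof.
rewrite /mesgt; set L := (_ + lv e)%N.
rewrite -(@cnt_level L c) -?(@cnt_level L d) -?(@cnt_level L e); try by rewrite /L; lia.
by rewrite -mulrDl ltr_pM2r ?halfpow_gt0 // -natrD ltr_nat.
Qed.

Definition bigb C B1 B2 := susb (fun t => mesgt (Kc C t) B2 B1).

Lemma bigbP C B1 B2 : bigb C B1 B2 <-> big C (mes B1 - mes B2).
Proof.
by split=> [/susbP[h hh]|[h hh]]; [|apply/susbP]; exists h => n; have := hh n;
  rewrite mesgtE; lra.
Qed.

(** [B] approximates the Suslin result from both sides: outside [B] the result is not large, and
    within [B] it is larger than [mes B - halfpow k]. Both conditions are decided by [S], so a good
    [B] is found by search. *)
Definition good C k B :=
  ~~ bigb (fun s => diffc (C s) B) (epsc k) 0 && bigb (fun s => capc (C s) B) B (epsc k).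
Definition susc C k := mu (fun B => good C k B).

Lemma big_le C p q : p <= q -> big C q -> big C p.
Proof. by move=> hp [h hh]; exists h => n; apply: le_lt_trans hp (hh n). Qed.

Lemma stable_value (u : nat -> rat) d : 0 < d -> (forall n, 0 <= u n) ->
  exists n, forall m, (n <= m)%N -> u n - d < u m.
Proof.
move=> hd hu; apply: NNPP => hno.
have hdrop n : exists m, u m <= u n - d.
  apply: NNPP => h; apply: hno; exists n => m _; rewrite ltNge; apply/negP => h'.
  by apply: h; exists m.
have H j : exists m, u m <= u 0%N - j%:R * d.
  elim: j => [|j [m hm]]; first by exists 0%N; rewrite mul0r subr0.
  by have [m' hm'] := hdrop m; exists m'; rewrite -addn1 natrD; lra.
have [m hm] := H (Num.truncn (u 0%N / d)).+1; have := hu m.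
by have := truncnS_gt (u 0%N / d); rewrite ltr_pdivrMr // => h'; lra.
Qed.

Lemma big_gap C d : 0 < d -> exists2 q, big C q & ~ big C (q + d).
Proof.
move=> hd; apply: NNPP => hno.
(* The value [-1] is a bound strictly below every measure, so the ascent can start there; it has to
   stop because no measure exceeds [1]. *)
have H j : big C (-1 + j%:R * d).
  elim: j => [|j IH].
    by exists (fun=> 0%N) => n; have := mes_ge0 (Kc C (bar (fun=> 0%N) n)); lra.
  apply: NNPP => h; apply: hno; exists (-1 + j%:R * d) => // h'.
  by apply: h; apply: big_le h'; rewrite -addn1 natrD; lra.
have [h hh] := H (Num.truncn (2%:R / d)).+1.
have := hh 0%N; have := mes_le1 (Kc C (bar h 0)).
by have := truncnS_gt (2%:R / d); rewrite ltr_pdivrMr // => h'; lra.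
Qed.

Lemma good_ex C k : exists B, good C k B.
Proof.
have hd := halfpow_gt0 k.
(* [h] is optimal up to [halfpow k], and from [n0] on the measures along [h] drop by less than
   [halfpow k]. *)
have [q [h hh] hq] := big_gap C hd.
have [n0 hn0] := stable_value hd (fun n => mes_ge0 (Kc C (bar h n))).
pose B := Kc C (bar h n0); exists B.
have hcap n : mes (capc (Kc C (bar h n)) B) = mes (Kc C (bar h (maxn n n0))).
  apply: mes_ext => f; rewrite clop_cap; apply/andP/idP => [[]|hf].
    by case: (leqP n n0).
  by split; apply: Kc_anti hf; rewrite ?leq_maxl ?leq_maxr.
apply/andP; split.
- apply/negP => /bigbP; rewrite mes_eps mes_empty subr0 => -[g hg]; apply: hq.
  (* The maximum keeps the mass above [q] that [h] provides inside [B] and the mass above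
     [halfpow k] that [g] provides outside [B], which contradicts the choice of [q]. *)
  exists (fun i => maxn (g i) (h i)) => n.
  set h' := fun i => _.
  have e1 : mes (diffc (Kc C (bar g n)) B) = mes (Kc (fun s => diffc (C s) B) (bar g n)).
    by apply: mes_ext => f; rewrite clop_diff Kc_diff.
  have := hg n; rewrite -e1 => hgn.
  have := mes_diff (Kc C (bar h' n)) B.
  have l1 : mes (diffc (Kc C (bar g n)) B) <= mes (diffc (Kc C (bar h' n)) B).
    apply: mes_le => f; rewrite !clop_diff => /andP[hf ->]; rewrite andbT.
    by apply: Kc_mono hf => i; rewrite leq_maxl.
  have l2 : mes (capc (Kc C (bar h n)) B) <= mes (capc (Kc C (bar h' n)) B).
    apply: mes_le => f; rewrite !clop_cap => /andP[hf ->]; rewrite andbT.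
    by apply: Kc_mono hf => i; rewrite leq_maxr.
  by have := hcap n; have := hh (maxn n n0); lra.
- apply/bigbP; rewrite mes_eps; exists h => n.
  have -> : mes (Kc (fun s => capc (C s) B) (bar h n)) = mes (capc (Kc C (bar h n)) B).
    by apply: mes_ext => f; rewrite clop_cap Kc_cap.
  by rewrite hcap; have := hn0 (maxn n n0); rewrite leq_maxr => /(_ isT).
Qed.

Definition differ (X : cantor -> Prop) c f := ~ (X f <-> clop c f).

(** Outside [B] the result has outer measure at most [halfpow k] by [big_Sus], and a second
    [halfpow k] pays for an actual cover. The third covers the part of [B] missed by the compact set
    along [h], which lies in the result by [konig]. *)
Lemma good_Cov C k B : good C k B ->
  Cov (differ (Sus (fun s => clop (C s))) B) (halfpow k + halfpow k + halfpow k).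
Proof.
move=> /andP[/negP h1 /bigbP[h h2]]; have hd := halfpow_gt0 k.
have c1 : Cov (fun f => Sus (fun s => clop (C s)) f /\ ~~ clop B f) (halfpow k + halfpow k).
  have hL : outer_le (Sus (fun s => clop (diffc (C s) B))) (halfpow k).
    apply: NNPP => /big_Sus hb; apply: h1; apply/bigbP.
    by rewrite mes_eps mes_empty subr0.
  apply: Cov_sub (hL _ hd) => // f [[g hg] hB]; exists g => n.
  by rewrite clop_diff hg.
have c2 : Cov (fun f => clop B f /\ ~ Sus (fun s => clop (C s)) f) (halfpow k).
  exists (fun n => diffc B (Kc C (bar h n))); split.
  - move=> n f; rewrite !clop_diff => /andP[-> /negP hf] /=.
    by apply/negP => hf'; apply: hf; apply: Kc_anti hf'.
  - move=> n; have := mes_diff B (Kc C (bar h n)).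
    have -> : mes (capc B (Kc C (bar h n))) = mes (Kc (fun s => capc (C s) B) (bar h n)).
      by apply: mes_ext => f; rewrite clop_cap Kc_cap andbC.
    by have := h2 n; rewrite mes_eps; lra.
  - move=> f [hB hS]; apply: NNPP => hno; apply: hS; apply: (@konig _ h) => n.
    by apply/negPn/negP => hf; apply: hno; exists n; rewrite clop_diff hB hf.
apply: Cov_sub (Cov_U c1 c2) => // f hf.
case hB : (clop B f); last first.
  left; split=> //; apply: NNPP => hS; apply: hf; rewrite hB; split=> //.
by right; split=> // hS; apply: hf; rewrite hB.
Qed.

Definition approximates (nu : nat -> nat) (X : cantor -> Prop) := forall k, Cov (differ X (nu k)) (halfpow k).

(** The errors [halfpow (k.+2 + s.+1)] of the members sum to less than [halfpow k.+2]; with the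
    three errors from [good_Cov] the total is at most [halfpow k]. *)
Definition susn (A : nat -> nat -> nat) k := susc (fun s => A s (k.+2 + s.+1)%N) k.+2.

Lemma susn_approx A X : (forall s, approximates (A s) (X s)) -> approximates (susn A) (Sus X).
Proof.
move=> hA k; pose C s := A s (k.+2 + s.+1)%N.
have c1 := good_Cov (muP (good_ex C k.+2)).
have c2 : Cov (fun f => exists s, differ (X s) (C s) f) (halfpow k.+2).
  apply: (Cov_bigU (q := fun s => halfpow (k.+2 + s.+1))) => [s|n]; first exact: hA.
  rewrite (eq_bigr (fun s : 'I_n => halfpow k.+2 * halfpow s.+1)) => [|s _]; last by rewrite halfpowD.
  rewrite -mulr_sumr sum_halfpow mulrBr mulr1.
  by have := mulr_gt0 (halfpow_gt0 k.+2) (halfpow_gt0 n); lra.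
have hee : halfpow k.+2 + halfpow k.+2 + halfpow k.+2 + halfpow k.+2 <= halfpow k.
  by rewrite (halfpowS k) (halfpowS k.+1); lra.
apply: Cov_sub hee (Cov_U c1 c2) => f hf.
case: (classic (exists s, differ (X s) (C s) f)) => h; [by right|left => h'].
have e s : X s f <-> clop (C s) f by apply: NNPP => hs; apply: h; exists s.
apply: hf; split; first by case=> g hg; apply/h'; exists g => n; apply/e.
by move/h' => [g hg]; exists g => n; apply/e.
Qed.

Lemma approx_clop c (X : cantor -> Prop) : (forall f, X f <-> clop c f) -> approximates (fun=> c) X.
Proof.
move=> h k; apply: (@Cov_sub _ (fun f => clop 0%N f) _ _ _ (ltW (halfpow_gt0 k))).
  by move=> f []; apply: h.
by rewrite -mes_empty; apply: Cov_clop.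
Qed.

Lemma approx_ext nu (X Y : cantor -> Prop) : (forall f, X f <-> Y f) -> approximates nu X -> approximates nu Y.
Proof. by move=> h hX k; apply: Cov_sub (hX k) => // f hf hf'; apply: hf; rewrite -h. Qed.

Lemma approx_cap nu mu' (X Y : cantor -> Prop) : approximates nu X -> approximates mu' Y ->
  approximates (fun k => capc (nu k.+1) (mu' k.+1)) (fun f => X f /\ Y f).
Proof.
move=> hX hY k; rewrite halfpowS; apply: Cov_sub (Cov_U (hX k.+1) (hY k.+1)) => // f hf.
case: (classic (differ X (nu k.+1) f)) => h1; [by left|].
case: (classic (differ Y (mu' k.+1) f)) => h2; [by right|].
case: hf; rewrite clop_cap; move/NNPP: h1 => h1; move/NNPP: h2 => h2.
by rewrite h1 h2; split=> [[-> ->]|/andP[]].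
Qed.

Lemma approx_diff nu mu' (X Y : cantor -> Prop) : approximates nu X -> approximates mu' Y ->
  approximates (fun k => diffc (nu k.+1) (mu' k.+1)) (fun f => X f /\ ~ Y f).
Proof.
move=> hX hY k; rewrite halfpowS; apply: Cov_sub (Cov_U (hX k.+1) (hY k.+1)) => // f hf.
case: (classic (differ X (nu k.+1) f)) => h1; [by left|].
case: (classic (differ Y (mu' k.+1) f)) => h2; [by right|].
case: hf; rewrite clop_diff; move/NNPP: h1 => h1; move/NNPP: h2 => h2.
by rewrite h1 h2; split=> [[-> /negP ->]|/andP[-> /negP]].
Qed.

End SuslinApproximation.

(** * Random stages along computable well-orderings *)

Lemma pc_In k P F G : pc k P F -> pc k P G -> pc k P (fun r => In (F r) (G r)).
Proof. by apply: (pc_app2 (f := fun c x => In c x : nat)); rewrite /In; pca. Qed.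

Lemma pc_mkc k P F (p : nat -> env -> bool) :
  pc k P F -> pc k.+1 (fun r => P (fun i => r i.+1)) (fun r => p (r 0) (fun i => r i.+1)) ->
  pc k P (fun r => mkc (F r) (fun x => p x r)).
Proof. by move=> h1 h2; rewrite /mkc /maskof; pca. Qed.

Lemma pc_capc k P F G : pc k P F -> pc k P G -> pc k P (fun r => capc (F r) (G r)).
Proof.
apply: (pc_app2 (f := capc)); rewrite /capc.
by apply: (pc_mkc (p := fun x r => In (r 0) x && In (r 1) x)); pca; apply: pc_In; pca.
Qed.

Lemma pc_diffc k P F G : pc k P F -> pc k P G -> pc k P (fun r => diffc (F r) (G r)).
Proof.
apply: (pc_app2 (f := diffc)); rewrite /diffc.
by apply: (pc_mkc (p := fun x r => In (r 0) x && ~~ In (r 1) x)); pca; apply: pc_In; pca.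
Qed.

Lemma pc_epsc k P F : pc k P F -> pc k P (fun r => epsc (F r)).
Proof. by move=> h; rewrite /epsc; apply: (pc_mkc (p := fun x r => x == 0)) => //; pca. Qed.

Lemma pc_takec k P F G : pc k P F -> pc k P G -> pc k P (fun r => takec (F r) (G r)).
Proof. by apply: (pc_app2 (f := takec)); rewrite /takec; pca. Qed.

Lemma pc_below k P F G : pc k P F -> pc k P G -> pc k P (fun r => below (F r) (G r)).
Proof. by apply: (pc_app2 (f := fun s t => below s t : nat)); rewrite /below; pca. Qed.

Lemma pc_mesgt k P F G H : pc k P F -> pc k P G -> pc k P H ->
  pc k P (fun r => mesgt (F r) (G r) (H r)).
Proof.
apply: (pc_app3 (f := fun c d e => mesgt c d e : nat)); rewrite /mesgt /cnt.
by pca; apply: pc_In; pca.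
Qed.

Lemma pc_let k (P : env -> Prop) (f : nat -> env -> nat) G :
  pc k.+1 (fun r => P (fun i => r i.+1)) (fun r => f (r 0) (fun i => r i.+1)) ->
  pc k P G -> pc k P (fun r => f (G r) r).
Proof. exact: (@pc_deep 0). Qed.

Lemma pc_Kc k P (C : nat -> env -> nat) T :
  pc k.+1 (fun r => P (fun i => r i.+1)) (fun r => C (r 0) (fun i => r i.+1)) ->
  pc k P T -> pc k P (fun r => Kc (fun s => C s r) (T r)).
Proof.
move=> hC; apply: (pc_let (f := fun t r => Kc (fun s => C s r) t)).
have hl : pc k.+1 (fun r => P (fun i => r i.+1)) (fun r => Klv (fun s => C s (fun i => r i.+1)) (r 0)).
  rewrite /Klv; pca.
  by apply: (@pc_deepw 2 C _ _ _ (fun r => r 0) _ hC) => //; pca.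
rewrite /Kc; apply: (pc_mkc (p := fun x r => Kin (fun s => C s (fun i => r i.+1)) (r 0) x)) => //.
rewrite /Kin; pca; first by apply: pc_below; pca.
apply: pc_In; last by pca.
apply: (@pc_deepw 4 C _ _ _ (fun r => takec (r 0) (r 1)) _ hC) => [r [[]]|] //.
by apply: pc_takec; pca.
Qed.

Lemma pc_susc k P (C : nat -> env -> nat) K :
  pc k.+1 (fun r => P (fun i => r i.+1)) (fun r => C (r 0) (fun i => r i.+1)) ->
  pc k P K -> pc k P (fun r => susc (fun s => C s r) (K r)).
Proof.
move=> hC; apply: (pc_let (f := fun j r => susc (fun s => C s r) j)).
rewrite /susc; pca; last by move=> r _; apply: good_ex.
rewrite /good /bigb; pca; cbv beta.
- apply: pc_mesgt; [|pca|by apply: pc_epsc; pca].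
  apply: (pc_Kc (C := fun s r => diffc (C s (fun i => r i.+3)) (r 1))); last by pca.
  apply: pc_diffc; last by pca.
  by apply: (@pc_deepw 4 C _ _ _ (fun r => r 0) _ hC) => //; pca.
- apply: pc_mesgt; [|by apply: pc_epsc; pca|pca].
  apply: (pc_Kc (C := fun s r => capc (C s (fun i => r i.+3)) (r 1))); last by pca.
  apply: pc_capc; last by pca.
  by apply: (@pc_deepw 4 C _ _ _ (fun r => r 0) _ hC) => [r []|] //; pca.
Qed.

(* [Run] on the type-1 argument [o] in which every premise is completed at a
   stage [lt]-below that of the conclusion. *)
Inductive Stage (lt : nat -> nat -> bool) (o : nat -> nat) : nat -> nat -> nat -> Prop :=
| Stage_leaf v x : kind x = 0 -> Stage lt o v x (leaf_value x)
| Stage_oracle v x : kind x = 1 -> Stage lt o v x (o (leaf_value x))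
| Stage_bind v u u' x y z : kind x = 2 -> lt u v -> lt u' v ->
    Stage lt o u (subconf x 0) y -> Stage lt o u' (nextconf x y) z -> Stage lt o v x z
| Stage_fun v x g u : kind x = 3 -> (forall i, lt (u i) v) ->
    (forall i, Stage lt o (u i) (subconf x i) (g i)) -> Stage lt o v x (Suslin g).

Lemma Stage_inv lt o v x z : Stage lt o v x z ->
  match kind x with
  | 0 => z = leaf_value x
  | 1 => z = o (leaf_value x)
  | 2 => exists u u' y, [/\ lt u v, lt u' v, Stage lt o u (subconf x 0) y & Stage lt o u' (nextconf x y) z]
  | 3 => exists g u, [/\ forall i, lt (u i) v, forall i, Stage lt o (u i) (subconf x i) (g i) & z = Suslin g]
  | _ => False
  end.
Proof.
case=> [{}v {}x|{}v {}x|{}v u u' {}x y {}z|{}v {}x g u] -> //.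
- by move=> h1 h2 h3 h4; exists u, u', y.
- by move=> h1 h2; exists g, u.
Qed.

Lemma Stage_Run lt o v x z : Stage lt o v x z -> Run [:: o] x z.
Proof.
elim=> {v x z} [v x hk|v x hk|v u u' x y z hk _ _ _ h1 _ h2|v x g u hk _ _ h].
- exact: Run_leaf.
- exact: (@Run_oracle [:: o]).
- exact: Run_bind h1 h2.
- exact: Run_fun.
Qed.

Definition orc j z := mkc j.+1 (fun y => odd (y %/ 2 ^ j) == z :> nat).

Definition b2n (f : cantor) : nat -> nat := fun n => nat_of_bool (f n).

Lemma num_bit f L i : i < L -> odd (num f L %/ 2 ^ i) = f i.
Proof. by move=> hi; rewrite -(maskofE f hi) /maskof sumfE. Qed.

Lemma clop_orc j z f : clop (orc j z) f = (b2n f j == z).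
Proof. by rewrite clop_mkc num_bit. Qed.

(** * Approximations at one stage from those at earlier stages *)

Section Names.
Variables (lt : nat -> nat -> bool) (E : nat -> nat -> nat -> nat -> nat) (v : nat).

Definition Uname x z := susn (fun s k =>
  if s == 0 then fullc else if lt (headc s) v then E (headc s) x z k else 0).

Definition Tname x i := susn (fun s k => if s == 0 then fullc else Uname (subconf x i) (headc s) k).

Definition Pname x i := susn (fun s k =>
  if s == 0 then fullc else if headc s == 0 then 0 else Uname (subconf x i) (headc s) k).

(** For kind [2] one Suslin operation expresses both the union over the intermediate value, which is
    the first entry of the path, and the intersection of two conditions: sequences of length one
    carry the first, longer ones the second. For kind [3] the set where all premises have values is
    cut by the set where S8 yields [1], or by its complement. *)
Definition Ename x z k :=
  if kind x == 0 then (if z == leaf_value x then fullc else 0)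
  else if kind x == 1 then orc (leaf_value x) z
  else if kind x == 2 then susn (fun s k =>
    if s == 0 then fullc else if tailc s == 0 then Uname (subconf x 0) (headc s) k
    else Uname (nextconf x (headc s)) z k) k
  else if z == 1 then
    capc (susn (fun s k => if s == 0 then fullc else Tname x (sizec s).-1 k) k.+1)
         (susn (fun s k => Pname x s k) k.+1)
  else if z == 0 then
    diffc (susn (fun s k => if s == 0 then fullc else Tname x (sizec s).-1 k) k.+1)
          (susn (fun s k => Pname x s k) k.+1)
  else 0.

Definition Us x z f := exists2 u, lt u v & Stage lt (b2n f) u x z.

Hypothesis hE : forall u, lt u v -> forall x z,
  approximates (E u x z) (fun f => Stage lt (b2n f) u x z).

Lemma approx_full (X : cantor -> Prop) : (forall f, X f) -> approximates (fun=> fullc) X.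
Proof. by move=> h; apply: approx_clop => f; rewrite clop_full; split. Qed.

Lemma approx_empty (X : cantor -> Prop) : (forall f, ~ X f) -> approximates (fun=> 0) X.
Proof. by move=> h; apply: approx_clop => f; rewrite clop_empty; split=> // /h. Qed.

Lemma barS h n : bar h n.+1 = consc (h 0) (bar (fun i => h i.+1) n).
Proof.
rewrite /bar -code_cons; congr code; rewrite /mkseq /= -[1]addn0 iotaDl -map_comp.
by congr (_ :: _); apply: eq_map.
Qed.

Lemma bar_eq0 h n : (bar h n == 0) = (n == 0).
Proof. by rewrite /bar code_eq0 -size_eq0 size_mkseq. Qed.

(* A countable union as a Suslin operation that depends only on [h 0]. *)
Lemma Sus_U (X : nat -> cantor -> Prop) f :
  Sus (fun s f => if s == 0 then True else X (headc s) f) f <-> exists y, X y f.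
Proof.
split=> [[h hh]|[y hy]].
  by exists (h 0); have := hh 1; rewrite bar_eq0 headc_bar.
by exists (fun=> y) => -[|n]; rewrite bar_eq0 //= headc_bar.
Qed.

Lemma Sus_I (X : nat -> cantor -> Prop) f :
  Sus (fun s f => if s == 0 then True else X (sizec s).-1 f) f <-> forall i, X i f.
Proof.
split=> [[h hh] i|hX].
  by have := hh i.+1; rewrite bar_eq0 size_bar.
by exists id => -[|n]; rewrite bar_eq0 //= size_bar.
Qed.

Lemma UnameP x z : approximates (Uname x z) (Us x z).
Proof.
apply: (@approx_ext _ (Sus (fun s f => if s == 0 then True
    else lt (headc s) v /\ Stage lt (b2n f) (headc s) x z))) => [f|].
  rewrite (Sus_U (fun u f => lt u v /\ Stage lt (b2n f) u x z)).
  by split=> [[u []]|[u]]; exists u.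
apply: susn_approx => s; case: (s == 0); first exact: approx_full.
case h : (lt (headc s) v); last by apply: approx_empty => f [].
by apply: approx_ext (hE h x z) => f; split=> // -[].
Qed.

Lemma TnameP x i : approximates (Tname x i) (fun f => exists y, Us (subconf x i) y f).
Proof.
apply: (@approx_ext _ (Sus (fun s f => if s == 0 then True else Us (subconf x i) (headc s) f))) => [f|].
  exact: (Sus_U (fun y f => Us (subconf x i) y f)).
by apply: susn_approx => s; case: (s == 0); [exact: approx_full | exact: UnameP].
Qed.

Lemma PnameP x i : approximates (Pname x i) (fun f => exists2 y, 0 < y & Us (subconf x i) y f).
Proof.
apply: (@approx_ext _ (Sus (fun s f => if s == 0 then True else
    0 < headc s /\ Us (subconf x i) (headc s) f))) => [f|].
  rewrite (Sus_U (fun y f => 0 < y /\ Us (subconf x i) y f)).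
  by split=> [[u []]|[u]]; exists u.
apply: susn_approx => s; case: (s == 0); first exact: approx_full.
case h : (headc s == 0); first by apply: approx_empty => f []; rewrite (eqP h).
by apply: approx_ext (UnameP _ _) => f; rewrite lt0n h; split=> // -[].
Qed.

Lemma Stage_det o u u' x y z : Stage lt o u x y -> Stage lt o u' x z -> y = z.
Proof. by move=> /Stage_Run h1 /Stage_Run h2; apply: Run_det h1 h2. Qed.

(** Values are unique, so the function [g] of premise values can be replaced by the sets of points
    at which a premise has a positive value; to these sets the Suslin operation on names applies. *)
Lemma Stage_funE f x z : kind x = 3 -> Stage lt (b2n f) v x z <->
  (forall i, exists y, Us (subconf x i) y f) /\
  ((z = 1 /\ Sus (fun s f => exists2 y, 0 < y & Us (subconf x s) y f) f) \/
   (z = 0 /\ ~ Sus (fun s f => exists2 y, 0 < y & Us (subconf x s) y f) f)).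
Proof.
move=> hk.
have key g u : (forall i, lt (u i) v) -> (forall i, Stage lt (b2n f) (u i) (subconf x i) (g i)) ->
    Sus (fun s f => exists2 y, 0 < y & Us (subconf x s) y f) f <-> exists h, forall n, 0 < g (bar h n).
  move=> h1 h2; split=> -[h hh]; exists h => n.
    by case: (hh n) => y hy [u' _ hu']; rewrite (Stage_det (h2 _) hu').
  by exists (g (bar h n)) => //; exists (u (bar h n)).
split.
- move=> hS; have := Stage_inv hS; rewrite hk => -[g [u [h1 h2 ->]]].
  split; first by move=> i; exists (g i), (u i).
  rewrite (key _ _ h1 h2) /Suslin; case: excluded_middle_informative => h; [by left|by right].
- case=> h1 h2.
  have [g hg] := choice _ h1.
  have [u hu] : exists u : nat -> nat, forall i, lt (u i) v /\ Stage lt (b2n f) (u i) (subconf x i) (g i).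
    by apply: (choice (fun i u => lt u v /\ Stage lt (b2n f) u (subconf x i) (g i))) => i;
      case: (hg i) => u; exists u.
  have hu1 i := proj1 (hu i); have hu2 i := proj2 (hu i).
  have -> : z = Suslin g.
    rewrite /Suslin; move: h2; rewrite (key _ _ hu1 hu2).
    by case: excluded_middle_informative => h [[]|[]].
  by apply: Stage_fun hu1 hu2.
Qed.

Lemma EnameP x z : approximates (Ename x z) (fun f => Stage lt (b2n f) v x z).
Proof.
have hT : approximates (susn (fun s k => if s == 0 then fullc else Tname x (sizec s).-1 k))
    (fun f => forall i, exists y, Us (subconf x i) y f).
  apply: (@approx_ext _ (Sus (fun s f => if s == 0 then True
    else exists y, Us (subconf x (sizec s).-1) y f))) => [f|].
    exact: (Sus_I (fun i f => exists y, Us (subconf x i) y f)).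
  by apply: susn_approx => s; case: (s == 0); [exact: approx_full | exact: TnameP].
have hS : approximates (susn (fun s k => Pname x s k)) (Sus (fun s f => exists2 y, 0 < y & Us (subconf x s) y f)).
  by apply: susn_approx => s; apply: PnameP.
rewrite /Ename; case: (kind_cases x) => hk; rewrite hk /=.
- case: eqP => [->|hz]; first by apply: approx_full => f; apply: Stage_leaf.
  by apply: approx_empty => f /Stage_inv; rewrite hk.
- apply: approx_clop => f; rewrite clop_orc; split; first by move/Stage_inv; rewrite hk => ->.
  by move/eqP => <-; apply: Stage_oracle.
- apply: (@approx_ext _ (Sus (fun s f => if s == 0 then True else if tailc s == 0 then
    Us (subconf x 0) (headc s) f else Us (nextconf x (headc s)) z f))) => [f|].
    split=> [[h hh]|hSt].
      have := hh 1; have := hh 2; rewrite !bar_eq0 /= (barS h 0) (barS h 1).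
      rewrite !headc_cons !tailc_cons !bar_eq0 /= => -[u' hu' h2] [u hu h1].
      exact: Stage_bind hk hu hu' h1 h2.
    have := Stage_inv hSt; rewrite hk => -[u [u' [y [h1 h2 h3 h4]]]].
    exists (fun=> y) => -[|n]; rewrite bar_eq0 //= barS headc_cons tailc_cons bar_eq0.
    by case: (n == 0); [exists u | exists u'].
  apply: susn_approx => s; case: (s == 0); first exact: approx_full.
  by case: (tailc s == 0); apply: UnameP.
- case: eqP => [->|h1].
    apply: approx_ext (approx_cap hT hS) => f; rewrite Stage_funE //; split=> [[h1 h2]|[h1 [[_ h2]|[]]]] //.
    by split=> //; left.
  case: eqP => [->|h0].
    apply: approx_ext (approx_diff hT hS) => f; rewrite Stage_funE //; split=> [[h2 h3]|[h2 [[]|[_ h3]]]] //.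
    by split=> //; right.
  by apply: approx_empty => f; rewrite Stage_funE // => -[_ [[]|[]]].
Qed.

End Names.

(** * Well-orderings given by program indices *)

Definition wo_lt w u v := (run_val w [:: u; v] == 0) && (u != v).
Definition wo_rel w u v : Prop := run_val w [:: u; v] = 0.
Definition total_index w := forall x y, runs w [:: x; y].
Definition wo_index w := total_index w /\ wellordering (wo_rel w).

Ltac pcx ::= first [simple apply pc_kind | simple apply pc_leaf_value | simple apply pc_subconf
  | simple apply pc_nextconf | simple apply pc_index_num | simple apply pc_capc
  | simple apply pc_diffc | simple apply pc_epsc | simple apply pc_mesgt
  | match goal with
    | |- pc ?k ?P (fun r => susc (fun s => @?C r s) (@?K r)) =>
        refine (@pc_susc k P (fun s r => C r s) K _ _)
    | |- pc ?k ?P (fun r => mkc (@?F r) (fun s => @?p r s)) =>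
        refine (@pc_mkc k P F (fun s r => p r s) _ _)
    end].

Lemma wo_lt_wf w : wo_index w -> well_founded (fun u v => wo_lt w u v).
Proof.
case=> _ [h1 h2 h3 h4 h5] v; apply: NNPP => hv.
have hex : exists u, ~ Acc (fun u v => wo_lt w u v) u /\ wo_rel w u u.
  apply: NNPP => hno; apply: hv; constructor => u /andP[/eqP hu _].
  by apply: NNPP => hu'; apply: hno; exists u; split=> //; case: (h1 _ _ hu).
have [m [hm hmm hmin]] := h5 _ hex.
apply: hm; constructor => u /andP[/eqP hu /eqP hne]; apply: NNPP => hu'.
have [huu _] := h1 _ _ hu.
by apply: hne; apply: h2 => //; apply: hmin.
Qed.

(** Effective transfinite recursion along [w]: the program calls its own index only after testing
    that the stage precedes [v], and convergence and correctness follow by induction on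
    [wo_lt w]. *)
Lemma names : exists N, forall w, wo_index w -> forall v x z,
  (forall k, runs N [:: w; v; x; z; k]) /\
  approximates (fun k => run_val N [:: w; v; x; z; k]) (fun f => Stage (wo_lt w) (b2n f) v x z).
Proof.
pose Pre (s w v : nat) := total_index w /\
  forall u, wo_lt w u v -> forall x z k, runs s [:: s; w; u; x; z; k].
have [e he] : pc 6 (fun r => Pre (r 0) (r 1) (r 2)) (fun r =>
    Ename (wo_lt (r 1)) (fun u x z k => run_val (r 0) [:: r 0; r 1; u; x; z; k])
      (r 2) (r 3) (r 4) (r 5)).
{ rewrite /Ename /Tname /Pname /Uname /susn /wo_lt /orc /fullc; pca; cbv beta.
  all: rewrite /Pre => r /= H; repeat match goal with H : _ /\ _ |- _ => destruct H end.
  all: try match goal with H : total_index _ |- _ => exact: H end.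
  all: match goal with H : forall _, _ |- _ => by apply: H end. }
pose s := pickle e.
have step w v : wo_index w -> (forall u, wo_lt w u v -> forall x z k, runs s [:: s; w; u; x; z; k]) ->
    forall x z k, Comp Suslin [::] e [:: s; w; v; x; z; k]
      (Ename (wo_lt w) (fun u x z k => run_val s [:: s; w; u; x; z; k]) v x z k).
  by move=> [hw _] hu x z k; apply: (he [::] [:: s; w; v; x; z; k]).
have conv w v : wo_index w -> forall x z k, runs s [:: s; w; v; x; z; k].
  move=> hw; elim/(well_founded_ind (wo_lt_wf hw)): v => v IH x z k.
  by eexists; apply/Comp_pickle; apply: step.
have eqn w v x z : wo_index w -> (fun k => run_val s [:: s; w; v; x; z; k]) =
    Ename (wo_lt w) (fun u x z k => run_val s [:: s; w; u; x; z; k]) v x z.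
  move=> hw; apply: functional_extensionality => k.
  by apply: run_valE; apply/Comp_pickle; apply: step => // u _ *; exact: conv.
have nm w v : wo_index w -> forall x z,
    approximates (fun k => run_val s [:: s; w; v; x; z; k]) (fun f => Stage (wo_lt w) (b2n f) v x z).
  move=> hw; elim/(well_founded_ind (wo_lt_wf hw)): v => v IH x z.
  rewrite eqn //; apply: (EnameP (E := fun u x z k => run_val s [:: s; w; u; x; z; k])).
  by move=> u hu x' z'; apply: IH.
pose N := pickle (Ccomp e (Cconst s)).
have hN w v x z k : wo_index w ->
    Comp Suslin [::] Cenum [:: N; w; v; x; z; k] (run_val s [:: s; w; v; x; z; k]).
  move=> hw; apply/Comp_pickle; apply: C_comp; first exact: C_const.
  by apply/Comp_pickle; apply: runsP; apply: conv.
exists N => w hw v x z; split=> [k|]; first by eexists; apply: hN.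
have -> : (fun k => run_val N [:: w; v; x; z; k]) = (fun k => run_val s [:: s; w; v; x; z; k]).
  by apply: functional_extensionality => k; apply: run_valE; apply: hN.
exact: nm.
Qed.

Lemma Stage_map (lt lt' : nat -> nat -> bool) (phi : nat -> nat) o v x z :
  (forall u v, lt u v -> lt' (phi u) (phi v)) -> Stage lt o v x z -> Stage lt' o (phi v) x z.
Proof.
move=> h; elim=> {v x z} [v x hk|v x hk|v u u' x y z hk h1 h2 _ s1 _ s2|v x g u hk h1 _ h2].
- exact: Stage_leaf.
- exact: Stage_oracle.
- by apply: (Stage_bind hk (h _ _ h1) (h _ _ h2) s1 s2).
- by apply: (@Stage_fun lt' o _ x g (fun i => phi (u i))) => // i; apply: h.
Qed.

(* The ordered sum of a computable sequence of computable well-orderings, with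
   [consc n v] for the element [v] of the [n]th summand and [0] on top. *)
Lemma sup_wo_index gi : (forall n, runs gi [:: n]) -> (forall n, wo_index (run_val gi [:: n])) ->
  exists w, [/\ wo_index w, wo_rel w 0 0 & forall n v, wo_rel (run_val gi [:: n]) v v ->
    exists v', [/\ wo_rel w v' v', wo_lt w v' 0 &
      forall o x z, Stage (wo_lt (run_val gi [:: n])) o v x z -> Stage (wo_lt w) o v' x z]].
Proof.
move=> hg hW; pose wn n := run_val gi [:: n].
pose fld p := (p != 0) && (run_val (wn (headc p)) [:: tailc p; tailc p] == 0).
pose rs p p' := if p' == 0 then (p == 0) || fld p else if p == 0 then false
  else ((headc p < headc p') && (fld p && fld p')) ||
    ((headc p == headc p') && (run_val (wn (headc p)) [:: tailc p; tailc p'] == 0)).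
(* The negation is due to [wo_rel], where the value [0] stands for truth. *)
have [e he] : pc 2 tt1 (fun r => ~~ (rs (r 0) (r 1))).
{ rewrite /rs /fld /wn; pca.
  all: move=> r _ /=; try exact: hg; exact: (proj1 (hW _)). }
pose w := pickle e; exists w.
have hc p p' : Comp Suslin [::] Cenum [:: w; p; p'] (~~ rs p p').
  by apply/Comp_pickle; apply: (he [::] [:: p; p']).
have hr p p' : wo_rel w p p' <-> rs p p'.
  by rewrite /wo_rel (run_valE (hc p p')); case: (rs p p').
have cn0 n v : (consc n v == 0) = false by rewrite eqn0Ngt consc_gt0.
have fldE n v : fld (consc n v) <-> wo_rel (wn n) v v.
  rewrite /fld headc_cons tailc_cons cn0 /=.
  by split=> [/eqP|] // h; apply/eqP.
have rsE n v n' v' : rs (consc n v) (consc n' v') <->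
    (n < n' /\ fld (consc n v) /\ fld (consc n' v')) \/ (n = n' /\ wo_rel (wn n) v v').
  rewrite /rs !cn0 !headc_cons !tailc_cons.
  split.
  - case/orP => [/andP[h1 /andP[h2 h3]]|/andP[/eqP h1 /eqP h2]]; [by left|by right].
  - by case=> [[-> [-> ->]] //|[-> h]]; apply/orP; right; rewrite eqxx; apply/eqP.
have rs0r p : rs p 0 = (p == 0) || fld p by [].
have rs0l n v : rs 0 (consc n v) = false by rewrite /rs cn0.
have hwo n := proj2 (hW n).
have fld0 : fld 0 = false by [].
have cases p : p = 0 \/ exists n v, p = consc n v.
  by case: (posnP p) => [|hp]; [left | right; exists (headc p), (tailc p); rewrite consK].
have rfl p : rs p p <-> p = 0 \/ fld p.
  case: (cases p) => [->|[n [v ->]]]; first by split=> // _; left.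
  rewrite rsE ltnn fldE; split=> [[[]|[_ h]]|[h|h]] //; try by right.
  by have := consc_gt0 n v; rewrite h.
have WO : wellordering (wo_rel w).
  split.
  - move=> p p'; rewrite !hr !rfl.
    case: (cases p) => [->|[n [v ->]]]; case: (cases p') => [->|[n' [v' ->]]].
    + by auto.
    + by rewrite rs0l.
    + by rewrite rs0r => /orP[/eqP|]; auto.
    + rewrite rsE !fldE; case=> [[_ [h1 h2]]|[<- h]]; first by auto.
      by case: (hwo n) => h1 _ _ _ _; case: (h1 _ _ h); auto.
  - move=> p p'; rewrite !hr.
    case: (cases p) => [->|[n [v ->]]]; case: (cases p') => [->|[n' [v' ->]]] //;
      rewrite ?rs0l //.
    rewrite !rsE; case=> [[h1 _]|[h1 h2]]; case=> [[h3 _]|[h3 h4]]; try lia.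
    by move: h4; rewrite -h1 => h4; case: (hwo n) => _ h _ _ _; rewrite (h _ _ h2 h4).
  - move=> p q r; rewrite !hr.
    case: (cases p) => [->|[n [v ->]]]; case: (cases q) => [->|[n' [v' ->]]];
      case: (cases r) => [->|[n'' [v'' ->]]] //; rewrite ?rs0l //.
    + rewrite rsE !rs0r => -[[_ [-> _]]|[_ h]] _; first by rewrite orbT.
      by apply/orP; right; apply/fldE; case: (hwo n) => h1 _ _ _ _; case: (h1 _ _ h).
    + rewrite !rsE !fldE; case=> [[h1 [h2 h3]]|[h1 h2]]; case=> [[h4 [h5 h6]]|[h4 h5]].
      * by left; split; [lia|].
      * rewrite -h4 in h5 *; left; split=> //; split=> //.
        by case: (hwo n') => h _ _ _ _; case: (h _ _ h5).
      * rewrite h1 in h2 *; left; split=> //; split=> //.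
        by case: (hwo n') => h _ _ _ _; case: (h _ _ h2).
      * right; split; first by rewrite h1.
        by rewrite -h1 in h5; case: (hwo n) => _ _ h _ _; apply: h h2 h5.
  - move=> p p'; rewrite !hr !rfl.
    case: (cases p) => [->|[n [v ->]]]; case: (cases p') => [->|[n' [v' ->]]].
    + by left.
    + case=> // _ [h|h]; first by have := consc_gt0 n' v'; rewrite h.
      by right; rewrite rs0r h orbT.
    + move=> [h|h] _; first by have := consc_gt0 n v; rewrite h.
      by left; rewrite rs0r h orbT.
    + move=> [h|h]; first by have := consc_gt0 n v; rewrite h.
      case=> [h'|h']; first by have := consc_gt0 n' v'; rewrite h'.
      rewrite !rsE; case: (ltngtP n n') => hn; try by auto.
      subst n'; case: (hwo n) => _ _ _ ht _.
      by case: (ht v v'); [apply/fldE|apply/fldE|auto|auto].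
  - move=> P [p [hP hp]].
    have pex (Q : nat -> Prop) : (exists n, Q n) -> exists n, Q n /\ forall m, Q m -> n <= m.
      case=> n hn; elim/ltn_ind: n hn => n IH hn.
      case: (classic (exists2 m, m < n & Q m)) => [[m hm hQ]|hno]; first exact: (IH m).
      by exists n; split=> // m hm; rewrite leqNgt; apply/negP => h; apply: hno; exists m.
    (* The minimum is taken in the first summand that meets [P]; if there is none, it is the top
       element [0]. *)
    case: (classic (exists n v, P (consc n v) /\ fld (consc n v))) => [hex|hno].
      have [n [[v [hPv hfv]] hmin]] := pex (fun n => exists v, P (consc n v) /\ fld (consc n v)) hex.
      case: (hwo n) => _ _ _ _ /(_ (fun v => P (consc n v))) [|m [hm1 hm2 hm3]].
        by exists v; split=> //; apply/fldE.
      have hfm : fld (consc n m) by apply/fldE.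
      exists (consc n m); split=> //; first by apply/hr/rfl; right.
      move=> q hq /hr/rfl hqf; apply/hr.
      case: (cases q) => [->|[n' [v' e']]]; first by rewrite rs0r hfm orbT.
      subst q; have {}hqf : fld (consc n' v').
        by case: hqf => // h; have := consc_gt0 n' v'; rewrite h.
      apply/rsE; have : n <= n' by apply: hmin; exists v'.
      rewrite leq_eqVlt => /orP[/eqP hn|hn]; last by left.
      by subst n'; right; split=> //; apply: hm3 => //; apply/fldE.
    have hp0 q : P q -> wo_rel w q q -> q = 0.
      move=> hq /hr/rfl[] // hf; case: (cases q) => // -[n [v e']]; case: hno.
      by exists n, v; rewrite -e'.
    exists 0; rewrite -{1}(hp0 p hP hp); split=> //; first by apply/hr.
    by move=> q hq hqq; rewrite (hp0 q hq hqq); apply/hr.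
have hWw : wo_index w by split=> // p p'; exists (~~ rs p p').
split=> //; first by apply/hr.
move=> n v hv; exists (consc n v).
have hf : fld (consc n v) by apply/fldE.
split.
- by apply/hr/rfl; right.
- apply/andP; split; last by rewrite cn0.
  by apply/eqP/hr; rewrite rs0r hf orbT.
- move=> o x z; apply: Stage_map => u u' /andP[/eqP h1 h2]; apply/andP; split.
    by apply/eqP/hr/rsE; right.
  by apply: contra h2 => /eqP h; rewrite -(tailc_cons n u) h tailc_cons.
Qed.

(** * Semidecidable search for well-orderings that capture finitely many premises *)

Section StageSearch.
Import Order.TTheory GRing.Theory Num.Theory.

Definition name_index := proj1_sig (constructive_indefinite_description _ names).

Lemma name_index_runs w v x z k : wo_index w -> runs name_index [:: w; v; x; z; k].
Proof.
by move=> hw; case: (proj2_sig (constructive_indefinite_description _ names) w hw v x z).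
Qed.

Lemma name_index_approx w v x z : wo_index w ->
  approximates (fun k => run_val name_index [:: w; v; x; z; k]) (fun f => Stage (wo_lt w) (b2n f) v x z).
Proof.
by move=> hw; case: (proj2_sig (constructive_indefinite_description _ names) w hw v x z).
Qed.

Lemma wo_index_empty : exists w, wo_index w.
Proof.
have h x y : Comp Suslin [::] Cenum [:: pickle (Cconst 1); x; y] 1.
  by apply/Comp_pickle; apply: C_const.
have hr x y : ~ wo_rel (pickle (Cconst 1)) x y by rewrite /wo_rel (run_valE (h x y)).
exists (pickle (Cconst 1)); split; first by move=> x y; exists 1.
by split=> [x y|x y|x y z|x y|P [x [_]]] => /hr.
Qed.

(** A finite list is turned into a computable sequence by padding with the empty ordering. Even the
    empty list yields an ordering with an element, at which leaves and oracle calls can be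
    staged. *)
Lemma sup_seq (ws : seq nat) : (forall w, w \in ws -> wo_index w) ->
  exists w, [/\ wo_index w, wo_rel w 0 0 & forall w' v, w' \in ws -> wo_rel w' v v ->
    exists v', [/\ wo_rel w v' v', wo_lt w v' 0 &
      forall o x z, Stage (wo_lt w') o v x z -> Stage (wo_lt w) o v' x z]].
Proof.
move=> hws; have [w0 hw0] := wo_index_empty.
have [e he] : pc 1 tt1 (fun r => if r 0 < size ws then nthc (code ws) (r 0) else w0) by pca.
pose gi := pickle e.
have hc n : Comp Suslin [::] Cenum [:: gi; n] (if n < size ws then nthc (code ws) n else w0).
  by apply/Comp_pickle; apply: (he [::] [:: n]).
have hev n : run_val gi [:: n] = if n < size ws then nth 0 ws n else w0.
  by rewrite (run_valE (hc n)) /nthc CodeSeq.codeK.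
have [||w [h1 h2 h3]] := @sup_wo_index gi.
- by move=> n; eexists; apply: hc.
- by move=> n; rewrite hev; case: ifP => // hn; apply: hws; apply: mem_nth.
exists w; split=> // w' v hw' hv; move: (h3 (index w' ws) v).
by rewrite hev index_mem hw' nth_index //; apply.
Qed.

Definition staged_in w f x z := exists2 v, wo_rel w v v & Stage (wo_lt w) (b2n f) v x z.
Definition staged f x z := exists2 w, wo_index w & staged_in w f x z.

Lemma staged_leaf f x : kind x = 0 -> staged f x (leaf_value x).
Proof.
move=> hk; have [|w [h1 h2 _]] := @sup_seq [::]; first by [].
by exists w => //; exists 0 => //; apply: Stage_leaf.
Qed.

Lemma staged_oracle f x : kind x = 1 -> staged f x (b2n f (leaf_value x)).
Proof.
move=> hk; have [|w [h1 h2 _]] := @sup_seq [::]; first by [].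
by exists w => //; exists 0 => //; apply: Stage_oracle.
Qed.

Lemma staged_bind f x y z : kind x = 2 -> staged f (subconf x 0) y -> staged f (nextconf x y) z -> staged f x z.
Proof.
move=> hk [w1 hw1 [v1 hv1 s1]] [w2 hw2 [v2 hv2 s2]].
have [|w [h1 h2 h3]] := @sup_seq [:: w1; w2].
  by move=> w; rewrite !inE => /orP[] /eqP ->.
have [v1' [_ l1 m1]] := h3 w1 v1 (mem_head _ _) hv1.
have [|v2' [_ l2 m2]] := h3 w2 v2 _ hv2; first by rewrite !inE eqxx orbT.
exists w => //; exists 0 => //.
exact: (Stage_bind hk l1 l2 (m1 _ _ _ s1) (m2 _ _ _ s2)).
Qed.

Definition premise_in w x i f := exists z, staged_in w f (subconf x i) z.

Lemma staged_seq gi f x : (forall n, runs gi [:: n]) -> (forall n, wo_index (run_val gi [:: n])) ->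
  kind x = 3 -> (forall i, exists n, premise_in (run_val gi [:: n]) x i f) -> exists z, staged f x z.
Proof.
move=> hg hW hk hA; have [w [h1 h2 h3]] := sup_wo_index hg hW.
have [gv hgv] : exists gv : nat -> nat * nat, forall i,
    wo_lt w (gv i).1 0 /\ Stage (wo_lt w) (b2n f) (gv i).1 (subconf x i) (gv i).2.
  apply: (choice (fun i p => wo_lt w p.1 0 /\ Stage (wo_lt w) (b2n f) p.1 (subconf x i) p.2)) => i.
  case: (hA i) => n [z [v hv hs]]; have [v' [_ l m]] := h3 _ _ hv.
  by exists (v', z); split=> //=; apply: m.
exists (Suslin (fun i => (gv i).2)), w => //; exists 0 => //.
by apply: (@Stage_fun _ _ 0 x (fun i => (gv i).2) (fun i => (gv i).1)) => // i; case: (hgv i).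
Qed.

Definition premises_in w x n f := forall i, i < n -> premise_in w x i f.

(** The first entry of a path codes a pair of a stage in the field of [w] and a value, over which
    the union is taken. *)
Definition Aname w x i := susn (fun s k => if s == 0 then fullc else
  if run_val w [:: headc (headc s); headc (headc s)] == 0
  then run_val name_index [:: w; headc (headc s); subconf x i; tailc (headc s); k] else 0).

Definition Bname w x n := susn (fun s k =>
  if (s == 0) || (n < sizec s) then fullc else Aname w x (sizec s).-1 k).

Lemma AnameP w x i : wo_index w -> approximates (Aname w x i) (premise_in w x i).
Proof.
move=> hw; pose X p f := wo_rel w (headc p) (headc p) /\
  Stage (wo_lt w) (b2n f) (headc p) (subconf x i) (tailc p).
apply: (@approx_ext _ (Sus (fun s f => if s == 0 then True else X (headc s) f))) => [f|].
  rewrite Sus_U /X; split=> [[p [h1 h2]]|[z [v h1 h2]]].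
    by exists (tailc p), (headc p).
  by exists (consc v z); rewrite headc_cons tailc_cons.
apply: susn_approx => s; case: (s == 0); first exact: approx_full.
rewrite /X /wo_rel; case: eqP => h; last by apply: approx_empty => f [].
by apply: approx_ext (name_index_approx _ _ _ hw) => f; split=> // -[].
Qed.

Lemma BnameP w x n : wo_index w -> approximates (Bname w x n) (premises_in w x n).
Proof.
move=> hw; apply: (@approx_ext _ (Sus (fun s f => if s == 0 then True else
    (fun i f => i < n -> premise_in w x i f) (sizec s).-1 f))) => [f|].
  exact: (Sus_I (fun i f => i < n -> premise_in w x i f)).
apply: susn_approx => s; case h0 : (s == 0) => /=; first exact: approx_full.
have hss : 0 < sizec s.
  by rewrite /sizec lt0n size_eq0 -code_eq0 CodeSeq.decodeK h0.
case h : (n < sizec s); first by apply: approx_full => f; lia.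
by apply: approx_ext (AnameP x (sizec s).-1 hw) => f; split=> [//|]; apply; lia.
Qed.

(** For total [w] one Suslin operation decides well-foundedness. Its paths are descending sequences;
    comparing the last two entries is enough, because every initial segment is tested. *)
Definition isWO w := [&&
  allb (fun x => allb (fun y => ~~ (run_val w [:: x; y] == 0) ||
    ((run_val w [:: x; x] == 0) && (run_val w [:: y; y] == 0)))),
  allb (fun x => allb (fun y => ~~ ((run_val w [:: x; y] == 0) && (run_val w [:: y; x] == 0)) || (x == y))),
  allb (fun x => allb (fun y => allb (fun z =>
    ~~ ((run_val w [:: x; y] == 0) && (run_val w [:: y; z] == 0)) || (run_val w [:: x; z] == 0)))),
  allb (fun x => allb (fun y =>
    ~~ ((run_val w [:: x; x] == 0) && (run_val w [:: y; y] == 0)) ||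
    ((run_val w [:: x; y] == 0) || (run_val w [:: y; x] == 0)))) &
  ~~ susb (fun s => (sizec s < 2) ||
    wo_lt w (nthc s (sizec s).-1) (nthc s (sizec s).-2))].

Lemma isWOP w : isWO w <-> wellordering (wo_rel w).
Proof.
split.
- case/and5P => /allbP h1 /allbP h2 /allbP h3 /allbP h4 h5; split.
  + move=> x y /eqP h; have /allbP/(_ y) := h1 x.
    by rewrite h /= => /andP[/eqP ? /eqP ?].
  + by move=> x y /eqP hxy /eqP hyx; have /allbP/(_ y) := h2 x; rewrite hxy hyx => /eqP.
  + move=> x y z /eqP hxy /eqP hyz; have /allbP/(_ y)/allbP/(_ z) := h3 x.
    by rewrite hxy hyz => /eqP.
  + move=> x y /eqP hx /eqP hy; have /allbP/(_ y) := h4 x.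
    by rewrite hx hy /= => /orP[/eqP|/eqP]; [left|right].
  + move=> P [x0 [hP0 hR0]]; apply: NNPP => hno.
    have step x : P x /\ wo_rel w x x -> exists y, (P y /\ wo_rel w y y) /\ wo_lt w y x.
      case=> hP hR; apply: NNPP => hn; apply: hno; exists x; split=> // y hPy hRy.
      have /allbP/(_ y) := h4 x; rewrite /wo_rel in hR hRy *; rewrite hR hRy /=.
      case/orP => [/eqP //|hyx]; case: (x =P y) => [->|hxy] //.
      case: hn; exists y; split=> //; rewrite /wo_lt hyx /=.
      by apply/eqP => h; apply: hxy.
    pose nb x := epsilon (inhabits 0) (fun y => (P y /\ wo_rel w y y) /\ wo_lt w y x).
    pose h n := iter n nb x0.
    have hh n : P (h n) /\ wo_rel w (h n) (h n).
      elim: n => [|n IH] //=; exact: proj1 (epsilon_spec _ _ (step _ IH)).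
    have hl n : wo_lt w (h n.+1) (h n).
      exact: proj2 (epsilon_spec _ _ (step _ (hh n))).
    case/negP: h5; apply/susbP; exists h => -[|[|n]]; rewrite size_bar //=.
    by rewrite !nth_bar ltnSn (ltnW (ltnSn _)) hl.
- case=> h1 h2 h3 h4 h5; apply/and5P; split.
  + apply/allbP => x; apply/allbP => y; case: eqP => //= h.
    by case: (h1 x y h) => -> ->.
  + apply/allbP => x; apply/allbP => y.
    case: eqP => //= hx; case: eqP => //= hy.
    by apply/eqP; apply: h2.
  + apply/allbP => x; apply/allbP => y; apply/allbP => z.
    case: eqP => //= hx; case: eqP => //= hy.
    by apply/eqP; apply: h3 hx hy.
  + apply/allbP => x; apply/allbP => y.
    case: eqP => //= hx; case: eqP => //= hy.
    by case: (h4 x y hx hy) => ->; rewrite ?orbT.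
  + apply/negP => /susbP[h hh].
    have hl n : wo_lt w (h n.+1) (h n).
      have := hh n.+2; rewrite size_bar /= !nth_bar ltnSn (ltnW (ltnSn _)).
      by [].
    have hf n : wo_rel w (h n.+1) (h n.+1).
      by case/andP: (hl n) => /eqP h' _; case: (h1 _ _ h').
    have [|m [[n hn] hm hmin]] := h5 (fun x => exists n, x = h n.+1).
      by exists (h 1); split; [exists 0 | exact: hf].
    have hr : wo_rel w m (h n.+2) by apply: hmin => //; exists n.+1.
    case/andP: (hl n.+1) => /eqP h' /eqP; apply; rewrite -hn.
    by apply: h2 => //; rewrite hn.
Qed.

Local Open Scope ring_scope.

Section Search.
Variables (x c : nat).

(** The clopen code [c] represents the bound [mes c]. The margin [halfpow k] absorbs the error of
    the [k]th approximation: a success really bounds the set of failures, and success is certain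
    when the premises hold on a set of outer measure above [mes c]. *)
Definition enough w n := exb (fun k => ~~ mesgt c (epsc k) (Bname w x n k)).

Lemma enoughP w n : enough w n <->
  exists k, mes c + halfpow k <= mes (Bname w x n k).
Proof.
by split=> [/exbP|hk]; [|apply/exbP]; case: hk || move=> []; move=> k hk; exists k;
  move: hk; rewrite mesgtE mes_eps -leNgt.
Qed.

Lemma enough_Cov w n : wo_index w -> enough w n -> Cov (fun f => ~ premises_in w x n f) (1 - mes c).
Proof.
move=> hw /enoughP[k hk]; have hB := BnameP x n hw k.
set b := Bname w x n k in hk hB.
have h1 : Cov (clop (diffc fullc b)) (1 - mes c - halfpow k).
  apply: (Cov_sub _ _ (Cov_clop (diffc fullc b))) => //.
  have := mes_diff fullc b; rewrite mes_full.
  have -> : mes (capc fullc b) = mes b.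
    by apply: mes_ext => f; rewrite clop_cap clop_full.
  by lra.
apply: (@Cov_sub _ _ (1 - mes c - halfpow k + halfpow k)) (Cov_U h1 hB); last by lra.
move=> f hf; case hb : (clop b f); last by left; rewrite clop_diff clop_full hb.
by right; rewrite /differ hb => -[_ h]; apply: hf; apply: h.
Qed.

Lemma outer_le_enough w n : wo_index w -> ~ outer_le (premises_in w x n) (mes c) -> enough w n.
Proof.
move=> hw hL; apply/enoughP; apply: NNPP => hno; apply: hL => e he.
have [k hk] := @halfpow_small (e / 2%:R) (ltac:(lra)).
have hlt : mes (Bname w x n k) < mes c + halfpow k.
  by rewrite ltNge; apply/negP => h; apply: hno; exists k.
apply: Cov_sub (Cov_U (Cov_clop (Bname w x n k)) (BnameP x n hw k)); last by lra.
move=> f hf; case hb : (clop (Bname w x n k) f); [by left | right].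
by rewrite /differ hb => -[h _]; have := h hf.
Qed.

(* [Capp 0] serves as a divergent program, there being no type-1 argument. *)
Lemma search_prog : exists V : kcode, forall w n,
  (exists z, Comp Suslin [::] V [:: w; n] z) <-> wo_index w /\ enough w n.
Proof.
have [e he] : pc 2 (fun r => total_index (r 0%N)) (fun r => isWO (r 0%N) && enough (r 0%N) (r 1%N)).
{ apply: (@pc_and _ _ (fun r => isWO (r 0%N)) (fun r => enough (r 0%N) (r 1%N))).
  { rewrite /isWO /wo_lt; pca.
    all: move=> r /= H; repeat match goal with H : _ /\ _ |- _ => destruct H end.
    all: match goal with H : total_index _ |- _ => exact: H end. }
  { rewrite /enough /Bname /Aname /susn; pca; cbv beta.
    all: move=> r /= H; repeat match goal with H : _ /\ _ |- _ => destruct H end.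
    all: try match goal with H : total_index _ |- _ => exact: H end.
    all: apply: name_index_runs; split=> //; exact/isWOP. } }
(* Two applications of S8 run [w] on all pairs, so [T] converges exactly when [w] is total. Only
   then may [isWO] and [enough] be evaluated. *)
pose T := Cfun (Cfun (xcall 4 Cenum [:: cvar 2; cvar 1; cvar 0])).
exists (Ccomp (cif (wk e) (Capp 0) (Cconst 0)) T) => w n.
have hev a b : evals Suslin [::] [:: cvar 2; cvar 1; cvar 0] [:: b; a; w; n] [:: w; a; b].
  by split; [exact: cvarP | split; [exact: cvarP | split=> //; exact: cvarP]].
split.
- case=> z /Comp_inv[y /Comp_inv[g hg _] h].
  have ht : total_index w.
    move=> a b; case/Comp_inv: (hg a) => g' /(_ b) + _.
    by move/(xcallE _ _ erefl (hev a b)); exists (g' b).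
  case/cif_inv: h => m /wkE h0.
  have {he} := he [::] [:: w; n] erefl ht => /(Comp_det h0) /= ->.
  case: andP => [[h1 h2] _|_ /Comp_inv[]] //.
  by split=> //; split=> //; apply/isWOP.
- case=> -[ht hw] hn; exists 0%N.
  pose G b := Suslin (fun a => run_val w [:: b; a]).
  apply: (C_comp (y := Suslin G)).
    apply: C_fun => a; apply: C_fun => b.
    by apply/(xcallE _ _ erefl (hev a b)); apply: runsP.
  apply: (@cifS _ _ _ _ _ _ 0); last exact: C_const.
  apply/wkE; have := he [::] [:: w; n] erefl ht => /=.
  by rewrite hn (_ : isWO w) //; apply/isWOP.
Qed.

End Search.

End StageSearch.

(** * Almost all points complete S8 below the supremum *)

Section Sacks.
Import Order.TTheory GRing.Theory Num.Theory.

Local Open Scope ring_scope.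

(** A clopen code for the dyadic rational [j * halfpow m], used to hand a bound to the search. *)
Definition dyad m j := mkc m (fun y => (y < j)%N).

Lemma mes_dyad m j : (j <= 2 ^ m)%N -> mes (dyad m j) = j%:R * halfpow m.
Proof.
move=> hj; rewrite -(@cnt_level m) ?lv_mkc // /cnt sumfE; congr (_%:R * _).
rewrite (eq_bigr (fun i : 'I_(2 ^ m) => (i < j : nat)%N)) => [|i _]; last first.
  by rewrite In_mkc modn_small.
by rewrite sum_ltn; apply/minn_idPr.
Qed.

Definition Dset x (f : cantor) := forall i, exists z, staged f (subconf x i) z.
Definition Nset x f := Dset x f /\ ~ exists z, staged f x z.

(** By continuity of outer measure, the orderings with index below some [j] capture the first [n]
    premises on a set of outer measure above [mes c]. They are finitely many, and their sum does the
    work of all of them. *)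
Lemma enough_ex x c n : ~ outer_le (Dset x) (mes c) -> exists2 w, wo_index w & enough x c w n.
Proof.
move=> hD; pose X j f := forall i, (i < n)%N ->
  exists w, [/\ (w < j)%N, wo_index w & premise_in w x i f].
have [j hj] : exists j, ~ outer_le (X j) (mes c).
  apply: not_all_ex_not => hall; apply: hD; apply: outer_le_sub (outer_le_incr _ hall).
  - move=> f hf.
    have [wi hwi] : exists wi : nat -> nat, forall i, wo_index (wi i) /\ premise_in (wi i) x i f.
      apply: (choice (fun i w => wo_index w /\ premise_in w x i f)) => i.
      by case: (hf i) => z [w h1 h2]; exists w; split=> //; exists z.
    exists (\sum_(i < n) (wi i).+1)%N => i hi; exists (wi i); case: (hwi i) => h1 h2.
    by split=> //; rewrite (bigD1 (Ordinal hi)) //= leq_addr.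
  - move=> j f hf i hi; case: (hf i hi) => w [h1 h2 h3]; exists w; split=> //.
    exact: ltnW.
pose ws := [seq w <- iota 0 j | if excluded_middle_informative (wo_index w) then true else false].
have hws w : w \in ws <-> (w < j)%N /\ wo_index w.
  rewrite mem_filter mem_iota /=; case: excluded_middle_informative => h /=.
    by split=> [|[]].
  by split=> [|[]].
have [w [h1 h2 h3]] := @sup_seq ws (fun w hw => proj2 (proj1 (hws w) hw)).
exists w => //; apply: outer_le_enough => // hL; apply: hj; apply: outer_le_sub hL => f hf i hi.
case: (hf i hi) => w' [l' hw' [z [v hv hs]]].
have [|v' [hv' _ m]] := h3 w' v _ hv; first by apply/hws.
by exists z, v' => //; apply: m.
Qed.

(* Sacks's argument.  Let [q] be slightly below the outer measure of the set of
   points at which all premises converge; for each [n] some well-ordering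
   captures the first [n] premises on a set larger than [q].  Selection makes
   the choice computable, and the sum of the chosen orderings captures all
   premises simultaneously on a set of measure at least [q]. *)
Lemma sacks x e : kind x = 3%N -> 0 < e -> Cov (Nset x) e.
Proof.
move=> hk he.
(* A quarter of [e] pays for the dyadic grid that locates the outer measure of [Dset x], and one
   quarter for the error in each of the two covers intersected at the end. *)
have [m hm] := @halfpow_small (e / 4%:R) (ltac:(lra)).
pose isLe j := if excluded_middle_informative (outer_le (Dset x) (j%:R * halfpow m)) then true else false.
have hisLe j : isLe j <-> outer_le (Dset x) (j%:R * halfpow m).
  by rewrite /isLe; case: excluded_middle_informative.
have hex : exists j, isLe j.
  exists (2 ^ m)%N; apply/hisLe; rewrite halfpow_exp -mes_full; apply: Cov_Le.
  by apply: Cov_sub (Cov_clop fullc) => // f _; apply: clop_full.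
(* If the least grid bound is [0], then [Dset x] is itself null; otherwise [j] steps of the grid are
   too few and [j + 1] suffice. *)
case: (ex_minnP hex) => -[|j] hj hmin.
  have := (proj1 (hisLe _) hj) e he; rewrite mul0r add0r.
  by apply: Cov_sub => // f [].
have hj2 : (j <= 2 ^ m)%N.
  apply: ltnW; apply: hmin; apply/hisLe; rewrite halfpow_exp -mes_full; apply: Cov_Le.
  by apply: Cov_sub (Cov_clop fullc) => // f _; apply: clop_full.
pose c := dyad m j; have hc : mes c = j%:R * halfpow m by apply: mes_dyad.
have hnL : ~ outer_le (Dset x) (mes c).
  by rewrite hc => /hisLe /hmin; rewrite ltnn.
have hLe : outer_le (Dset x) (mes c + halfpow m).
  by have := proj1 (hisLe _) hj; rewrite hc -addn1 natrD mulrDl mul1r.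
have [V hV] := search_prog x c.
have [g hg] := gandy V.
have hgn n : exists2 w, Comp Suslin [::] g [:: n] w & wo_index w /\ enough x c w n.
  have [w hw1 hw2] := enough_ex n hnL.
  have [|w' h1 h2] := hg n; first by exists w; apply/hV; split.
  by exists w'; [exact: h1 | apply/hV].
pose gi := pickle g.
have hev n : wo_index (run_val gi [:: n]) /\ enough x c (run_val gi [:: n]) n.
  by case: (hgn n) => w /Comp_pickle/run_valE ->.
have hcnv n : runs gi [:: n] by case: (hgn n) => w /Comp_pickle hw; exists w.
pose Y f := forall i, exists n, premise_in (run_val gi [:: n]) x i f.
have hYX f : Y f -> exists z, staged f x z.
  by apply: staged_seq => // n; case: (hev n).
have hYD f : Y f -> Dset x f.
  move=> hf i; case: (hf i) => n [z hz]; exists z, (run_val gi [:: n]) => //.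
  by case: (hev n).
(* The ordering chosen for [n] captures the first [n] premises outside a set of size [1 - mes c].
   The points missing one of the first [n] premises increase with [n], so the bound passes to their
   union. *)
have hYc : outer_le (fun f => ~ Y f) (1 - mes c).
  pose Z n f := ~ forall i, (i < n)%N -> exists n, premise_in (run_val gi [:: n]) x i f.
  apply: (@outer_le_sub _ (fun f => exists n, Z n f)).
    move=> f hf; apply: NNPP => hno; apply: hf => i; apply: NNPP => hi.
    by apply: hno; exists i.+1 => /(_ i (ltnSn i)).
  apply: outer_le_incr => [n f hZ h|n]; first by apply: hZ => i hi; apply: h; apply: ltnW.
  apply: Cov_Le; case: (hev n) => hw hen.
  apply: Cov_sub (enough_Cov hw hen) => // f hZ hB; apply: hZ => i hi.
  by exists n; apply: hB.
have he4 : 0 < e / 4%:R by lra.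
have hun f : Dset x f \/ ~ Y f.
  by case: (classic (Y f)) => hf; [left; exact: hYD | by right].
apply: (Cov_sub _ _ (Cov_cap hun (hLe _ he4) (hYc _ he4))); last by lra.
by move=> f [hD hX]; split=> // /hYX.
Qed.

Definition exceptional f := exists x, kind x = 3%N /\ Nset x f.

Lemma exceptional_null : m_null exceptional.
Proof.
apply: m_null_Cov => e he.
apply: (@Cov_bigU (fun x f => kind x = 3%N /\ Nset x f) (fun x => e * halfpow x.+1)) => [x|n].
  have he' : 0 < e * halfpow x.+1 by rewrite mulr_gt0 // halfpow_gt0.
  case: (kind x =P 3%N) => hk.
    by apply: Cov_sub (sacks hk he') => // f [].
  apply: Cov_sub (ltW he') _; last by rewrite -mes_empty; apply: Cov_clop.
  by move=> f [].
rewrite -mulr_sumr sum_halfpow; have := mulr_gt0 he (halfpow_gt0 n).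
by rewrite mulrBr mulr1; lra.
Qed.

(** A failure could occur only at S8 and would put [f] into [Nset] of that configuration. The staged
    value is the right one because values are unique. *)
Lemma Run_Xf f x z : ~ exceptional f -> Run [:: b2n f] x z -> staged f x z.
Proof.
move=> hf; elim=> {x z} [x hk|x hk _|x y z hk _ h1 _ h2|x g hk hr IH].
- exact: staged_leaf.
- exact: staged_oracle.
- exact: staged_bind h1 h2.
- have [z hz] : exists z, staged f x z.
    apply: NNPP => hno; apply: hf; exists x; split=> //; split=> // i.
    by exists (g i); apply: IH.
  suff -> : Suslin g = z by [].
  case: hz => w _ [v _ /Stage_Run h]; apply: Run_det h.
  exact: Run_fun.
Qed.

End Sacks.

(** * Stages of subcomputations of composite programs *)

Section Descent.
Variables (lt : nat -> nat -> bool) (o : nat -> nat).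
Hypothesis lt_trans : forall u v w, lt u v -> lt v w -> lt u w.

Definition le u v := u = v \/ lt u v.

Lemma le_trans u v w : le u v -> le v w -> le u w.
Proof. by case=> [->|h] // [<-|h']; right=> //; apply: lt_trans h h'. Qed.

Lemma lt_le_trans u v w : lt u v -> le v w -> lt u w.
Proof. by move=> h [<-|h'] //; apply: lt_trans h h'. Qed.

Lemma le_lt_trans u v w : le u v -> lt v w -> lt u w.
Proof. by case=> [->|h] // h'; apply: lt_trans h h'. Qed.

(** Unwinding a composite program passes through administrative steps whose number is irrelevant; it
    only matters that the stage does not rise, while S8 itself forces a strict descent. *)
Definition below_St v c a z := exists2 u, le u v & Stage lt o u (conf c a) z.

Lemma below_trans u v c a z : le u v -> below_St u c a z -> below_St v c a z.
Proof. by move=> h [t ht hs]; exists t => //; apply: le_trans h. Qed.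

Lemma Stage_comp v e1 e2 a z : Stage lt o v (conf (Ccomp e1 e2) a) z ->
  exists u y, [/\ lt u v, Comp Suslin [:: o] e2 a y & Stage lt o u (conf e1 (y :: a)) z].
Proof.
move/Stage_inv; rewrite kindE => -[u [u' [y [h1 h2]]]]; rewrite subconf_compE nextconf_compE => s1 s2.
by exists u', y; split=> //; apply: Run_Comp => //; apply: Stage_Run s1.
Qed.

Lemma Stage_wk v e x a z : Stage lt o v (conf (wk e) (x :: a)) z -> below_St v e a z.
Proof.
elim: x v z => [|x IH] v z /Stage_inv; rewrite kindE => -[u [u' [y [h1 h2]]]].
  by rewrite nextconf_pr0E => _ hs; exists u' => //; right.
rewrite subconf_prSE nextconf_prSE => hs hs'; have := Stage_inv hs'; rewrite kindE leaf_valueE => ->.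
by apply: below_trans (IH _ _ hs); right.
Qed.

Lemma Stage_wk_iter v e b a z :
  Stage lt o v (conf (iter (size b) wk e) (b ++ a)) z -> below_St v e a z.
Proof.
elim: b v => [|x b IH] v /=; first by move=> h; exists v => //; left.
by case/Stage_wk => u hu /IH; apply: below_trans.
Qed.

Lemma Stage_swap v i e a z : i < size a -> Stage lt o v (conf (Cswap i e) a) z ->
  below_St v e (swap0 i a) z.
Proof.
move=> hi /Stage_inv; rewrite kindE => -[u [u' [y [h1 h2]]]].
by rewrite nextconf_swapE // => _ hs; exists u' => //; right.
Qed.

Lemma Stage_enum v n (c : kcode) a z : unpickle n = Some c ->
  Stage lt o v (conf Cenum (n :: a)) z -> below_St v c a z.
Proof.
move=> hc /Stage_inv; rewrite kindE => -[u [u' [y [h1 h2]]]].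
by rewrite (nextconf_enumE _ _ hc) => _ hs; exists u' => //; right.
Qed.

Lemma Stage_sink v e vs b ws z : size vs <= size b ->
  Stage lt o v (conf (sink (size vs) (size b) e) (vs ++ b ++ ws)) z ->
  below_St v e (rev vs ++ ws) z.
Proof.
elim: vs b ws v => [|x vs IH] b ws v hb; first exact: Stage_wk_iter.
case/lastP: b hb => // b y; rewrite /= size_rcons ltnS => hb.
case/Stage_swap; first by rewrite /= !size_cat size_rcons; lia.
rewrite swap0_last => u hu /Stage_wk[u' hu' /IH]; rewrite rev_cons cat_rcons => /(_ hb).
by apply: below_trans; apply: le_trans hu' hu.
Qed.

Lemma Stage_push v es b a vs e z : evals Suslin [:: o] es a vs ->
  Stage lt o v (conf (push (size b) es e) (b ++ a)) z -> below_St v e (rev vs ++ b ++ a) z.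
Proof.
elim: es b vs v => [|e1 es IH] b [|x vs] v //=; first by move=> _ h; exists v => //; left.
case=> h1 h2 /Stage_comp[u [y [hu /wkE_iter hy hs]]].
rewrite (Comp_det hy h1) in hs; have h := IH (x :: b) _ _ h2 hs.
by rewrite rev_cons cat_rcons; apply: below_trans h; right.
Qed.

Lemma Stage_xcall v k e es a vs z : size a = k -> evals Suslin [:: o] es a vs ->
  Stage lt o v (conf (xcall k e es) a) z -> below_St v e vs z.
Proof.
move=> hk hes; have hs := evals_size hes.
have h0 : evals Suslin [:: o] (nseq (size es) (Cconst 0)) a (nseq (size es) 0).
  by elim: (size es) => //= n IH; split=> //; apply: C_const.
case/(Stage_push (b := [::]) (evals_cat h0 hes)) => u hu; rewrite /= rev_cat -catA.
have -> : size es + k = size (rev (nseq (size es) 0) ++ a).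
  by rewrite size_cat size_rev size_nseq hk.
have {1}-> : size es = size (rev vs) by rewrite size_rev.
have := @Stage_sink u e (rev vs) (rev (nseq (size es) 0) ++ a) [::] z.
rewrite revK !cats0 => hS /hS h; apply: below_trans hu (h _).
by rewrite !size_cat !size_rev size_nseq hs leq_addr.
Qed.

Lemma Stage_cfun v e a z : Stage lt o v (conf (Cfun e) a) z ->
  forall i, exists u t, lt u v /\ Stage lt o u (conf e (i :: a)) t.
Proof.
move/Stage_inv; rewrite kindE => -[g [u [h1 h2 _]]] i; exists (u i), (g i).
by rewrite -subconf_funE.
Qed.

Lemma Stage_cif0 v e0 e1 e2 a z : Comp Suslin [:: o] e0 a 0 ->
  Stage lt o v (conf (cif e0 e1 e2) a) z -> below_St v e1 a z.
Proof.
move=> h0 /Stage_comp[u [p [hu /Comp_inv[y /(Comp_det h0) <- /pr_constE ->]]]].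
by move=> /(Stage_enum (pickleK _)); apply: below_trans; right.
Qed.

End Descent.

Lemma wo_lt_trans w : wo_index w -> forall u v t, wo_lt w u v -> wo_lt w v t -> wo_lt w u t.
Proof.
case=> _ [h1 h2 h3 h4 h5] u v t /andP[/eqP a1 /eqP n1] /andP[/eqP a2 /eqP n2].
apply/andP; split; first by apply/eqP; apply: h3 a1 a2.
by apply/eqP => e; rewrite e in a1 n1 *; apply: n1; apply: h2.
Qed.

(* A program [B] such that [B] on [self, x] calls itself on all strict
   [R]-predecessors of [x] converges at a stage above those of its calls, so a
   well-ordering decided by [e] embeds into the stages of [B]. *)
Lemma otype_le_stage f R e : ~ exceptional f -> wellordering R ->
  (forall x y, (R x y -> Comp Suslin [:: b2n f] e [:: x; y] 0) /\ (~ R x y -> Comp Suslin [:: b2n f] e [:: x; y] 1)) ->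
  exists2 w, wo_index w & otype_le R (wo_rel w).
Proof.
move=> hf [r1 r2 r3 r4 r5] he; pose o := b2n f.
(* The environment is the answer of [e], then [y], the self index and [x]; the value is [0] exactly
   for a strict predecessor [y], the case in which [cif] makes the recursive call. *)
have [eq1 heq1] : pc 4 tt1 (fun r => ~~ ((r 0 == 0) && (r 1 != r 3))) by pca.
pose cnd := Ccomp eq1 (xcall 3 e [:: cvar 0; cvar 2]).
pose cal := xcall 3 Cenum [:: cvar 1; cvar 1; cvar 0].
pose B := Cfun (cif cnd cal (Cconst 0)).
have [s hs] : exists s, (unpickle s : option kcode) = Some B.
  by exists (pickle B); apply: pickleK.
have ev1 x y : evals Suslin [:: o] [:: cvar 0; cvar 2] [:: y; s; x] [:: y; x].
  by split; [exact: cvarP | split=> //; exact: cvarP].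
have ev2 x y : evals Suslin [:: o] [:: cvar 1; cvar 1; cvar 0] [:: y; s; x] [:: s; s; y].
  by split; [exact: cvarP | split; [exact: cvarP | split=> //; exact: cvarP]].
have hcnd x y : (R y x /\ y <> x -> Comp Suslin [:: o] cnd [:: y; s; x] 0) /\ (~ (R y x /\ y <> x) -> Comp Suslin [:: o] cnd [:: y; s; x] 1).
  have h v : Comp Suslin [:: o] e [:: y; x] v ->
      Comp Suslin [:: o] cnd [:: y; s; x] (~~ ((v == 0) && (y != x))).
    move=> hv; apply: C_comp; last exact: (heq1 [:: o] [:: v; y; s; x]).
    exact/(xcallE _ _ erefl (ev1 x y)).
  case: (he y x) => h0 h1; split.
  - by case=> /h0/h hc /eqP hne; rewrite hne in hc.
  - case: (classic (R y x)) => hR hn; last by have := h _ (h1 hR).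
    have := h _ (h0 hR); case: (y =P x) => hxy //=.
    by case: hn.
have wfR : well_founded (fun y x => R y x /\ y <> x).
  move=> v; apply: NNPP => hv.
  have hex : exists u, ~ Acc (fun y x => R y x /\ y <> x) u /\ R u u.
    apply: NNPP => hno; apply: hv; constructor => u [hu _].
    by apply: NNPP => hu'; apply: hno; exists u; split=> //; case: (r1 _ _ hu).
  have [m [hm hmm hmin]] := r5 _ hex.
  apply: hm; constructor => u [hu hne]; apply: NNPP => hu'.
  by apply: hne; apply: r2 => //; apply: hmin => //; case: (r1 _ _ hu).
have convB x : exists z, Comp Suslin [:: o] B [:: s; x] z.
  elim/(well_founded_ind wfR): x => x IH.
  have hy y : exists z, Comp Suslin [:: o] (cif cnd cal (Cconst 0)) [:: y; s; x] z.
    case: (classic (R y x /\ y <> x)) => hR.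
      have [z hz] := IH y hR; exists z; apply: cif0; first by apply: (hcnd x y).1.
      by apply/(xcallE _ _ erefl (ev2 x y)); apply: C_enum hs hz.
    exists 0; apply: cifS; first by apply: (hcnd x y).2.
    exact: C_const.
  have [g hg] := choice _ hy.
  by exists (Suslin g); apply: C_fun.
have [g hg] := choice _ convB.
(* A single computation with those of [B] at all [x] among its premises, so that one ordering [w]
   stages all of them. *)
pose O := Cfun (Ccomp B (Cconst s)).
have convO : Comp Suslin [:: o] O [::] (Suslin g).
  by apply: C_fun => x; apply: C_comp (hg x); apply: C_const.
have [w hw [v0 hv0 hs0]] := Run_Xf hf (Comp_Run (al := [:: b2n f]) (leqnn 1) convO).
exists w => //.
have lt_tr := wo_lt_trans hw; have [_ [q1 q2 q3 q4 q5]] := hw.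
pose Sim x v := exists z, Stage (wo_lt w) o v (conf B [:: s; x]) z.
have fl u v : wo_lt w u v -> wo_rel w u u.
  by case/andP => /eqP h _; case: (q1 _ _ h).
have simall x : exists v, Sim x v /\ wo_rel w v v.
  have [u [t [h1 /Stage_comp[u' [y [h3 /Comp_inv ey h4]]]]]] := Stage_cfun hs0 x.
  by exists u'; rewrite ey in h4; split; [exists t | apply: fl h3].
have simlt x y v : R y x -> y <> x -> Sim x v -> exists2 u, wo_lt w u v & Sim y u.
  move=> hR hne [z hz]; have [u [t [h1 h2]]] := Stage_cfun hz y.
  have [u1 hu1 h3] := Stage_cif0 lt_tr ((hcnd x y).1 (conj hR hne)) h2.
  have [u2 hu2 h4] := Stage_xcall lt_tr erefl (ev2 x y) h3.
  have [u3 hu3 hs3] := Stage_enum hs h4.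
  exists u3; last by exists t.
  apply: (le_lt_trans lt_tr) h1.
  by apply: (le_trans lt_tr) hu1; apply: (le_trans lt_tr) hu2.
(* Each [x] is sent to the least stage at which [B] converges on it. By [simlt] this stage lies
   strictly above some stage for each strict predecessor, hence above the least one. *)
have [h hh] : exists h : nat -> nat, forall x,
    [/\ Sim x (h x), wo_rel w (h x) (h x) & forall u, Sim x u -> wo_rel w u u -> wo_rel w (h x) u].
  apply: (choice (fun x m => [/\ Sim x m, wo_rel w m m & forall u, Sim x u -> wo_rel w u u -> wo_rel w m u])) => x.
  by apply: q5; case: (simall x) => v hv; exists v.
exists h; split=> [x _|x y hR hne]; first by case: (hh x).
case: (hh y) => hy _ _; have [u hu hsu] := simlt _ _ _ hR hne hy.
case: (hh x) => _ _ /(_ u hsu (fl _ _ hu)) hxu.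
case/andP: (hu) => /eqP huy /eqP nuy.
split; first exact: q3 hxu huy.
by move=> e'; apply: nuy; apply: q2 => //; rewrite -e'.
Qed.

Lemma computable_wo_rel w : wo_index w -> computable_rel Suslin [::] (wo_rel w).
Proof.
case=> ht _; have [e he] : pc 2 tt1 (fun r => run_val w [:: r 0; r 1] != 0).
  by pca => r _; apply: ht.
exists e => x y; have := he [::] [:: x; y] erefl Logic.I; rewrite /wo_rel /=.
by case: eqP => h; split.
Qed.

Lemma omega1_eq f : ~ exceptional f -> omega1_S_f_eq f.
Proof.
move=> hf; split=> R hR [e he].
  have [w hw hle] := otype_le_stage hf hR he.
  by exists (wo_rel w); split=> //; [case: hw | exact: computable_wo_rel].
exists R; split=> //; last by exists id; split.
by exists e => x y; case: (he x y) => h0 h1; split=> h; apply: Comp_nil; auto.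
Qed.

Theorem theorem6p5 : m_measure_one (fun f : cantor => omega1_S_f_eq f).
Proof.
move=> eps heps; have [s [h1 h2]] := exceptional_null heps.
exists s; split=> // f hf; apply: h1; apply: NNPP => hn.
exact: hf (omega1_eq hn).
Qed.
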